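(* Let $\Delta$ be an affine ordered hovel and let $G\le\mathrm{Aut}(\Delta)$ be a group of vectorially Weyl-automorphisms. Then the following conditions are equivalent: (i) $G$ is strongly transitive on $\Delta$; (ii) every local chamber of $\Delta$ is good (with respect to $G$); (iii) every sector-germ of $\Delta$ is good (with respect to $G$).
   Context: VECTORIAL DATA. $V$ is a finite dimensional real vector space, $I$ a finite non-empty set, $(\alpha_i)_{i\in I}$ a free family in $V^*$, $(\alpha_i^\vee)_{i\in I}$ a family in $V$ such that $\mathbb M=(\alpha_j(\alpha_i^\vee))_{i,j\in I}$ is a (possibly decomposable) generalized Cartan matrix. Put $r_i(v)=v-\alpha_i(v)\alpha_i^\vee$ and let $W^v\subset GL(V)$ be the group generated by the $r_i$. $\Phi=\{w(\alpha_i): w\in W^v,i\in I\}$ is the set of real roots; $\Phi_{im}\subset\bigoplus_i\mathbb Z\alpha_i\subset V^*$ is the set of imaginary roots of the Kac–Moody Lie algebra of $\mathbb M$. For $\alpha=w(\alpha_i)\in\Phi$, $\alpha^\vee=w(\alpha_i^\vee)$ and $r_\alpha(v)=v-\alpha(v)\alpha^\vee$. $C^v_f=\{v:\alpha_i(v)>0\ \forall i\}$. For $J\subset I$, $F^v(J)=\{v:\alpha_i(v)=0\ \forall i\in J,\ \alpha_i(v)>0\ \forall i\in I\setminus J\}$. Positive (negative) vectorial faces are the $w.F^v(J)$ (the $-w.F^v(J)$), $w\in W^v$; chambers if $J=\emptyset$, panels if $|J|=1$; spherical if $\langle r_i: i\in J\rangle$ is finite. $\mathcal T$ (resp. $\mathcal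 T^\circ$) is the union of all positive (resp. positive spherical) vectorial faces. MODEL APARTMENT. $\mathbb A$ is $V$ as an affine space with a set $\mathcal M$ of walls, hyperplanes of the form $M(\alpha,k)=\{v:\alpha(v)+k=0\}$, $\alpha\in\Phi$, $k\in\mathbb R$. Let $\Lambda_\alpha=\{k: M(\alpha,k)\in\mathcal M\}$ for $\alpha\in\Phi$ (assumed infinite and containing $0$), and $\Lambda_\alpha=\mathbb R$ for $\alpha\in\Phi_{im}$. $D(\alpha,k)=\{v:\alpha(v)+k\ge0\}$, $D(\alpha,\infty)=\mathbb A$. $W^a$ is the group generated by the affine reflections $r_M$ in walls $M=M(\alpha,k)$ (with linear part $r_\alpha$ and fixed set $M$); it is assumed to stabilize $\mathcal M$. $\mathrm{Aut}(\mathbb A)$ is the group of affine bijections stabilizing the set of pairs $(M,\alpha^\vee)$ with $M=M(\alpha,k)$, $\alpha\in\Phi$, $k\in\Lambda_\alpha$. Write $x\le y$ if $y-x\in\mathcal T$ and $x\stackrel{o}{<}y$ if $y-x\in\mathcal T^\circ$. FILTERS. A filter is contained in a set $S$ if $S$ belongs to it; $F\subset F'$ for filters if every member of $F'$ is a member of $F$; a map fixes a filter pointwise if it fixes pointwise some member. $\mathrm{germ}_x(S)$ is the filter of subsets containing the intersection of $S$ with a neighbourhood of $x$. The enclosure $cl_{\mathbb A}(F)$ is the filter of subsets containing some member of $F$ of the form $\bigcap_{\alpha\in\Phi\cup\Phi_{im}}D(\alpha,k_\alpha)$, $k_\alpha\in\Lambda_\alpha\cup\{\infty\}$. The support of $F$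 is the smallest affine subspace containing it. Local face: $F^\ell(x,F^v)=\mathrm{germ}_x(x+F^v)$ ($x\in\mathbb A$, $F^v$ a vectorial face); local chamber if $F^v$ is a chamber; closed face: enclosure of a local face. Sector: $Q=x+C^v$ with $C^v$ a vectorial chamber (base point $x$, direction $C^v$); the sector-germ of $Q$ is the filter of subsets of the apartment containing a translate of $Q$. Chimney: $\mathfrak r(F,F^v)=cl_{\mathbb A}(F+F^v)$, $F$ a local face, $F^v$ a vectorial face; splayed if $F^v$ is spherical; solid if (the direction of) its support has finite pointwise stabilizer in $W^v$; its germ is the filter of subsets containing $\mathfrak r(F+\xi,F^v)$ for some $\xi\in F^v$. A ray with origin $x$ containing $y\ne x$ (or interval $(x,y]$) is preordered if $x\le y$ or $y\le x$, generic if $x\stackrel{o}{<}y$ or $y\stackrel{o}{<}x$; the germ of $(x,y]$ is $\mathrm{germ}_x((x,y])$. HOVEL. An apartment of type $\mathbb A$ is a set $A$ with a set $Isom^w(\mathbb A,A)$ of bijections which is of the form $\{f_0\circ w: w\in W^a\}$. A bijection $\varphi:A\to A'$ of apartments is an isomorphism (resp. Weyl-isomorphism, vectorially Weyl-isomorphism) if $f'^{-1}\circ\varphi\circ f\in\mathrm{Aut}(\mathbb A)$ (resp. $W^a$, $(W^v\ltimes V)\cap\mathrm{Aut}(\mathbb A)$) for all $f\in Isom^w(\mathbb A,A)$, $f'\in Isom^w(\mathbb A,A')$. All notions above are transported to apartments. An affine ordered hovel of type $\mathbb A$ is a set $\Delta$ with a covering $\mathcal A$ by subsets (apartments) such that: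 (MA1) each $A\in\mathcal A$ has a structure of apartment of type $\mathbb A$; (MA2) if $F$ is a point, a germ of a preordered interval, a generic ray or a solid chimney in an apartment $A$ and $A'$ is another apartment containing $F$, then $A\cap A'\supset cl_A(F)$ and there is a Weyl-isomorphism $A\to A'$ fixing $cl_A(F)$ pointwise; (MA3) if $\mathfrak R$ is the germ of a splayed chimney and $F$ is a closed face or a germ of a solid chimney, some apartment contains $\mathfrak R$ and $F$; (MA4) if two apartments $A,A'$ contain such $\mathfrak R$ and $F$, then $A\cap A'\supset cl_A(\mathfrak R\cup F)$ and there is a Weyl-isomorphism $A\to A'$ fixing $cl_A(\mathfrak R\cup F)$ pointwise; (MAO) if $x,y\in A\cap A'$ and $x\le_A y$, then $[x,y]_A=[x,y]_{A'}$. $\mathrm{Aut}(\Delta)$ is the group of bijections $\varphi$ of $\Delta$ with $A\in\mathcal A\Leftrightarrow\varphi(A)\in\mathcal A$ and each $\varphi|_A:A\to\varphi(A)$ an isomorphism; $\varphi$ is vectorially Weyl if every $\varphi|_A$ is a vectorially Weyl-isomorphism. GOOD SUBSETS AND STRONG TRANSITIVITY. A subset or filter $\Omega$ of an apartment of $\Delta$ is good with respect to $G$ if, for any two apartments $A,A'$ containing $\Omega$, there is $g\in G$ fixing $\Omega$ pointwise such that $A'=g(A)$ and $g|_A:A\to A'$ is a Weyl-isomorphism. $G$ acts strongly transitively on $\Delta$ if every isomorphism involved in the axioms (MA2) and (MA4) may be chosen to be the restriction of an element of $G$; that is, each of the sets $cl_A(F)$ of (MA2) and $cl_A(\mathfrak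 R\cup F)$ of (MA4) is good with respect to $G$. *)

(* Defs.v *)
From mathcomp Require Import all_boot all_order all_algebra.
From mathcomp Require Import all_classical all_reals all_analysis.

Set Implicit Arguments.
Unset Strict Implicit.
Unset Printing Implicit Defensive.

Import Order.TTheory GRing.Theory Num.Theory.
Import numFieldNormedType.Exports.

Local Open Scope classical_set_scope.
Local Open Scope ring_scope.

Definition bij_group (T : Type) (G : set (T -> T)) : Prop :=
  [/\ forall g, G g -> bijective g,
      G id,
      forall g h, G g -> G h -> G (g \o h) &
      forall g h, G g -> cancel g h -> cancel h g -> G h].

Definition gen_group (T : Type) (S : set (T -> T)) : set (T -> T) :=
  smallest (@bij_group T) S.

Section KacMoody.
Context (R : realType) (I : finType).

Definition gen_cartan (a : I -> I -> R) : Prop :=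
  [/\ forall i, a i i = 2,
      forall i j, a i j \is a Num.int,
      forall i j, i != j -> a i j <= 0 &
      forall i j, a i j = 0 -> a j i = 0].

Section Lie.
Context (L : lmodType R) (br : L -> L -> L).

Definition lie_bracket : Prop :=
  [/\ forall x, linear (br x),
      forall y, linear (br^~ y),
      forall x, br x x = 0 &
      forall x y z, br x (br y z) + br y (br z x) + br z (br x y) = 0].

Definition linear_subspace (S : set L) : Prop :=
  S 0 /\ forall (c : R) x y, S x -> S y -> S (c *: x + y).

Definition lie_subalgebra (S : set L) : Prop :=
  linear_subspace S /\ forall x y, S x -> S y -> S (br x y).

Definition lie_ideal (S : set L) : Prop :=
  linear_subspace S /\ forall x y, S y -> S (br x y).

(* [(L, br)] is the Kac-Moody algebra g(a): the quotient of the Lie algebra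
   with generators [h], [e i], [f i] and the relations below by its largest
   ideal meeting [h] trivially, where [(H, p, pv)] is a minimal realization of
   the matrix [a] and [iota] embeds [H] as the Cartan subalgebra [h].  The
   conditions determine [L] up to isomorphism.  We use the split form over [R]:
   the set of roots does not depend on the ground field of characteristic 0. *)
Record kac_moody_algebra (a : I -> I -> R) (H : vectType R)
    (p : I -> 'Hom(H, R^o)) (pv : I -> H)
    (iota : H -> L) (e f : I -> L) : Prop := KacMoodyAlgebra {
  km_lie : lie_bracket;
  km_roots_free : free (codom p);
  km_coroots_free : free (codom pv);
  km_pairing : forall i j, p j (pv i) = a i j;
  km_dim : (\dim {: H} +
    \rank (\matrix_(i < #|I|, j < #|I|) a (enum_val i) (enum_val j))
    = 2 * #|I|)%N;
  km_iota_linear : linear iota;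
  km_iota_inj : injective iota;
  km_hh : forall h h', br (iota h) (iota h') = 0;
  km_he : forall h i, br (iota h) (e i) = (p i h : R) *: e i;
  km_hf : forall h i, br (iota h) (f i) = - (p i h : R) *: f i;
  km_ef : forall i j, br (e i) (f j) = if i == j then iota (pv i) else 0;
  km_generated : forall S, lie_subalgebra S ->
    range iota `<=` S -> range e `<=` S -> range f `<=` S -> S = setT;
  km_no_ideal : forall S, lie_ideal S ->
    S `&` range iota = [set 0] -> S = [set 0]
}.

End Lie.

(* [n : I -> int] stands for the element [\sum_i n_i alpha_i] of the root
   lattice. *)
Definition kac_moody_root (a : I -> I -> R) (n : I -> int) : Prop :=
  (exists i, n i != 0) /\
  exists (L : lmodType R) (br : L -> L -> L) (H : vectType R)
    (p : I -> 'Hom(H, R^o)) (pv : I -> H) (iota : H -> L) (e f : I -> L),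
    kac_moody_algebra br a p pv iota e f /\
    exists2 x : L, x != 0 &
      forall h, br (iota h) x = (\sum_i (n i)%:~R * (p i h : R)) *: x.

End KacMoody.

Record vectorial_data (R : realType) (V : vectType R) (I : finType) :=
  VectorialData {
    sroot : I -> 'Hom(V, R^o);
    scoroot : I -> V;
    index_nonempty : (0 < #|I|)%N;
    sroot_free : free (codom sroot);
    sroot_cartan : gen_cartan (fun i j => sroot j (scoroot i))
  }.

Section Vectorial.
Context (R : realType) (V : vectType R) (I : finType).
Variable D : vectorial_data V I.

Definition srefl (i : I) : V -> V :=
  fun v => v - (sroot D i v : R) *: scoroot D i.

Definition weyl : set (V -> V) := gen_group (range srefl).

(* [beta \o w = alpha_i] says that [beta] is the image of [alpha_i] under the
   contragredient action of [w]. *)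
Definition root_coroot (beta : 'Hom(V, R^o)) (h : V) : Prop :=
  exists w i, [/\ weyl w, (forall v, beta (w v) = sroot D i v) &
                  h = w (scoroot D i)].

Definition real_root : set 'Hom(V, R^o) :=
  [set beta | exists h, root_coroot beta h].

Definition imaginary_root : set 'Hom(V, R^o) :=
  [set beta | exists n : I -> int,
     [/\ kac_moody_root (fun i j => sroot D j (scoroot D i)) n,
         beta = \sum_i (n i)%:~R *: sroot D i &
         ~ real_root beta]].

Definition std_face (J : {set I}) : set V :=
  [set v | (forall i, i \in J -> sroot D i v = 0) /\
           (forall i, i \notin J -> 0 < (sroot D i v : R))].

(* [neg = false] gives the positive faces [w.F(J)], [neg = true] the negative
   faces [-w.F(J)]. *)
Definition face_of_type (neg : bool) (J : {set I}) (F : set V) : Prop :=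
  exists2 w, weyl w & F = [set (-1) ^+ neg *: w v | v in std_face J].

Definition spherical_type (J : {set I}) : Prop :=
  finite_set (gen_group [set srefl i | i in [set` J]]).

Definition vectorial_face (F : set V) : Prop :=
  exists neg J, face_of_type neg J F.

Definition spherical_face (F : set V) : Prop :=
  exists neg J, face_of_type neg J F /\ spherical_type J.

Definition vectorial_chamber (F : set V) : Prop :=
  exists neg, face_of_type neg finset.set0 F.

Definition tits_cone : set V :=
  [set v | exists J F, face_of_type false J F /\ F v].

Definition spherical_tits_cone : set V :=
  [set v | exists J F,
     [/\ face_of_type false J F, spherical_type J & F v]].

Definition tits_le (x y : V) : Prop := tits_cone (y - x).
Definition tits_lt (x y : V) : Prop := spherical_tits_cone (y - x).

End Vectorial.

Section Walls.
Context (R : realType) (V : vectType R) (I : finType).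
Variables (D : vectorial_data V I) (walls : set (set V)).

Definition wall (alpha : 'Hom(V, R^o)) (k : R) : set V :=
  [set v | (alpha v : R) + k = 0].

Definition wall_params (alpha : 'Hom(V, R^o)) : set R :=
  [set k | walls (wall alpha k)].

Definition affine_reflection (alpha : 'Hom(V, R^o)) (h : V) (k : R) : V -> V :=
  fun v => v - ((alpha v : R) + k) *: h.

Definition affine_weyl : set (V -> V) :=
  gen_group [set r | exists alpha h k,
    [/\ root_coroot D alpha h, wall_params alpha k &
        r = affine_reflection alpha h k]].

End Walls.

Record model_apartment (R : realType) (V : vectType R) (I : finType)
    (D : vectorial_data V I) := ModelApartment {
  walls : set (set V);
  walls_of_roots : forall M, walls M ->
    exists alpha k, real_root D alpha /\ M = wall alpha k;
  wall_params_infinite : forall alpha, real_root D alpha ->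
    infinite_set (wall_params walls alpha);
  wall_params0 : forall alpha, real_root D alpha ->
    wall_params walls alpha 0;
  walls_stable : forall w, affine_weyl D walls w ->
    forall M, walls M -> walls (w @` M)
}.

Section Model.
Context (R : realType) (V : vectType R) (I : finType).
Context (D : vectorial_data V I).
Variable AA : model_apartment D.

Definition Wa : set (V -> V) := affine_weyl D (walls AA).

Definition wall_coroot (M : set V) (h : V) : Prop :=
  exists alpha k, [/\ root_coroot D alpha h, wall_params (walls AA) alpha k &
                      M = wall alpha k].

Definition aut_model : set (V -> V) :=
  [set phi | bijective phi /\
     exists (l : 'End(V)) (t : V), (forall v, phi v = l v + t) /\
       forall M h, wall_coroot M h <-> wall_coroot (phi @` M) (l h)].

Definition vect_weyl_aut_model : set (V -> V) :=
  [set phi | aut_model phi /\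
     exists w t, weyl D w /\ forall v, phi v = w v + t].

(* Filters of subsets are [set_system]s; a filter [F] is contained in a set
   [S] when [F S], and a set [S] is identified with the filter [globally S]. *)

(* The neighbourhoods of [x] for the vector space topology of [V], transported
   from that of row vectors. *)
Definition vnbhs (x : V) : set_system V :=
  [set U | nbhs (VectorInternalTheory.v2r x)
                (VectorInternalTheory.r2v @^-1` U)].

Definition germ (x : V) (S : set V) : set_system V :=
  [set U | exists2 N, vnbhs x N & S `&` N `<=` U].

(* [None] encodes the value [oo]. *)
Definition half_apartment (alpha : 'Hom(V, R^o)) (k : option R) : set V :=
  [set v | if k is Some r then 0 <= (alpha v : R) + r else True].

Definition all_root : set 'Hom(V, R^o) := real_root D `|` imaginary_root D.

Definition admissible (alpha : 'Hom(V, R^o)) (k : option R) : Prop :=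
  if k is Some r
  then real_root D alpha -> wall_params (walls AA) alpha r
  else True.

Definition enclosure (F : set_system V) : set_system V :=
  [set U | exists k : 'Hom(V, R^o) -> option R,
     let E := \bigcap_(alpha in all_root) half_apartment alpha (k alpha) in
     [/\ forall alpha, all_root alpha -> admissible alpha (k alpha),
         F E & E `<=` U]].

Definition affine_subspace (x : V) (U : {vspace V}) : set V :=
  [set x + u | u in [set` U]].

Definition is_support (F : set_system V) (x : V) (U : {vspace V}) : Prop :=
  F (affine_subspace x U) /\
  forall y W, F (affine_subspace y W) ->
    affine_subspace x U `<=` affine_subspace y W.

Definition solid (F : set_system V) : Prop :=
  exists x U, is_support F x U /\
    finite_set [set w | weyl D w /\ forall u, u \in U -> w u = u].

Definition translate (x : V) (S : set V) : set V := [set x + v | v in S].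

Definition local_face (F : set_system V) : Prop :=
  exists x Fv, vectorial_face D Fv /\ F = germ x (translate x Fv).

Definition local_chamber (F : set_system V) : Prop :=
  exists x C, vectorial_chamber D C /\ F = germ x (translate x C).

Definition closed_face (F : set_system V) : Prop :=
  exists2 F0, local_face F0 & F = enclosure F0.

Definition sector_germ (F : set_system V) : Prop :=
  exists x C, vectorial_chamber D C /\
    F = [set U | exists t, translate t (translate x C) `<=` U].

Definition filter_add (F : set_system V) (S : set V) : set_system V :=
  [set U | exists2 N, F N & [set x + y | x in N & y in S] `<=` U].

Definition filter_translate (xi : V) (F : set_system V) : set_system V :=
  fmap (fun v => v + xi) F.

Definition chimney (F : set_system V) (Fv : set V) : set_system V :=
  enclosure (filter_add F Fv).

Definition chimney_germ (F : set_system V) (Fv : set V) : set_system V :=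
  [set U | exists2 xi, Fv xi & chimney (filter_translate xi F) Fv U].

Definition solid_chimney (C : set_system V) : Prop :=
  exists F Fv, [/\ local_face F, vectorial_face D Fv, C = chimney F Fv &
                   solid C].

Definition solid_chimney_germ (C : set_system V) : Prop :=
  exists F Fv, [/\ local_face F, vectorial_face D Fv, solid (chimney F Fv) &
                   C = chimney_germ F Fv].

Definition splayed_chimney_germ (C : set_system V) : Prop :=
  exists F Fv, [/\ local_face F, spherical_face D Fv & C = chimney_germ F Fv].

Definition segment (x y : V) : set V :=
  [set x + t *: (y - x) | t in [set t : R | 0 <= t <= 1]].

Definition segment_oc (x y : V) : set V :=
  [set x + t *: (y - x) | t in [set t : R | 0 < t <= 1]].

Definition ray (x y : V) : set V :=
  [set x + t *: (y - x) | t in [set t : R | 0 <= t]].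

Definition point_filter (F : set_system V) : Prop :=
  exists x : V, F = globally [set x].

Definition preordered_segment_germ (F : set_system V) : Prop :=
  exists x y, [/\ x <> y, tits_le D x y \/ tits_le D y x &
                  F = germ x (segment_oc x y)].

Definition generic_ray (F : set_system V) : Prop :=
  exists x y, [/\ x <> y, tits_lt D x y \/ tits_lt D y x &
                  F = globally (ray x y)].

Definition MA2_filter (F : set_system V) : Prop :=
  [\/ point_filter F, preordered_segment_germ F, generic_ray F |
      solid_chimney F].

Definition MA3_filter (F : set_system V) : Prop :=
  closed_face F \/ solid_chimney_germ F.

End Model.

Section Hovel.
Context (R : realType) (V : vectType R) (I : finType).
Context (D : vectorial_data V I).
Variables (AA : model_apartment D) (Delta : Type).

(* [charts A] is the set Isom^w(AA, A) of an apartment [A]. *)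
Record apartment_system := ApartmentSystem {
  apartments : set (set Delta);
  charts : set Delta -> set (V -> Delta)
}.

Definition apartment_structure (A : set Delta) (C : set (V -> Delta)) : Prop :=
  exists2 f0, set_bij setT A f0 & C = [set f0 \o w | w in Wa AA].

Definition fixes_filter (phi : Delta -> Delta) (F : set_system Delta) : Prop :=
  exists2 S, F S & forall x, S x -> phi x = x.

(* A filter in an apartment is also seen as a filter of subsets of [Delta]
   (through [fmap f], for a chart [f]), so that the apartment [A] contains the
   filter [F] when [F A]. *)
Definition filter_pullback (f : V -> Delta) (F : set_system Delta) :
    set_system V :=
  [set S | F (f @` S)].

(* The enclosure cl_A(F), transported by a chart [f] of the apartment [A]. *)
Definition chart_enclosure (f : V -> Delta) (F : set_system Delta) :
    set_system Delta :=
  fmap f (enclosure AA (filter_pullback f F)).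

Section System.
Variable S : apartment_system.

Definition in_apartment (A : set Delta) (P : set_system V -> Prop)
    (F : set_system Delta) : Prop :=
  exists f F0, [/\ charts S A f, P F0 & F = fmap f F0].

Definition in_hovel (P : set_system V -> Prop) (F : set_system Delta) : Prop :=
  exists2 A, apartments S A & in_apartment A P F.

(* An isomorphism of apartments is represented by a map on [Delta], of which
   only the restriction to [A] matters. *)
Definition apt_iso (K : set (V -> V)) (A A' : set Delta)
    (phi : Delta -> Delta) : Prop :=
  set_bij A A' phi /\
  forall f f', charts S A f -> charts S A' f' ->
    exists2 k, K k & forall v, phi (f v) = f' (k v).

Definition isomorphism := apt_iso (aut_model AA).
Definition weyl_isomorphism := apt_iso (Wa AA).
Definition vect_weyl_isomorphism := apt_iso (vect_weyl_aut_model AA).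

Record affine_ordered_hovel : Prop := AffineOrderedHovel {
  hovel_cover : forall x, exists2 A, apartments S A & A x;
  hovel_MA1 : forall A, apartments S A -> apartment_structure A (charts S A);
  hovel_MA2 : forall A A' F f,
    apartments S A -> apartments S A' -> charts S A f ->
    in_apartment A (MA2_filter AA) F -> F A' ->
    chart_enclosure f F (A `&` A') /\
    exists2 phi, weyl_isomorphism A A' phi &
      fixes_filter phi (chart_enclosure f F);
  hovel_MA3 : forall RR F,
    in_hovel (splayed_chimney_germ AA) RR -> in_hovel (MA3_filter AA) F ->
    exists A, [/\ apartments S A, RR A & F A];
  hovel_MA4 : forall RR F A A' f,
    in_hovel (splayed_chimney_germ AA) RR -> in_hovel (MA3_filter AA) F ->
    apartments S A -> apartments S A' -> charts S A f ->
    RR A -> F A -> RR A' -> F A' ->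
    chart_enclosure f (RR `&` F) (A `&` A') /\
    exists2 phi, weyl_isomorphism A A' phi &
      fixes_filter phi (chart_enclosure f (RR `&` F));
  hovel_MAO : forall A A' f f' x y x' y',
    apartments S A -> apartments S A' -> charts S A f -> charts S A' f' ->
    f x = f' x' -> f y = f' y' -> tits_le D x y ->
    f @` segment x y = f' @` segment x' y'
}.

Definition automorphism (phi : Delta -> Delta) : Prop :=
  [/\ bijective phi,
      forall A, apartments S A <-> apartments S (phi @` A) &
      forall A, apartments S A -> isomorphism A (phi @` A) phi].

Definition vectorially_weyl (phi : Delta -> Delta) : Prop :=
  forall A, apartments S A -> vect_weyl_isomorphism A (phi @` A) phi.

Section Group.
Variable G : set (Delta -> Delta).

(* For a subset [X] of an apartment, take [Omega := globally X]. *)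
Definition good (Omega : set_system Delta) : Prop :=
  forall A A', apartments S A -> apartments S A' -> Omega A -> Omega A' ->
    exists g, [/\ G g, fixes_filter g Omega, A' = g @` A &
                  weyl_isomorphism A A' g].

Definition strongly_transitive : Prop :=
  (forall A F f, apartments S A -> charts S A f ->
     in_apartment A (MA2_filter AA) F -> good (chart_enclosure f F)) /\
  (forall RR F A f,
     in_hovel (splayed_chimney_germ AA) RR -> in_hovel (MA3_filter AA) F ->
     apartments S A -> charts S A f -> RR A -> F A ->
     good (chart_enclosure f (RR `&` F))).

End Group.
End System.
End Hovel.

(* Main.v *)
(* Every root, real or imaginary, has a constant sign on each vectorial chamber.
   For real roots this is Tits' theorem; for imaginary roots it holds because the
   weights of a Kac-Moody algebra have coefficients of one sign and are permuted
   by the Weyl group. Hence an intersection of root half-spaces containing the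
   germ of a segment in a face contains the local face, and one containing a ray
   in a face contains the translate of the face.

   A Weyl-isomorphism of apartments is determined by its restriction to a local
   chamber or to a sector. Suppose that local chambers are good, and let A and A'
   share cl(RR u F) as in (MA4). Replace RR in A' and F in A by the filters RR+
   and F+ obtained by putting local chambers in place of their local faces. An
   apartment A1 containing RR+ and F+ is related to A and to A' by isomorphisms
   fixing a local chamber, which come from G, and their composite fixes
   cl(RR u F). Faces and solid chimneys are treated in the same way with a sector
   germ of A' as RR+.

   Suppose that sector germs are good, and let A and A' share the local chamber C
   at x. If xi is in the direction of C, real induction along the ray x - R+ xi of
   A' shows that each of its points lies, together with the segment to x, in an
   apartment containing the sector germ of A in the direction of C. Hence an
   apartment containing this sector germ and the opposite one of A' contains a
   segment of the ray around x, and is related to both A and A' by G. *)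

Require Import Defs.
From HB Require Import structures.
From mathcomp Require Import all_boot all_order all_algebra.
From mathcomp Require Import all_classical all_reals all_analysis.
From mathcomp Require Import lra zify.

Set Implicit Arguments.
Unset Strict Implicit.
Unset Printing Implicit Defensive.

Import Order.TTheory GRing.Theory Num.Theory.
Import numFieldNormedType.Exports VectorInternalTheory.

Local Open Scope classical_set_scope.
Local Open Scope ring_scope.

(** * Linear forms and the vectorial Weyl group *)

Section GenGroup.
Context (T : Type).

(** Apartments are compared through charts: [conn f f'] says that [f'] is [f] followed by an element
    of [G]. For a filter that spans, goodness makes any two charts agreeing on it connected. On a
    smaller filter agreeing charts may differ by an affine Weyl element fixing the filter, which
    [conn_filter] allows for. Enclosures involve all roots, possibly infinitely many, so everything
    is tested root by root; uniform bounds come from the integrality of coefficients and from the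
    finite number of orbits of real roots. The sign of imaginary roots has to be extracted from the
    generators of the Kac-Moody algebra and from the absence of ideals meeting the Cartan subalgebra
    trivially, hence the Serre relations, local nilpotence and [sl2] strings. (MA3) and (MA4) accept
    germs of chimneys where (MA2) has whole chimneys: gluing yields an element fixing the germ only,
    and the bounded gaps between walls bring this back to the chimney. In the real induction,
    passing a point downwards could fold the ray, since the old and the new chart share no segment
    below that point; (MAO) excludes the fold. *)

Lemma bij_group_inv (G : set (T -> T)) g : bij_group G -> G g ->
  exists h, [/\ G h, cancel g h & cancel h g].
Proof.
case=> bG _ _ iG Gg; have [h gK hK] := bG _ Gg.
by exists h; split=> //; exact: iG Gg gK hK.
Qed.

Lemma all_bij_group : bij_group [set g : T -> T | bijective g].
Proof.
split=> //.
- by exists id.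
- by move=> g h /= bg bh; exact: bij_comp.
- by move=> g h _ gK hK; exists g.
Qed.

Lemma gen_group_bij (S : set (T -> T)) : (forall g, S g -> bijective g) ->
  bij_group (gen_group S).
Proof.
move=> bS; have allS : [set M | bij_group M /\ S `<=` M]
    [set g : T -> T | bijective g] by split; [exact: all_bij_group|].
split.
- by move=> g /(_ _ allS).
- by move=> M [[]].
- by move=> g h Gg Gh M MS; have [[_ _ cM _] _] := MS; apply: cM; [exact: Gg|exact: Gh].
- by move=> g h Gg gK hK M MS; have [[_ _ _ iM] _] := MS; apply: iM gK hK; exact: Gg.
Qed.

Lemma sub_gen_group (S : set (T -> T)) : S `<=` gen_group S.
Proof. exact: sub_gen_smallest. Qed.

Lemma gen_group_min (S G : set (T -> T)) : bij_group G -> S `<=` G ->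
  gen_group S `<=` G.
Proof. by move=> bG SG; apply: smallest_sub. Qed.

End GenGroup.

(* The value of a linear form, retyped from [R^o] to [R] for the arithmetic
   tactics. *)
Definition ev (R : realType) (V : vectType R) (a : 'Hom(V, R^o)) (v : V) : R :=
  a v.

Section Ev.
Context (R : realType) (V : vectType R).
Implicit Types (a : 'Hom(V, R^o)) (u v : V) (c : R).

Lemma ev0 a : ev a 0 = 0. Proof. exact: linear0. Qed.
Lemma evD a u v : ev a (u + v) = ev a u + ev a v. Proof. exact: linearD. Qed.
Lemma evB a u v : ev a (u - v) = ev a u - ev a v. Proof. exact: linearB. Qed.
Lemma evN a v : ev a (- v) = - ev a v. Proof. exact: linearN. Qed.
Lemma evZ a c v : ev a (c *: v) = c * ev a v. Proof. exact: linearZ. Qed.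
Lemma ev_sum (J : finType) a (F : J -> V) : ev a (\sum_i F i) = \sum_i ev a (F i).
Proof. exact: linear_sum. Qed.

Lemma ev_inj a a' : ev a =1 ev a' -> a = a'.
Proof. by move=> h; apply/lfunP => v; exact: h. Qed.

Lemma ev_lc (J : finType) (c : J -> R) (a : J -> 'Hom(V, R^o)) v :
  ev (\sum_i c i *: a i) v = \sum_i c i * ev (a i) v.
Proof.
by rewrite /ev sum_lfunE; apply: eq_bigr => i _; rewrite scale_lfunE.
Qed.

Lemma ev_neg a v : ev (- a) v = - ev a v.
Proof. by rewrite /ev opp_lfunE. Qed.

End Ev.

Definition evE := (ev0, evD, evB, evN, evZ, ev_neg).

(** * Free families of linear forms *)

Section FreeForms.
Context (R : realType) (V : vectType R) (I : finType).

(** In coordinates the forms are the columns of [A]; freeness makes the columns independent, so the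
    rows span and every row of prescribed values is attained. *)
Lemma free_codom_dual (a : I -> 'Hom(V, R^o)) (c : I -> R) :
  free (codom a) -> exists v, forall i, ev (a i) v = c i.
Proof.
move=> fa.
pose A := \matrix_(k < dim V, i < #|I|)
  ev (a (enum_val i)) (r2v (delta_mx 0 k)).
have evA i v : ev (a (enum_val i)) v = (v2r v *m A) 0 i.
  rewrite -[in LHS](v2rK v).
  rewrite [v2r v in LHS]row_sum_delta linear_sum ev_sum mxE.
  by apply: eq_bigr => k _; rewrite linearZ evZ mxE.
have fullA : row_full A.
  rewrite -col_leq_rank -mxrank_tr row_leq_rank; apply: inj_row_free => k kA0.
  have /(@freeP _ _ _ (codom_tuple a)) /(_ (fun i => k 0 i)) k0 := fa.
  apply/rowP => i; rewrite mxE; apply: k0; apply/lfunP => v.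
  rewrite sum_lfunE zero_lfunE.
  have : (k *m A^T *m (v2r v)^T) 0 0 = 0 by rewrite kA0 mul0mx mxE.
  rewrite -mulmxA -trmx_mul mxE => kv0; rewrite -[RHS]kv0.
  apply: eq_bigr => j _; rewrite scale_lfunE mxE -evA /ev.
  by rewrite (nth_map (enum_val j)) -?cardE // -enum_val_nth.
have /submxP[B defB] := submx_full (\row_i c (enum_val i)) fullA.
exists (r2v B) => i.
rewrite -(enum_rankK i) evA r2vK -defB mxE.
by rewrite enum_rankK.
Qed.

Lemma free_codom_coef (a : I -> 'Hom(V, R^o)) (c d : I -> R) :
  free (codom a) ->
  (forall v, \sum_i c i * ev (a i) v = \sum_i d i * ev (a i) v) -> c =1 d.
Proof.
move=> fa h i; have [v hv] := free_codom_dual (fun j => (i == j)%:R) fa.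
have := h v.
rewrite (bigD1 i) //= [in RHS](bigD1 i) //= hv eqxx !mulr1 !big1 ?addr0 // => j.
  by rewrite hv eq_sym => /negbTE ->; rewrite mulr0.
by rewrite hv eq_sym => /negbTE ->; rewrite mulr0.
Qed.

End FreeForms.

(** * The vectorial Weyl group: reduced words and signs of roots *)

Section Weyl.
Context (R : realType) (V : vectType R) (I : finType) (D : vectorial_data V I).
Local Notation al i := (ev (sroot D i)).
Local Notation cr := (scoroot D).
Local Notation r := (srefl D).

Lemma al_cr i : al i (cr i) = 2.
Proof. by have [+ _ _ _] := sroot_cartan D; exact. Qed.

Lemma sreflE i v : r i v = v - al i v *: cr i. Proof. by []. Qed.

Lemma ev_srefl a i v : ev a (r i v) = ev a v - al i v * ev a (cr i).
Proof. by rewrite sreflE !evE. Qed.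

Lemma al_srefl i v : al i (r i v) = - al i v.
Proof. by rewrite ev_srefl al_cr; lra. Qed.

Lemma sreflK i : involutive (r i).
Proof.
by move=> v; rewrite [LHS]sreflE al_srefl sreflE scaleNr opprK subrK.
Qed.

Lemma srefl_linear i : linear (r i).
Proof.
move=> c u v; rewrite !sreflE evD evZ scalerDl scalerBr scalerA.
by rewrite opprD addrACA.
Qed.

Definition word (s : seq I) : V -> V := foldr (fun i w => r i \o w) id s.

Lemma word_cat s t : word (s ++ t) = word s \o word t.
Proof. by elim: s => //= i s ->. Qed.

Lemma word_revK s : cancel (word s) (word (rev s)).
Proof.
elim: s => // i s IH v; rewrite rev_cons -cats1 word_cat /=.
by rewrite sreflK IH.
Qed.

Lemma word_revVK s : cancel (word (rev s)) (word s).
Proof. by rewrite -{2}(revK s); exact: word_revK. Qed.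

Lemma word_linear s : linear (word s).
Proof. by elim: s => // i s IH c u v /=; rewrite IH srefl_linear. Qed.

Lemma weylP w : weyl D w <-> exists s, w = word s.
Proof.
have bij_r g : range r g -> bijective g.
  by case=> i _ <-; exists (r i); exact: sreflK.
have [_ W1 WM _] := gen_group_bij bij_r.
split=> [|[s ->]]; last first.
  by elim: s => //= i s IH; apply: WM => //; apply: sub_gen_group; exists i.
move: w; apply: gen_group_min => [|_ [i _ <-]]; last by exists [:: i].
split=> [_ [s ->]||_ _ [s ->] [t ->]|_ h [s ->] sK hK].
- by exists (word (rev s)); [exact: word_revK|exact: word_revVK].
- by exists [::].
- by exists (s ++ t); rewrite word_cat.
- exists (rev s); apply/funext => v.
  by rewrite -{1}(word_revVK s v) sK.
Qed.

Lemma weyl_group : bij_group (weyl D).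
Proof. by apply: gen_group_bij => _ [i _ <-]; exists (r i); exact: sreflK. Qed.

Lemma weyl_id : weyl D id. Proof. by have [] := weyl_group. Qed.

Lemma weyl_comp w w' : weyl D w -> weyl D w' -> weyl D (w \o w').
Proof. by have [_ _ + _] := weyl_group; exact. Qed.

Lemma weyl_srefl i : weyl D (r i).
Proof. by apply/weylP; exists [:: i]. Qed.

Lemma weyl_linear w : weyl D w -> linear w.
Proof. by move=> /weylP[s ->]; exact: word_linear. Qed.

Lemma linear_lfun (U W : vectType R) (f : U -> W) : linear f ->
  exists l : 'Hom(U, W), forall v, f v = l v.
Proof.
move=> lf; pose F : {linear U -> W} := HB.pack f (GRing.isLinear.Build _ _ _ _ f lf).
by exists (linfun F) => v; rewrite lfunE.
Qed.

(* [p x^2 + q y^2 - p b x y], half the squared length of [x alpha_i + y alpha_j]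
   for a suitable invariant form of rank two, takes the value [p] on the orbit
   of [alpha_i]; for integers [x, y] of opposite signs it exceeds [p]. *)
Lemma rank2_exchange i j (d : seq I) : i != j -> {subset d <= [:: i; j]} ->
  (exists x y : R, [/\ 0 <= x, 0 <= y &
     forall v, al i (word d v) = x * al i v + y * al j v]) \/
  (exists d', (size d' < size d)%N /\ r i \o word d = word d').
Proof.
move=> ij; have [ca2 caZ caN ca0] := sroot_cartan D.
pose b := - al j (cr i); pose b' := - al i (cr j).
have b0 : 0 <= b by rewrite oppr_ge0; exact: caN.
have b0' : 0 <= b' by rewrite oppr_ge0; apply: caN; rewrite eq_sym.
have bZ : b \is a Num.int by rewrite rpredN; exact: caZ.
have bZ' : b' \is a Num.int by rewrite rpredN; exact: caZ.
have bb' : b = 0 -> b' = 0.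
  by move=> /eqP; rewrite oppr_eq0 => /eqP /ca0; rewrite /b' /ev => ->; rewrite oppr0.
have b'b : b' = 0 -> b = 0.
  by move=> /eqP; rewrite oppr_eq0 => /eqP /ca0; rewrite /b /ev => ->; rewrite oppr0.
(* A Cartan matrix of rank two is symmetrizable; if [b = 0] then [b' = 0] and any positive weights
   do. *)
have [p [q [p0 q0 pbqb]]] : exists p q : R, [/\ 0 < p, 0 < q & p * b = q * b'].
  have [b0E|bn0] := eqVneq b 0.
    by exists 1, 1; split=> //; rewrite b0E (bb' b0E).
  exists b', b; split; [|by rewrite lt_neqAle eq_sym bn0|by rewrite mulrC].
  by rewrite lt_neqAle b0' andbT eq_sym; apply: contra bn0 => /eqP/b'b ->.
have alji v : al j (r i v) = al j v + b * al i v by rewrite ev_srefl /b; lra.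
have alij v : al i (r j v) = al i v + b' * al j v by rewrite ev_srefl /b'; lra.
have crji : r i (cr j) = cr j + b' *: cr i by rewrite sreflE scaleNr.
have crij : r j (cr i) = cr i + b *: cr j by rewrite sreflE scaleNr.
have crii k : r k (cr k) = - cr k.
  by rewrite sreflE al_cr -addn1 natrD scalerDl scale1r opprD addrA subrr add0r.
have int1 (x : R) : x \is a Num.int -> 0 < x -> 1 <= x.
  by move=> /intrP[z ->]; rewrite ltr0z ler1z.
have intN1 (x : R) : x \is a Num.int -> x < 0 -> x <= -1.
  by move=> xZ x0; rewrite lerNr int1 ?rpredN // oppr_gt0.
(* Strengthened for the induction on the last letter: [x] and [y] are integers of norm [p], and
   [(p x) cr i + (q y) cr j], which is [p] times the coroot of [x alpha_i + y alpha_j], is carried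
   to [p cr i]. *)
suff : {subset d <= [:: i; j]} ->
  (exists x y : R, [/\ [/\ x \is a Num.int, y \is a Num.int, 0 <= x & 0 <= y],
     p * x * x + q * y * y - p * b * x * y = p,
     word d ((p * x) *: cr i + (q * y) *: cr j) = p *: cr i &
     forall v, al i (word d v) = x * al i v + y * al j v]) \/
  (exists d', (size d' < size d)%N /\ r i \o word d = word d').
  move=> h /h [[x [y [[_ _ x0 y0] _ _ e]]]|]; last by right.
  by left; exists x, y.
elim/last_ind: d => [_|d s IH sub].
  left; exists 1, 0; split.
  - by rewrite ?ler01; split.
  - by lra.
  - by rewrite /= mulr0 scale0r addr0 mulr1.
  - by move=> v /=; lra.
have wrc v : word (rcons d s) v = word d (r s v) by rewrite -cats1 word_cat.
have subd : {subset d <= [:: i; j]}.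
  by move=> k kd; apply: sub; rewrite mem_rcons inE kd orbT.
have linw := word_linear d.
pose W : {linear V -> V} := HB.pack (word d) (GRing.isLinear.Build _ _ _ _ (word d) linw).
have WE v : word d v = W v by [].
have [[x [y [[xZ yZ x0 y0] Nxy th e]]]|[d' [dd' e]]] := IH subd; last first.
  right; exists (rcons d' s); split; first by rewrite !size_rcons.
  by apply/funext => v /=; rewrite wrc -cats1 word_cat /= -e.
have /orP[/eqP si|/eqP sj] : (s == i) || (s == j).
  by have := sub s; rewrite mem_rcons !inE eqxx; apply.
- subst s; pose x' := b * y - x.
  have x'Z : x' \is a Num.int by rewrite rpredB // rpredM.
  have N' : p * x' * x' + q * y * y - p * b * x' * y = p by rewrite -[RHS]Nxy /x'; lra.
  have [x'0|x'0] := leP 0 x'.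
    left; exists x', y; split => //.
    + rewrite wrc -[RHS]th; congr (word d _).
      rewrite srefl_linear [r i ((q * y) *: _)](_ : _ = (q * y) *: r i (cr j)); last first.
        by rewrite -[_ *: cr j]addr0 srefl_linear [r i 0]sreflE ev0 scale0r subr0 addr0.
      rewrite crii crji scalerN -scaleNr scalerDr scalerA addrCA -scalerDl addrC.
      by congr (_ *: _ + _); rewrite /x'; move: pbqb; nra.
    + by move=> v; rewrite wrc e al_srefl alji /x'; lra.
  have yE : y = 0.
    apply/eqP; rewrite eq_le y0 andbT leNgt; apply/negP => y1.
    have := int1 _ yZ y1; have := intN1 _ x'Z x'0 => x'1 y2.
    have h1 : 0 <= p * b * (- x') * y by rewrite !mulr_ge0 // ?ltW // oppr_gt0.
    have h2 : 0 < q * y * y by rewrite !mulr_gt0.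
    have x'2 : 1 <= x' * x' by nra.
    have h3 : p <= p * x' * x' by rewrite -mulrA ler_peMr // ltW.
    by lra.
  (* Now [x^2 = 1] and [word d] maps [cr i] to [x cr i], so [r i] commutes with [word d], and a
     letter [i] put in front cancels the last one. *)
  right; exists d; split; first by rewrite size_rcons.
  have x2 : x * x = 1.
    apply: (mulfI (lt0r_neq0 p0)); rewrite mulr1 mulrA -[RHS]Nxy yE; lra.
  have wi : word d (cr i) = x *: cr i.
    apply: (scalerI (lt0r_neq0 p0)); apply: (scalerI (a := x)).
      by apply/eqP => xE; move: x2; rewrite xE mulr0; lra.
    move: th; rewrite yE mulr0 scale0r addr0 !WE linearZ /= !scalerA => th.
    by rewrite [x * p]mulrC th -mulrA x2 mulr1.
  apply/funext => v /=; rewrite wrc [LHS]sreflE e al_srefl yE mul0r addr0.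
  rewrite [r i v in LHS]sreflE !WE linearB linearZ /= wi.
  by rewrite mulrN scaleNr opprK scalerA [al i v * x]mulrC subrK.
- subst s; pose y' := b' * x - y.
  have y'Z : y' \is a Num.int by rewrite rpredB // rpredM.
  have N' : p * x * x + q * y' * y' - p * b * x * y' = p.
    by rewrite -[RHS]Nxy /y' pbqb; lra.
  have [y'0|y'0] := leP 0 y'.
    left; exists x, y'; split => //.
    + rewrite wrc -[RHS]th; congr (word d _).
      rewrite srefl_linear [r j ((q * _) *: _)](_ : _ = (q * y') *: r j (cr j)); last first.
        by rewrite -[_ *: cr j]addr0 srefl_linear [r j 0]sreflE ev0 scale0r subr0 addr0.
      rewrite crii crij scalerN -scaleNr scalerDr scalerA -addrA -scalerDl.
      by congr (_ + _ *: _); rewrite /y'; move: pbqb; nra.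
    + by move=> v; rewrite wrc e al_srefl alij /y'; lra.
  have xE : x = 0.
    apply/eqP; rewrite eq_le x0 andbT leNgt; apply/negP => x1.
    have := int1 _ xZ x1; have := intN1 _ y'Z y'0 => y'1 x2.
    have h1 : 0 <= p * b * x * (- y') by rewrite !mulr_ge0 // ?ltW // oppr_gt0.
    have h2 : 0 < q * y' * y' by rewrite -mulrA mulr_gt0 // nmulr_lgt0.
    have x'2 : 1 <= x * x by nra.
    have h3 : p <= p * x * x by rewrite -mulrA ler_peMr // ltW.
    by lra.
  (* Here [word d] conjugates [r j] into [r i], so a letter [i] put in front cancels the last letter
     [j]. *)
  right; exists d; split; first by rewrite size_rcons.
  have y2 : q * y * y = p by rewrite -[RHS]Nxy xE; lra.
  have wi : word d (cr j) = y *: cr i.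
    have yn0 : y != 0 by apply/eqP => yE; move: y2; rewrite yE mulr0; lra.
    apply: (scalerI (a := q * y)); first by rewrite mulf_neq0 // gt_eqF.
    move: th; rewrite xE mulr0 scale0r add0r !WE linearZ /= => ->.
    by rewrite scalerA y2.
  apply/funext => v /=; rewrite wrc [LHS]sreflE e al_srefl xE mul0r add0r.
  rewrite [r j v in LHS]sreflE !WE linearB linearZ /= wi.
  by rewrite mulrN scaleNr opprK scalerA [al j v * y]mulrC subrK.
Qed.

Definition reduced (s : seq I) : Prop :=
  forall t, word t = word s -> (size s <= size t)%N.

Definition nonneg_form (phi : V -> R) : Prop :=
  exists c : I -> R, (forall i, 0 <= c i) /\
    forall v, phi v = \sum_i c i * al i v.

Lemma exists_reduced w : weyl D w -> exists2 s, w = word s & reduced s.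
Proof.
move=> /weylP[s0 ws0].
have ex : exists n, `[< exists2 s, w = word s & size s = n >].
  by exists (size s0); apply/asboolP; exists s0.
case: (ex_minnP ex) => n /asboolP[s ws sn] nmin; exists s => // t ts.
by rewrite sn; apply: nmin; apply/asboolP; exists t; rewrite // ts.
Qed.

Lemma sreflcK i (w : V -> V) : r i \o (r i \o w) = w.
Proof. by apply/funext => v /=; rewrite sreflK. Qed.

(** With [j] the first letter of [s], split off a prefix [d] in the letters [i], [j], leaving [u] as
    short as possible. Neither [r i] nor [r j] shortens [u], so by induction [alpha_i o u] and
    [alpha_j o u] are nonnegative, and the question is reduced to [d], in rank two. *)
Lemma reduced_nonneg s i : reduced s ->
  (forall t, word t = r i \o word s -> (size s <= size t)%N) ->
  nonneg_form (fun v => al i (word s v)).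
Proof.
move: i; have [n] := ubnP (size s); elim: n s => // n IH s sn i reds reds_i.
case: s sn reds reds_i => [|j s'] sn reds reds_i.
  exists (fun k => (k == i)%:R); split=> [k|v] /=; first exact: ler0n.
  rewrite (bigD1 i) //= eqxx mul1r big1 ?addr0 // => k /negbTE ->.
  by rewrite mul0r.
set s := j :: s' in sn reds reds_i *.
have ij : i != j.
  apply/eqP => ij; subst j.
  have := reds_i s' _; rewrite /= sreflcK => /(_ erefl).
  by rewrite ltnn.
pose P m := `[< exists (d u : seq I), [/\ {subset d <= [:: i; j]},
  word d \o word u = word s, (size d + size u)%N = size s & size u = m] >].
have exP : exists m, P m.
  exists (size s'); apply/asboolP; exists [:: j], s'; split=> //.
  by move=> k; rewrite !inE => ->; rewrite orbT.
have [m /asboolP[d [u [dij dus sdu um]]] mmin] := ex_minnP exP.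
have um' : (size u <= size s')%N.
  rewrite um; apply: mmin; apply/asboolP; exists [:: j], s'; split=> //.
  by move=> k; rewrite !inE => ->; rewrite orbT.
have redu : reduced u.
  move=> t tu; rewrite -(leq_add2l (size d)) sdu -size_cat.
  by apply: reds; rewrite word_cat tu.
have redu_k k : k \in [:: i; j] ->
    forall t, word t = r k \o word u -> (size u <= size t)%N.
  move=> kij t tu; rewrite leqNgt; apply/negP => tltu.
  have e : word (rcons d k) \o word t = word s.
    by rewrite tu -dus -cats1 word_cat; apply/funext => v /=; rewrite sreflK.
  have le1 : (size s <= (size d).+1 + size t)%N.
    by rewrite -(size_rcons d k) -size_cat; apply: reds; rewrite word_cat.
  have : (m <= size t)%N.
    apply: mmin; apply/asboolP; exists (rcons d k), t; split=> //.
    - by move=> l; rewrite mem_rcons inE => /predU1P[->//|/dij].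
    - by rewrite size_rcons; move: le1 tltu sdu; lia.
  by move: tltu; rewrite um; lia.
have un : (size u < n)%N by apply: leq_ltn_trans um' _; move: sn; rewrite /s /=; lia.
have [ci [ci0 eci]] := IH u un i redu (redu_k i (mem_head _ _)).
have [cj [cj0 ecj]] : nonneg_form (fun v => al j (word u v)).
  by apply: IH => //; apply: redu_k; rewrite !inE eqxx orbT.
have [[x [y [x0 y0 e]]]|[d' [dd' e]]] := rank2_exchange ij dij.
  exists (fun k => x * ci k + y * cj k); split=> [k|v].
    by rewrite addr_ge0 ?mulr_ge0.
  rewrite -dus /= e eci ecj !mulr_sumr -big_split /=.
  by apply: eq_bigr => k _; rewrite mulrDl !mulrA.
have := reds_i (d' ++ u); rewrite word_cat -e -dus => /(_ erefl).
by rewrite size_cat => le; exfalso; move: le dd' sdu; lia.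
Qed.

(** If left multiplication by [r i] shortens [w], the length criterion applies to [r i o w] instead,
    and [r i] changes the sign of [alpha_i]. *)
Lemma weyl_coherent w i : weyl D w ->
  nonneg_form (fun v => al i (w v)) \/ nonneg_form (fun v => - al i (w v)).
Proof.
move=> ww; have [s ws reds] := exists_reduced ww.
have [h|/existsNP[t /not_implyP[e /negP]]] :=
  pselect (forall t, word t = r i \o word s -> (size s <= size t)%N).
  by left; rewrite ws; exact: reduced_nonneg.
rewrite -ltnNge => ts; right.
have [t' wt' redt'] : exists2 s, r i \o w = word s & reduced s.
  by apply: exists_reduced; apply: weyl_comp => //; exact: weyl_srefl.
have -> : (fun v => - al i (w v)) = (fun v => al i (word t' v)).
  by apply/funext => v; rewrite -wt' /= al_srefl.
apply: reduced_nonneg => // t2 e2; rewrite ltnW //.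
apply: (@leq_ltn_trans (size t)); first by apply: redt'; rewrite e -ws wt'.
by apply: leq_trans ts _; apply: reds; rewrite e2 -wt' sreflcK.
Qed.

Lemma reduced_cons i s : reduced (i :: s) ->
  reduced s /\ nonneg_form (fun v => - al i (word (i :: s) v)).
Proof.
move=> reds; have reds' : reduced s.
  by move=> t ts; rewrite -ltnS; apply: (reds (i :: t)); rewrite /= ts.
split=> //.
have -> : (fun v => - al i (word (i :: s) v)) = (fun v => al i (word s v)).
  by apply/funext => v /=; rewrite al_srefl opprK.
by apply: reduced_nonneg => // t ts; rewrite ltnW // reds.
Qed.

Lemma weyl_chamber_id w v : weyl D w -> (forall i, 0 < al i v) ->
  (forall i, 0 < al i (w v)) -> w = id.
Proof.
move=> ww v0 wv0; have [[|i s] ws reds] := exists_reduced ww; first by [].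
have [_ [c [c0 e]]] := reduced_cons reds.
have : 0 <= - al i (w v).
  by rewrite ws e sumr_ge0 // => k _; rewrite mulr_ge0 // ltW.
by rewrite oppr_ge0 leNgt wv0.
Qed.

(** If [i] is the first letter of a reduced word of [w], then [alpha_i o w] is nonpositive on the
    closed dominant chamber. At the fixed dominant point [v] this forces [alpha_i(v) = 0], and the
    letter can be removed. *)
Lemma weyl_fixer w v : weyl D w -> (forall i, 0 <= al i v) -> w v = v ->
  gen_group [set r i | i in [set i | al i v = 0]] w.
Proof.
move=> ww v0; have [s -> reds] := exists_reduced ww.
have bg : bij_group (gen_group [set r i | i in [set i | al i v = 0]]).
  by apply: gen_group_bij => _ [i _ <-]; exists (r i); exact: sreflK.
have [_ id_g comp_g _] := bg.
elim: s reds => [|i s IH] reds wv //.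
have [reds' [c [c0 e]]] := reduced_cons reds.
have alv : al i v = 0.
  apply/eqP; rewrite eq_le v0 andbT -oppr_ge0 -{1}wv e sumr_ge0 // => k _.
  by rewrite mulr_ge0.
apply: comp_g; first by apply: sub_gen_group; exists i.
apply: IH => //; rewrite -[LHS](sreflK i) [r i (word s v)]wv.
by rewrite sreflE alv scale0r subr0.
Qed.

Lemma weyl_integral w i : weyl D w ->
  exists n : I -> int, forall v, al i (w v) = \sum_j (n j)%:~R * al j v.
Proof.
move=> /weylP[s ->]; elim/last_ind: s => [|s k [n e]].
  exists (fun j => (j == i)%:R : int) => v /=.
  rewrite (bigD1 i) //= eqxx mul1r big1 ?addr0 // => j /negbTE ->.
  by rewrite mul0r.
have [_ caZ _ _] := sroot_cartan D.
have /choice[m em] j : exists m : int, al j (cr k) = m%:~R.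
  by have /intrP := caZ k j.
exists (fun j => n j - (j == k)%:R * \sum_l n l * m l) => v.
rewrite -cats1 word_cat /= e.
transitivity (\sum_j ((n j)%:~R * al j v - (n j * m j)%:~R * al k v)).
  apply: eq_bigr => j _; rewrite (ev_srefl (sroot D j) k v) em intrM; lra.
transitivity (\sum_j ((n j)%:~R * al j v -
    (j == k)%:R * (\sum_l n l * m l)%:~R * al j v)); last first.
  by apply: eq_bigr => j _; rewrite intrB intrM mulrBl; case: (j == k).
rewrite !big_split /= !sumrN; congr (_ - _).
rewrite [RHS](bigD1 k) //= eqxx mul1r [X in _ + X]big1 ?addr0; last first.
  by move=> j /negbTE ->; rewrite !mul0r.
by rewrite rmorph_sum mulr_suml.
Qed.

Definition coherent (n : I -> int) : Prop :=
  (forall i, 0 <= n i) \/ (forall i, n i <= 0).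

Lemma weyl_root_coherent w i : weyl D w -> exists n : I -> int,
  coherent n /\ forall v, al i (w v) = \sum_j (n j)%:~R * al j v.
Proof.
move=> ww; have [n e] := weyl_integral i ww; exists n; split=> //.
have [[c [c0 ec]]|[c [c0 ec]]] := weyl_coherent i ww.
  left=> j; rewrite -(ler0z R).
  have -> : (n j)%:~R = c j; last by [].
  apply: (free_codom_coef (c := fun j => (n j)%:~R) (sroot_free D)) => v.
  by rewrite -e -ec.
right=> j; rewrite -(lerz0 R).
have -> : (n j)%:~R = - c j; last by rewrite oppr_le0.
apply: (free_codom_coef (c := fun j => (n j)%:~R) (d := fun j => - c j)
  (sroot_free D)) => v.
by rewrite -e -[LHS]opprK ec -sumrN; apply: eq_bigr => k _; rewrite mulNr.
Qed.

End Weyl.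

(** * Roots of Kac-Moody algebras *)

Section KacMoodyAlgebra.
Context (R : realType) (I : finType) (L : lmodType R) (br : L -> L -> L).
Context (a : I -> I -> R) (H : vectType R).
Context (p : I -> 'Hom(H, R^o)) (pv : I -> H).
Context (iota : H -> L) (e f : I -> L).
Hypothesis ca : gen_cartan a.
Hypothesis km : kac_moody_algebra br a p pv iota e f.
Local Notation P i := (ev (p i)).

Lemma brlin x c y z : br x (c *: y + z) = c *: br x y + br x z.
Proof. by have [h _ _ _] := km_lie km; exact: h. Qed.

Lemma brxx x : br x x = 0.
Proof. by have [_ _ h _] := km_lie km; exact: h. Qed.

Lemma brD x y z : br x (y + z) = br x y + br x z.
Proof. by rewrite -[y in LHS]scale1r brlin scale1r. Qed.

Lemma br0 x : br x 0 = 0.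
Proof. by apply: (addrI (br x 0)); rewrite -brD !addr0. Qed.

Lemma brZ x c y : br x (c *: y) = c *: br x y.
Proof. by rewrite -[c *: y]addr0 brlin br0 addr0. Qed.

Lemma brlinl c x y z : br (c *: x + y) z = c *: br x z + br y z.
Proof. by have [_ h _ _] := km_lie km; exact: h. Qed.

Lemma brDl x y z : br (x + y) z = br x z + br y z.
Proof. by rewrite -[x in LHS]scale1r brlinl scale1r. Qed.

Lemma br0l x : br 0 x = 0.
Proof. by apply: (addrI (br 0 x)); rewrite -brDl !addr0. Qed.

Lemma brZl c x y : br (c *: x) y = c *: br x y.
Proof. by rewrite -[c *: x]addr0 brlinl br0l addr0. Qed.

Lemma brC x y : br x y = - br y x.
Proof.
apply/eqP; rewrite -addr_eq0; apply/eqP.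
by have := brxx (x + y); rewrite brD !brDl !brxx add0r addr0 addrC.
Qed.

Lemma brJ x y z : br x (br y z) = br (br x y) z + br y (br x z).
Proof.
have [_ _ _ /(_ x y z) J] := km_lie km.
apply/eqP; rewrite -subr_eq0 opprD addrA; apply/eqP; rewrite -[RHS]J.
rewrite [br z (br x y)]brC [br y (br z x)](_ : _ = - br y (br x z)); last first.
  by rewrite [br z x]brC -scaleN1r brZ scaleN1r.
by rewrite addrAC.
Qed.

Lemma iotaD u v : iota (u + v) = iota u + iota v.
Proof. by rewrite -[u in LHS]scale1r (km_iota_linear km) scale1r. Qed.

Lemma iota0 : iota 0 = 0.
Proof. by apply: (addrI (iota 0)); rewrite -iotaD !addr0. Qed.

(* The Chevalley generators [e i] and [f i] are treated together through a
   sign. *)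
Definition cgen (b : bool) (i : I) : L := if b then e i else f i.
Definition csign (b : bool) : R := if b then 1 else -1.

Lemma csignN b : csign (~~ b) = - csign b.
Proof. by case: b; rewrite //= opprK. Qed.

Lemma csign2 b : csign b * csign b = 1.
Proof. by case: b; rewrite /csign; lra. Qed.

Lemma csign_neq0 b : csign b != 0.
Proof. by case: b; rewrite /= ?oppr_eq0 oner_eq0. Qed.

Lemma br_iota_cgen h b i : br (iota h) (cgen b i) = (csign b * P i h) *: cgen b i.
Proof.
by case: b; rewrite /= ?mul1r ?mulN1r; [exact: km_he km h i|exact: km_hf km h i].
Qed.

Lemma br_cgen_iota h b i : br (cgen b i) (iota h) = (- (csign b * P i h)) *: cgen b i.
Proof. by rewrite brC br_iota_cgen scaleNr. Qed.

Lemma br_cgenN b i j :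
  br (cgen b i) (cgen (~~ b) j) = if i == j then csign b *: iota (pv i) else 0.
Proof.
case: b => /=; first by rewrite (km_ef km) scale1r.
rewrite brC (km_ef km) eq_sym; case: eqVneq => [->|]; first by rewrite scaleN1r.
by rewrite oppr0.
Qed.

Lemma P_pv i j : P j (pv i) = a i j. Proof. exact: km_pairing km i j. Qed.

Definition weight (lam : H -> R) (x : L) : Prop :=
  forall h, br (iota h) x = lam h *: x.

Lemma weight_cgen b i : weight (fun h => csign b * P i h) (cgen b i).
Proof. by move=> h; exact: br_iota_cgen. Qed.

Lemma weight_iota h : weight (fun=> 0) (iota h).
Proof. by move=> h'; rewrite (km_hh km) scale0r. Qed.

Lemma weight_br lam x b i : weight lam x ->
  weight (fun h => csign b * P i h + lam h) (br (cgen b i) x).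
Proof. by move=> wx h; rewrite brJ br_iota_cgen wx brZl brZ scalerDl. Qed.

Lemma weight_iter lam x b i k : weight lam x ->
  weight (fun h => k%:R * (csign b * P i h) + lam h) (iter k (br (cgen b i)) x).
Proof.
move=> wx; elim: k => [|k IH] h /=; first by rewrite wx mul0r add0r.
by rewrite (weight_br b i IH) addrA -natr1; congr (_ *: _); lra.
Qed.

Lemma iter_br0 k x : iter k (br x) 0 = 0.
Proof. by elim: k => //= k ->; rewrite br0. Qed.

Lemma iter_brZ k x c y : iter k (br x) (c *: y) = c *: iter k (br x) y.
Proof. by elim: k => //= k ->; rewrite brZ. Qed.

Lemma iter_br_comm z x k y : br z x = 0 ->
  br z (iter k (br x) y) = iter k (br x) (br z y).
Proof. by move=> zx; elim: k => //= k IH; rewrite brJ zx br0l add0r IH. Qed.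

(** The [sl2] identity [e f^(k+1) = f^(k+1) e + (k+1) f^k (h - k)], for both choices of the raising
    generator. *)
Lemma sl2_iter b i lam x k : weight lam x ->
  br (cgen b i) (iter k.+1 (br (cgen (~~ b) i)) x) =
  iter k.+1 (br (cgen (~~ b) i)) (br (cgen b i) x) +
  (k.+1%:R * (csign b * lam (pv i) - k%:R)) *: iter k (br (cgen (~~ b) i)) x.
Proof.
move=> wx; elim: k => [|k IH].
  rewrite /= brJ br_cgenN eqxx brZl wx scalerA addrC; congr (_ + _ *: _); lra.
rewrite [iter k.+2 _ x]iterS brJ br_cgenN eqxx brZl (weight_iter _ _ _ wx).
rewrite IH brD brZ scalerA addrCA -iterS -[br _ (iter k _ x)]iterS -scalerDl.
congr (_ + _ *: _); rewrite csignN P_pv; have [-> _ _ _] := ca.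
have := csign2 b; rewrite -[k.+2%:R]natr1 -[k.+1%:R]natr1 => s2.
have -> : csign b * ((k%:R + 1) * (- csign b * 2) + lam (pv i)) =
  csign b * lam (pv i) - 2 * (k%:R + 1) * (csign b * csign b) by lra.
by rewrite s2; lra.
Qed.

(** [f^k] is injective on vectors of [h]-eigenvalue [k], by induction on the order of nilpotence of
    [e] at [x]: [e x] has eigenvalue [k + 2] and is killed by [f^(k+2)], hence is 0. Then [x] is a
    highest weight vector, and the factors [(l+1)(k-l)], [l < k], are nonzero. *)
Lemma sl2_inj b i N lam x k : weight lam x ->
  csign b * lam (pv i) = k%:R -> iter N (br (cgen b i)) x = 0 ->
  iter k (br (cgen (~~ b) i)) x = 0 -> x = 0.
Proof.
elim: N lam x k => // N IH lam x k wx lamk; rewrite iterSr => Nx kx.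
have Ex : br (cgen b i) x = 0.
  apply: (IH _ _ k.+2 (weight_br b i wx)) => //.
    rewrite P_pv mulrDr lamk mulrA csign2; have [-> _ _ _] := ca.
    by rewrite -[k.+2%:R]natr1 -[k.+1%:R]natr1; lra.
  have := sl2_iter b i k.+1 wx; rewrite [iter k.+2 _ x]iterS [iter k.+1 _ x]iterS.
  by rewrite kx !br0 scaler0 addr0 => <-.
have : forall l, (l <= k)%N -> iter l (br (cgen (~~ b) i)) x = 0 -> x = 0.
  elim=> // l IHl lk lx; apply: IHl; first exact: ltnW.
  have := sl2_iter b i l wx; rewrite lx br0 Ex iter_br0 add0r lamk => /esym/eqP.
  rewrite scaler_eq0 mulf_eq0 pnatr_eq0 subr_eq0 eqr_nat /=.
  by rewrite gtn_eqF //= => /eqP.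
by move=> /(_ k (leqnn k) kx).
Qed.

Definition lspan (X : set L) : set L := smallest (@linear_subspace R L) X.

Lemma lspan_subspace X : linear_subspace (lspan X).
Proof.
split=> [M [[]] //|c x y Xx Xy M XM].
by have [[_ h] _] := XM; apply: h; [exact: Xx|exact: Xy].
Qed.

Lemma sub_lspan X : X `<=` lspan X. Proof. exact: sub_gen_smallest. Qed.

Lemma lspan_min X (S : set L) : linear_subspace S -> X `<=` S -> lspan X `<=` S.
Proof. by move=> ? ?; exact: smallest_sub. Qed.

Lemma lspan_br z X (S : set L) : linear_subspace S -> (forall x, X x -> S (br z x)) ->
  forall x, lspan X x -> S (br z x).
Proof.
move=> [S0 SD] XS; apply: lspan_min; last by move=> x /XS.
by split=> [|c x y Sx Sy] /=; rewrite ?br0 // brlin; exact: SD.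
Qed.

Lemma subspaceZ (S : set L) c x : linear_subspace S -> S x -> S (c *: x).
Proof. by move=> [S0 SD] Sx; rewrite -[_ *: _]addr0; exact: SD. Qed.
Lemma subspaceD (S : set L) x y : linear_subspace S -> S x -> S y -> S (x + y).
Proof. by move=> [S0 SD] Sx Sy; rewrite -[x]scale1r; exact: SD. Qed.

(** By the Jacobi identity the elements whose adjoint map preserves [S] form a subalgebra. *)
Lemma cgen_stable (S : set L) : linear_subspace S ->
  (forall h y, S y -> S (br (iota h) y)) ->
  (forall b i y, S y -> S (br (cgen b i) y)) -> forall x y, S y -> S (br x y).
Proof.
move=> sS Sh Sg.
suff all : [set x | forall y, S y -> S (br x y)] = setT.
  by move=> x; have : [set: L] x by []; rewrite -all.
apply: (km_generated km).
- split; first split=> [y Sy|c x z Sx Sz y Sy] /=.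
  + by rewrite br0l; case: sS.
  + by rewrite brlinl; case: sS => _; apply; [exact: Sx|exact: Sz].
  move=> x z Sx Sz y Sy /=.
  have -> : br (br x z) y = br x (br z y) + - 1 *: br z (br x y).
    by rewrite [br x (br z y)]brJ scaleN1r addrK.
  apply: subspaceD => //; first by apply: Sx; exact: Sz.
  by apply: subspaceZ sS _; apply: Sz; exact: Sx.
- by move=> _ [h _ <-] y; exact: Sh.
- by move=> _ [i _ <-] y; exact: (Sg true).
- by move=> _ [i _ <-] y; exact: (Sg false).
Qed.

(* [shift (h, c)] is [ad h - c]; a vector killed by a product of such operators
   with all [c <> lam h] has no component of weight [lam]. *)
Definition shift (hc : H * R) (x : L) : L := br (iota hc.1) x - hc.2 *: x.

Definition killed (lam : H -> R) : set L :=
  [set x | exists l : seq (H * R),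
     (forall hc, List.In hc l -> lam hc.1 - hc.2 != 0) /\ foldr shift x l = 0].

Lemma shiftC hc hc' x : shift hc (shift hc' x) = shift hc' (shift hc x).
Proof.
rewrite /shift -!scaleNr !brD !brZ.
rewrite [br (iota hc.1) (br _ _)]brJ (km_hh km) br0l add0r -!addrA.
congr (_ + _); rewrite !scalerDr !scalerA addrCA; congr (_ + (_ + _ *: _)).
by rewrite mulrC.
Qed.

Lemma shift_lin hc c x y : shift hc (c *: x + y) = c *: shift hc x + shift hc y.
Proof.
rewrite /shift brlin scalerDr opprD addrACA scalerBr !scalerA.
by rewrite [hc.2 * c]mulrC.
Qed.

Lemma foldr_shift_lin l c x y :
  foldr shift (c *: x + y) l = c *: foldr shift x l + foldr shift y l.
Proof. by elim: l => //= hc l ->; rewrite shift_lin. Qed.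

Lemma foldr_shift0 l : foldr shift 0 l = 0.
Proof. by elim: l => //= hc l ->; rewrite /shift br0 scaler0 subr0. Qed.

Lemma foldr_shiftC l hc x : foldr shift (shift hc x) l = shift hc (foldr shift x l).
Proof. by elim: l => //= hc' l ->; rewrite shiftC. Qed.

Lemma foldr_shift_catC l l' x : foldr shift x (l ++ l') = foldr shift x (l' ++ l).
Proof.
elim: l => [|hc l IH] /=; first by rewrite cats0.
by rewrite IH !foldr_cat /= -foldr_shiftC.
Qed.

Lemma killed_subspace lam : linear_subspace (killed lam).
Proof.
split=> [|c x y [l [ln lx]] [l' [ln' ly]]]; first by exists [::].
exists (l ++ l'); split=> [hc /List.in_app_iff[]|]; [exact: ln|exact: ln'|].
rewrite foldr_shift_lin [foldr _ x _]foldr_shift_catC !foldr_cat lx ly.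
by rewrite !foldr_shift0 scaler0 addr0.
Qed.

Lemma killed_weight lam lam' x h : weight lam' x -> lam h != lam' h -> killed lam x.
Proof.
move=> wx ne; exists [:: (h, lam' h)]; split=> [hc [<-|//]|/=].
  by rewrite subr_eq0.
by rewrite /shift wx subrr.
Qed.

Lemma weight_killed_eq0 lam x : weight lam x -> killed lam x -> x = 0.
Proof.
move=> wx [l []]; elim: l => [|hc l IH] //= ln.
rewrite -foldr_shiftC [shift hc x]/shift wx -scalerBl -[_ *: _]addr0 foldr_shift_lin.
rewrite foldr_shift0 addr0 => /eqP; rewrite scaler_eq0.
rewrite (negbTE (ln hc _)) /=; last by left.
by move=> /eqP; apply: IH => hc' ?; apply: ln; right.
Qed.

(** The multidegree is carried along because it cannot be read off the vector, which may be 0. *)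
Inductive descendant (b : bool) (Y : (I -> nat) -> L -> Prop) :
    (I -> nat) -> L -> Prop :=
| Descendant0 m y : Y m y -> descendant b Y m y
| DescendantS m y i : descendant b Y m y ->
    descendant b Y (fun j => (j == i) + m j)%N (br (cgen b i) y).

Definition height_weight (b : bool) (m : I -> nat) (h : H) : R :=
  csign b * \sum_j (m j)%:R * P j h.

Lemma height_weightS b m i h :
  height_weight b (fun j => (j == i) + m j)%N h =
  csign b * P i h + height_weight b m h.
Proof.
rewrite /height_weight -mulrDr; congr (_ * _).
under eq_bigr do rewrite natrD mulrDl.
rewrite big_split /= (bigD1 i) //= eqxx mul1r [X in _ + X + _]big1 ?addr0 //.
by move=> j /negbTE ->; rewrite mul0r.
Qed.

Lemma descendant_weight b Y : (forall m y, Y m y -> weight (height_weight b m) y) ->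
  forall m y, descendant b Y m y -> weight (height_weight b m) y.
Proof.
move=> Yw m y; elim=> {m y} [m y /Yw//|m y i _ IH h].
by rewrite (weight_br b i IH) height_weightS.
Qed.

Lemma separating_coef (c d : I -> R) j : c j != d j ->
  exists h, \sum_i c i * P i h != \sum_i d i * P i h.
Proof.
move=> /eqP cd; apply: contrapT => /forallNP all; apply: cd.
apply: (free_codom_coef (km_roots_free km)) => h.
by have /negP/negPn/eqP := all h.
Qed.

Lemma height_weight_sep (n : I -> int) b m :
  ~ (forall j, (n j)%:~R = csign b * (m j)%:R) ->
  exists h, \sum_j (n j)%:~R * P j h != height_weight b m h.
Proof.
move=> /existsNP[j /eqP nj].
have [h hh] := @separating_coef (fun j => (n j)%:~R) (fun j => csign b * (m j)%:R) j nj.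
exists h; apply: contra hh => /eqP ->; rewrite /height_weight mulr_sumr.
by apply/eqP/eq_bigr => k _; rewrite mulrA.
Qed.

(** For [N = - a i j] this is the Serre element [(ad e_i)^(1 - a_ij) e_j], or its analogue for the
    [f]'s. *)
Definition serre_elt b i j N : L := iter N.+1 (br (cgen b i)) (cgen b j).

Lemma br_serre_elt b i j N k : i != j -> a i j = - N%:R ->
  br (cgen (~~ b) k) (serre_elt b i j N) = 0.
Proof.
move=> ij aij; rewrite /serre_elt.
have N2 x : br (cgen (~~ b) x) (cgen b i) = if x == i then csign (~~ b) *: iota (pv x) else 0.
  by have := br_cgenN (~~ b) x i; rewrite negbK.
have N3 x : br (cgen (~~ b) x) (cgen b j) = if x == j then csign (~~ b) *: iota (pv x) else 0.
  by have := br_cgenN (~~ b) x j; rewrite negbK.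
have [ki|ki] := eqVneq k i.
  subst k; have := sl2_iter (~~ b) i N (weight_cgen b j); rewrite negbK => ->.
  rewrite N3 (negbTE ij) iter_br0 add0r P_pv aij csignN.
  have s2 := csign2 b.
  have -> : - csign b * (csign b * - N%:R) = (csign b * csign b) * N%:R by lra.
  by rewrite s2 mul1r subrr mulr0 scale0r.
rewrite iter_br_comm; last by rewrite N2 (negbTE ki).
rewrite N3; case: eqVneq => [->|_]; last exact: iter_br0.
rewrite iter_brZ iterSr br_cgen_iota P_pv iter_brZ.
(* For [N > 0] a second bracket with the same generator gives 0. For [N = 0] only one bracket is
   taken, and it vanishes because [a i j = 0] implies [a j i = 0]. *)
case: N aij => [|N] aij; last by rewrite iterSr brxx iter_br0 !scaler0.
have [_ _ _ ->] := ca; first by rewrite mulr0 oppr0 scale0r scaler0.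
by rewrite aij oppr0.
Qed.

(** The opposite generators kill the Serre element, so the span of its descendants is an ideal. All
    their multidegrees involve [j], so weight 0 does not occur, the ideal meets the Cartan
    subalgebra trivially, and it is 0. *)
Lemma serre_relation b i j N : i != j -> a i j = - N%:R -> serre_elt b i j N = 0.
Proof.
move=> ij aij; set y := serre_elt b i j N.
pose m0 k := ((k == j) + (k == i) * N.+1)%N.
pose Y m x := m = m0 /\ x = y.
have Yw m x : Y m x -> weight (height_weight b m) x.
  case=> -> -> h; rewrite /y /serre_elt (weight_iter _ _ _ (weight_cgen b j)).
  congr (_ *: _); rewrite /height_weight mulrC -mulrA -mulrDr.
  under [in RHS]eq_bigr do rewrite natrD mulrDl.
  rewrite big_split /= (bigD1 j) //= eqxx mul1r big1 ?addr0; last first.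
    by move=> k /negbTE ->; rewrite mul0r.
  rewrite (bigD1 i) //= eqxx mul1n big1 ?addr0; last first.
    by move=> k /negbTE ->; rewrite mul0r.
  by congr (_ * _); lra.
have Ym m x : descendant b Y m x -> (0 < m j)%N.
  elim=> {m x} [m x [-> _]|m x k _]; first by rewrite /m0 eqxx.
  by move=> mj; rewrite addn_gt0 mj orbT.
pose S := lspan [set x | exists m, descendant b Y m x].
have sS : linear_subspace S by exact: lspan_subspace.
have Sdesc m x : descendant b Y m x -> S x by move=> h; apply: sub_lspan; exists m.
have Sy : S y by apply: (Sdesc m0); exact: Descendant0.
have Sb k x : S x -> S (br (cgen b k) x).
  apply: lspan_br => // z [m d]; apply: (Sdesc (fun l => (l == k) + m l)%N).
  exact: DescendantS.
have Sh h x : S x -> S (br (iota h) x).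
  apply: lspan_br => // z [m d]; rewrite (descendant_weight Yw d).
  by apply: subspaceZ sS _; exact: (Sdesc _ _ d).
have SN k x : S x -> S (br (cgen (~~ b) k) x).
  apply: lspan_br => // z [m d]; elim: d => {m z x} [m x [_ ->]|m x l d IH].
    by rewrite br_serre_elt //; case: sS.
  rewrite brJ; apply: (subspaceD sS); last exact: Sb.
  have := br_cgenN (~~ b) k l; rewrite negbK => ->.
  case: ifP => _; last by rewrite br0l; case: sS.
  by rewrite brZl; apply: subspaceZ sS _; apply: Sh; exact: (Sdesc _ _ d).
have Sall : forall x z, S z -> S (br x z).
  apply: cgen_stable => // b' k x Sx.
  have [->|bb'] := eqVneq b' b; first exact: Sb.
  have -> : b' = ~~ b by move: bb'; case: (b'); case: (b).
  exact: SN.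
suff : S = [set 0] by move=> S0; move: Sy; rewrite S0.
apply: (km_no_ideal km); first by split.
rewrite eqEsubset; split=> [x [Sx [h _ hx]]|x ->]; last first.
  by split; [case: sS|exists 0 => //; exact: iota0].
rewrite /= -hx; apply: (weight_killed_eq0 (weight_iota h)).
rewrite hx; move: x Sx {hx}; apply: lspan_min; first exact: killed_subspace.
move=> x [m d]; have := Ym _ _ d => mj.
have [|h' hh'] := @height_weight_sep (fun=> 0) b m.
  move=> /(_ j)/eqP; rewrite eq_sym mulf_eq0 (negbTE (csign_neq0 b)) pnatr_eq0.
  by rewrite gtn_eqF.
apply: (killed_weight (h := h') (descendant_weight Yw d)).
by move: hh'; rewrite big1 // => k _; rewrite mul0r.
Qed.

(** By the Leibniz rule the vectors on which [ad g] is nilpotent form a subalgebra; it contains the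
    generators of the same sign by the Serre relations. *)
Lemma locally_nilpotent b i x : exists N, iter N (br (cgen b i)) x = 0.
Proof.
set g := cgen b i; pose S := [set x | exists N, iter N (br g) x = 0].
have mono N M z : iter N (br g) z = 0 -> iter (N + M) (br g) z = 0.
  by move=> z0; rewrite addnC iterD z0 iter_br0.
have itlin N c y z : iter N (br g) (c *: y + z) = c *: iter N (br g) y + iter N (br g) z.
  by elim: N => //= N ->; rewrite brlin.
have leib n : forall N M y z, (N + M = n)%N -> iter N (br g) y = 0 ->
    iter M (br g) z = 0 -> iter (N + M) (br g) (br y z) = 0.
  elim: n => [|n IH] N M y z nm y0 z0.
    by move: nm y0 => /eqP; rewrite addn_eq0 => /andP[/eqP-> /eqP->] /= ->; rewrite br0l.
  case: N nm y0 => [|N] nm y0; first by move: y0 => /= ->; rewrite br0l iter_br0.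
  case: M nm z0 => [|M] nm z0; first by move: z0 => /= ->; rewrite br0 iter_br0 br0.
  rewrite addSn iterSr brJ -[br (br g y) z]scale1r itlin scale1r.
  rewrite (IH N M.+1) ?add0r //; [|by move: nm; lia|by rewrite -iterSr].
  rewrite addnS -addSn; apply: IH => //; first by move: nm; lia.
  by rewrite -iterSr.
have Scgen b' j : S (cgen b' j).
  have [->|bb'] := eqVneq b' b.
    have [<-|ij] := eqVneq i j; first by exists 1%N; exact: brxx.
    have [_ caZ caN _] := ca.
    have [N aN] : exists N : nat, a i j = - N%:R.
      have /natrP[N aN] : - a i j \is a Num.nat by rewrite natrEint rpredN caZ oppr_ge0 caN.
      by exists N; rewrite -aN opprK.
    by exists N.+1; exact: serre_relation.
  have -> : b' = ~~ b by move: bb'; case: (b'); case: (b).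
  (* Applied to the opposite generator, [ad g] gives successively an element of the Cartan
     subalgebra, a multiple of [g], and 0. *)
  exists 3%N; rewrite 2!iterSr br_cgenN; case: ifP => _; last by rewrite /= !br0.
  by rewrite /= brZ br_cgen_iota !brZ brxx !scaler0.
suff : S = setT by move=> ST; have : [set: L] x by []; rewrite -ST.
apply: (km_generated km).
- split; first split=> [|c y z [N y0] [M z0]]; first by exists 0%N.
    exists (N + M)%N; rewrite itlin mono // addnC mono //.
    by rewrite scaler0 addr0.
  by move=> y z [N y0] [M z0]; exists (N + M)%N; exact: leib.
- move=> _ [h _ <-]; exists 2%N.
  by rewrite iterSr br_cgen_iota /= brZ brxx scaler0.
- move=> _ [j _ <-]; exact: (Scgen true j).
- move=> _ [j _ <-]; exact: (Scgen false j).
Qed.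

(** The reflected weight is reached by applying [ad f_i] or [ad e_i], according to the sign of [c],
    exactly [|c|] times; the result is nonzero by [sl2] theory, local nilpotence providing its
    hypothesis. *)
Lemma weight_reflection (n : I -> int) i (c : int) x : x != 0 ->
  c%:~R = \sum_j (n j)%:~R * a i j ->
  weight (fun h => \sum_j (n j)%:~R * P j h) x ->
  exists2 y, y != 0 &
    weight (fun h => \sum_j (n j - (j == i)%:R * c)%:~R * P j h) y.
Proof.
move=> x0 ec wx.
have [b [k ck]] : exists b k, csign b * c%:~R = k%:R :> R.
  have [c0|c0] := lerP 0 c.
    by exists true, `|c|%N; rewrite mul1r natr_absz ger0_norm.
  by exists false, `|c|%N; rewrite mulN1r natr_absz ltr0_norm // intrN.
exists (iter k (br (cgen (~~ b) i)) x).
  apply/eqP => kx; move/eqP: x0; apply.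
  have [N Nx] := locally_nilpotent b i x.
  apply: (sl2_inj wx _ Nx kx); rewrite -ck ec; congr (_ * _).
  by apply: eq_bigr => j _; rewrite P_pv.
move=> h; rewrite (weight_iter _ _ _ wx); congr (_ *: _).
have -> : \sum_j (n j)%:~R * P j h =
    \sum_j (n j - (j == i)%:R * c)%:~R * P j h + c%:~R * P i h.
  transitivity (\sum_j ((n j - (j == i)%:R * c)%:~R * P j h +
      (j == i)%:R * (c%:~R * P j h))).
    apply: eq_bigr => j _; rewrite intrB intrM mulrBl.
    by case: (j == i); rewrite ?mul1r ?mul0r ?subrK ?subr0 ?addr0.
  rewrite big_split /=; congr (_ + _).
  rewrite (bigD1 i) //= eqxx mul1r big1 ?addr0 // => j /negbTE ->.
  by rewrite mul0r.
rewrite csignN -ck.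
have -> : csign b * c%:~R * (- csign b * P i h) =
  - ((csign b * csign b) * (c%:~R * P i h)) by lra.
by rewrite csign2 mul1r addrC addrK.
Qed.

(* Triangular decomposition: the iterated brackets of the [e i], those of the
   [f i] and the Cartan subalgebra span [L]. *)
Lemma weight_coherent (n : I -> int) x : (exists i, n i != 0) -> x != 0 ->
  weight (fun h => \sum_j (n j)%:~R * P j h) x -> coherent n.
Proof.
move=> [i ni] x0 wx; apply: contrapT => ncoh.
pose Y b m y := exists i, m = (fun j => (j == i) : nat) /\ y = cgen b i.
have Yw b m y : Y b m y -> weight (height_weight b m) y.
  case=> k [-> ->] h; rewrite br_iota_cgen /height_weight; congr (_ * _ *: _).
  by rewrite (bigD1 k) //= eqxx mul1r big1 ?addr0 // => l /negbTE ->; rewrite mul0r.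
pose X b := [set y | exists m, descendant b (Y b) m y].
have Xg b k : X b (cgen b k).
  by exists (fun j => (j == k) : nat); apply: Descendant0; exists k.
pose U := lspan (X true `|` X false `|` range iota).
have sU : linear_subspace U by exact: lspan_subspace.
have XU b y : X b y -> U y.
  by move=> Xy; apply: sub_lspan; left; case: b Xy; [left|right].
have iU h : U (iota h) by apply: sub_lspan; right; exists h.
(* A Borel half: an opposite generator sends a bracket of sign [b] back into it, possibly down to
   the Cartan part. *)
pose B b := lspan (X b `|` range iota).
have sB b : linear_subspace (B b) by exact: lspan_subspace.
have BU b : B b `<=` U.
  by apply: lspan_min => // y [/XU//|[h _ <-]].
have Bb b k y : B b y -> B b (br (cgen b k) y).
  apply: lspan_br => // z [[m d]|[h _ <-]].
    apply: sub_lspan; left; exists (fun l => (l == k) + m l)%N.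
    exact: DescendantS.
  rewrite br_cgen_iota; apply: (subspaceZ _ (sB b)); apply: sub_lspan; left.
  exact: Xg.
have BN b k y : X b y -> B b (br (cgen (~~ b) k) y).
  have Ng j : br (cgen (~~ b) k) (cgen b j) =
      if k == j then csign (~~ b) *: iota (pv k) else 0.
    by have := br_cgenN (~~ b) k j; rewrite negbK.
  case=> m; elim=> {m y} [m y [j [_ ->]]|m y j d IH].
    rewrite Ng; case: ifP => _; last by case: (sB b).
    by apply: (subspaceZ _ (sB b)); apply: sub_lspan; right; exists (pv k).
  rewrite brJ; apply: (subspaceD (sB b)); last exact: Bb.
  rewrite Ng; case: ifP => _; last by rewrite br0l; case: (sB b).
  rewrite brZl (descendant_weight (Yw b) d) scalerA; apply: (subspaceZ _ (sB b)).
  by apply: sub_lspan; left; exists m.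
have Ug b k y : U y -> U (br (cgen b k) y).
  apply: lspan_br => // z [Xz|[h _ <-]]; last first.
    by rewrite br_cgen_iota; apply: (subspaceZ _ sU); exact: (XU b).
  have {Xz} [b' Xz] : exists b', X b' z by case: Xz; [exists true|exists false].
  apply: (BU b'); have [->|bb'] := eqVneq b b'.
    by apply: Bb; apply: sub_lspan; left.
  have -> : b = ~~ b' by move: bb'; case: (b'); case: (b).
  exact: BN.
have Uh h y : U y -> U (br (iota h) y).
  apply: lspan_br => // z [Xz|[h' _ <-]].
    have {Xz} [b' [m d]] : exists b', X b' z by case: Xz; [exists true|exists false].
    rewrite (descendant_weight (Yw b') d); apply: (subspaceZ _ sU).
    by apply: (XU b'); exists m.
  by rewrite (km_hh km); case: sU.
have UT : U = setT.
  apply: (km_generated km).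
  - by split=> // y z _; exact: cgen_stable.
  - by move=> _ [h _ <-].
  - by move=> _ [k _ <-]; apply: (XU true); exact: Xg.
  - by move=> _ [k _ <-]; apply: (XU false); exact: Xg.
(* If [n] had mixed signs, [x] would lie in the span of weight vectors all of weights different from
   its own. *)
move/eqP: x0; apply; apply: (weight_killed_eq0 wx).
have : U x by rewrite UT.
move: x wx; rewrite /U => x _; move: x; apply: lspan_min.
  exact: killed_subspace.
move=> y [Xy|[h _ <-]].
  have {Xy} [b [m d]] : exists b, X b y by case: Xy; [exists true|exists false].
  have [|h hh] := @height_weight_sep n b m.
    move=> nm; apply: ncoh; case: b {d} nm => nm; [left|right] => j.
      by rewrite -(ler0z R) nm mul1r ler0n.
    by rewrite -(lerz0 R) nm mulN1r oppr_le0 ler0n.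
  exact: (killed_weight (h := h) (descendant_weight (Yw b) d)).
have [|h' hh'] := @separating_coef (fun j => (n j)%:~R) (fun=> 0) i.
  by rewrite intr_eq0.
apply: (killed_weight (h := h') (weight_iota h)); move: hh'.
by rewrite [X in _ != X]big1 // => j _; rewrite mul0r.
Qed.

End KacMoodyAlgebra.

Section KacMoodyRoots.
Context (R : realType) (I : finType) (a : I -> I -> R).
Hypothesis ca : gen_cartan a.

Lemma kac_moody_root_coherent n : kac_moody_root a n -> coherent n.
Proof.
case=> n0 [L [br [H [p [pv [iota [e [f [km [x x0 wx]]]]]]]]]].
exact: (weight_coherent km n0 x0 wx).
Qed.

Lemma kac_moody_root_reflection n i (c : int) : kac_moody_root a n ->
  c%:~R = \sum_j (n j)%:~R * a i j ->
  kac_moody_root a (fun j => n j - (j == i)%:R * c).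
Proof.
case=> [[k nk] [L [br [H [p [pv [iota [e [f [km [x x0 wx]]]]]]]]]]] ec; split.
  apply: contrapT => /forallNP n'0.
  have n'E j : n j = (j == i)%:R * c.
    by apply/eqP; rewrite -subr_eq0; apply/negPn/negP; exact: n'0.
  move: nk; rewrite n'E; case: (k == i); last by rewrite mul0r eqxx.
  (* If the reflected root were 0, [n] would be [c alpha_i], whose pairing with the coroot of [i] is
     [2 c]. *)
  have : c%:~R = 2 * c%:~R :> R.
    rewrite {1}ec (bigD1 i) //= n'E eqxx mul1r big1 ?addr0; last first.
      by move=> j /negbTE ji; rewrite n'E ji mul0r mul0r.
    by have [-> _ _ _] := ca; rewrite mulrC.
  move=> c2; have /eqP : c%:~R = 0 :> R by lra.
  by rewrite intr_eq0 mul1r => ->.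
exists L, br, H, p, pv, iota, e, f; split => //.
exact: (weight_reflection ca km x0 ec wx).
Qed.

End KacMoodyRoots.

(** * Vectorial faces *)

Section Bases.
Context (R : realType) (V : vectType R) (I : finType) (D : vectorial_data V I).
Local Notation al i := (ev (sroot D i)).
Local Notation cr := (scoroot D).

Lemma weyl_inv w : weyl D w -> exists w', [/\ weyl D w', cancel w w' & cancel w' w].
Proof. by move=> ww; exact: bij_group_inv (weyl_group D) ww. Qed.

Lemma weyl_lfun w : weyl D w -> exists l : 'End(V), forall v, w v = l v.
Proof. by move=> ww; apply: linear_lfun; exact: weyl_linear ww. Qed.

Lemma weylD w u v : weyl D w -> w (u + v) = w u + w v.
Proof. by move=> /weyl_lfun[l e]; rewrite !e linearD. Qed.

Lemma weylZ w c v : weyl D w -> w (c *: v) = c *: w v.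
Proof. by move=> /weyl_lfun[l e]; rewrite !e linearZ. Qed.

Lemma weylB w u v : weyl D w -> w (u - v) = w u - w v.
Proof. by move=> /weyl_lfun[l e]; rewrite !e linearB. Qed.

Lemma comp_form (a : 'Hom(V, R^o)) (l : 'End(V)) v : ev (a \o l)%VF v = ev a (l v).
Proof. by rewrite /ev comp_lfunE. Qed.

Lemma real_root_weyl a w : weyl D w -> real_root D a ->
  exists2 a', real_root D a' & forall v, ev a' v = ev a (w v).
Proof.
move=> ww [h [u [i [wu ae _]]]].
have [l le] := weyl_lfun ww; have [w' [ww' wK w'K]] := weyl_inv ww.
exists (a \o l)%VF; last by move=> v; rewrite comp_form le.
exists (w' (u (cr i))), (w' \o u), i; split => //.
- exact: weyl_comp.
- by move=> v; rewrite -ae [LHS]comp_form /= -le w'K.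
Qed.

Lemma imaginary_root_srefl a i : imaginary_root D a ->
  exists2 a', imaginary_root D a' & forall v, ev a' v = ev a (srefl D i v).
Proof.
case=> n [kn ae nreal]; have ca := sroot_cartan D.
have [_ caZ _ _] := ca.
have /choice[m em] j : exists m : int, al j (cr i) = m%:~R.
  by have /intrP := caZ i j.
have ec : (\sum_j n j * m j)%:~R = \sum_j (n j)%:~R * (sroot D j (cr i) : R) :> R.
  by rewrite rmorph_sum; apply: eq_bigr => j _; rewrite rmorphM /= -em.
pose n' (j : I) : int := n j - (j == i)%:R * \sum_l n l * m l.
have kn' : kac_moody_root (fun i j => sroot D j (cr i) : R) n'.
  by have := kac_moody_root_reflection ca kn ec.
have e v : ev (\sum_j (n' j)%:~R *: sroot D j) v = ev a (srefl D i v).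
  rewrite ae !ev_lc; rewrite /n'; move: ec; set c := \sum_j n j * m j => ec.
  transitivity (\sum_j ((n j)%:~R * al j v - (j == i)%:R * (c%:~R * al j v))).
    apply: eq_bigr => j _; rewrite intrB intrM mulrBl.
    by case: (j == i); rewrite ?mul1r ?mul0r.
  transitivity (\sum_j ((n j)%:~R * al j v - (n j)%:~R * al j (cr i) * al i v)).
    rewrite !big_split /= !sumrN; congr (_ - _).
    rewrite (bigD1 i) //= eqxx mul1r big1 ?addr0; last first.
      by move=> j /negbTE ->; rewrite mul0r.
    by rewrite ec mulr_suml.
  by apply: eq_bigr => j _; rewrite (ev_srefl D (sroot D j)); lra.
exists (\sum_j (n' j)%:~R *: sroot D j) => //; exists n'; split=> //.
(* Real roots are stable under the Weyl group, so reflecting a second time would make [a] itself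
   real. *)
move=> re; apply: nreal.
have [a' ra' e'] := real_root_weyl (weyl_srefl i) re.
suff -> : a = a' by [].
by apply: ev_inj => v; rewrite e' e sreflK.
Qed.

Lemma imaginary_root_weyl a w : weyl D w -> imaginary_root D a ->
  exists2 a', imaginary_root D a' & forall v, ev a' v = ev a (w v).
Proof.
move=> /weylP[s ->]; elim: s a => [|i s IH] a ia; first by exists a.
have [a1 ia1 e1] := imaginary_root_srefl i ia.
by have [a2 ia2 e2] := IH _ ia1; exists a2 => // v; rewrite e2 e1.
Qed.

Lemma all_root_weyl a w : weyl D w -> all_root D a ->
  exists2 a', all_root D a' & forall v, ev a' v = ev a (w v).
Proof.
move=> ww [ra|ia].
  by have [a' ra' e] := real_root_weyl ww ra; exists a' => //; left.
by have [a' ia' e] := imaginary_root_weyl ww ia; exists a' => //; right.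
Qed.

Lemma all_root_coherent a : all_root D a -> exists n, coherent n /\
  forall v, ev a v = \sum_i (n i)%:~R * al i v.
Proof.
case=> [[h [w [i [ww ae _]]]]|[n [kn -> _]]]; last first.
  exists n; split; last by move=> v; rewrite ev_lc.
  exact: kac_moody_root_coherent kn.
have [w' [ww' wK w'K]] := weyl_inv ww.
have [n [nc e]] := weyl_root_coherent i ww'; exists n; split=> // v.
by rewrite -e -[v in LHS]w'K; exact: ae.
Qed.

(* The simple systems [+/- w (alpha_i)]; the vectorial faces are their facets. *)
Definition is_base (b : I -> 'Hom(V, R^o)) : Prop :=
  exists (neg : bool) w, weyl D w /\
    forall i v, ev (b i) (w v) = (-1) ^+ neg * al i v.

Definition bface (b : I -> 'Hom(V, R^o)) (J : {set I}) : set V :=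
  [set v | (forall i, i \in J -> ev (b i) v = 0) /\
           (forall i, i \notin J -> 0 < ev (b i) v)].

Lemma base_exists (neg : bool) w : weyl D w ->
  exists b, forall i v, ev (b i) (w v) = (-1) ^+ neg * al i v.
Proof.
move=> /weyl_inv[w' [/weyl_lfun[l le] wK _]].
exists (fun i => (-1) ^+ neg *: (sroot D i \o l)%VF) => i v.
by rewrite /ev scale_lfunE comp_lfunE -le wK.
Qed.

Lemma signK (neg : bool) (x : V) : (-1 : R) ^+ neg *: ((-1) ^+ neg *: x) = x.
Proof. by rewrite scalerA -signr_addb addbb scale1r. Qed.

Lemma bface_image b (neg : bool) w J : weyl D w ->
  (forall i v, ev (b i) (w v) = (-1) ^+ neg * al i v) ->
  bface b J = [set (-1) ^+ neg *: w v | v in std_face D J].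
Proof.
move=> ww be; have [w' [ww' wK w'K]] := weyl_inv ww.
have be' i v : ev (b i) ((-1) ^+ neg *: w v) = al i v.
  by rewrite evZ be mulrA -signr_addb addbb mul1r.
rewrite eqEsubset; split=> [u [u0 u1]|_ [v [v0 v1] <-]]; last first.
  by split=> i iJ; rewrite be'; [exact: v0|exact: v1].
have ue : (-1) ^+ neg *: w (w' ((-1) ^+ neg *: u)) = u by rewrite w'K signK.
exists (w' ((-1) ^+ neg *: u)) => //.
have E i : al i (w' ((-1) ^+ neg *: u)) = ev (b i) u by rewrite -be' ue.
split=> i iJ; first exact: etrans (E i) (u0 i iJ).
by have := u1 i iJ; rewrite -E.
Qed.

Lemma vectorial_faceP F : vectorial_face D F <->
  exists b J, is_base b /\ F = bface b J.
Proof.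
split=> [[neg [J [w ww ->]]]|[b [J [[neg [w [ww be]]] ->]]]].
  have [b be] := base_exists neg ww; exists b, J; split; first by exists neg, w.
  by rewrite (bface_image J ww be).
by exists neg, J, w => //; exact: bface_image.
Qed.

Lemma vectorial_chamberP F : vectorial_chamber D F <->
  exists b, is_base b /\ F = bface b finset.set0.
Proof.
split=> [[neg [w ww ->]]|[b [[neg [w [ww be]]] ->]]].
  have [b be] := base_exists neg ww; exists b; split; first by exists neg, w.
  by rewrite (bface_image _ ww be).
by exists neg, w => //; exact: bface_image.
Qed.

Lemma spherical_faceP F : spherical_face D F <->
  exists b J, [/\ is_base b, spherical_type D J & F = bface b J].
Proof.
split=> [[neg [J [[w ww ->] sJ]]]|[b [J [[neg [w [ww be]]] sJ ->]]]].
  have [b be] := base_exists neg ww; exists b, J; split=> //; first by exists neg, w.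
  by rewrite (bface_image _ ww be).
by exists neg, J; split=> //; exists w => //; exact: bface_image.
Qed.

Lemma bfaceN b J v : bface (fun i => - b i) J v <-> bface b J (- v).
Proof.
split=> -[h0 h1]; split=> i iJ.
- by have := h0 _ iJ; rewrite !evE.
- by have := h1 _ iJ; rewrite !evE.
- by have := h0 _ iJ; rewrite !evE.
- by have := h1 _ iJ; rewrite !evE.
Qed.

Lemma is_baseN b : is_base b -> is_base (fun i => - b i).
Proof.
case=> neg [w [ww be]]; exists (~~ neg), w; split=> // i v.
by rewrite ev_neg be signrN mulNr.
Qed.

Lemma tits_leP x y : tits_le D x y \/ tits_le D y x <->
  exists b J, is_base b /\ bface b J (y - x).
Proof.
split=> [[] [J [F [[w ww ->] Fv]]]|[b [J [[neg [w [ww be]]] bv]]]].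
- have [b be] := base_exists false ww; exists b, J; split; first by exists false, w.
  by rewrite (bface_image _ ww be).
- have [b be] := base_exists false ww; exists (fun i => - b i), J.
  split; first by apply: is_baseN; exists false, w.
  by apply/bfaceN; rewrite opprB (bface_image _ ww be).
move: bv; rewrite (bface_image _ ww be); case: neg be => be [v Jv e].
  right; exists J, [set (-1) ^+ false *: w v | v in std_face D J].
  split; first by exists w.
  exists v => //; rewrite scale1r -[RHS]opprB -e scaleN1r opprK //.
left; exists J, [set (-1) ^+ false *: w v | v in std_face D J].
by split; [exists w|exists v].
Qed.

Lemma tits_ltP x y : tits_lt D x y \/ tits_lt D y x <->
  exists b J, [/\ is_base b, spherical_type D J & bface b J (y - x)].
Proof.
split=> [[] [J [F [[w ww ->] sJ Fv]]]|[b [J [[neg [w [ww be]]] sJ bv]]]].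
- have [b be] := base_exists false ww; exists b, J; split=> //; first by exists false, w.
  by rewrite (bface_image _ ww be).
- have [b be] := base_exists false ww; exists (fun i => - b i), J.
  split=> //; first by apply: is_baseN; exists false, w.
  by apply/bfaceN; rewrite opprB (bface_image _ ww be).
move: bv; rewrite (bface_image _ ww be); case: neg be => be [v Jv e].
  right; exists J, [set (-1) ^+ false *: w v | v in std_face D J].
  split=> //; first by exists w.
  exists v => //; rewrite scale1r -[RHS]opprB -e scaleN1r opprK //.
left; exists J, [set (-1) ^+ false *: w v | v in std_face D J].
by split=> //; [exists w|exists v].
Qed.

Lemma spherical_type0 : spherical_type D finset.set0.
Proof.
apply: (@sub_finite_set _ _ [set id]); last exact: finite_set1.
apply: gen_group_min; last by move=> r [i] /=; rewrite finset.in_set0.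
split=> //=.
- by move=> g ->; exists id.
- by move=> g h -> ->.
- by move=> g h -> h1 _; apply/funext => v; exact: h1.
Qed.

Lemma base_dual b (c : I -> R) : is_base b -> exists v, forall i, ev (b i) v = c i.
Proof.
case=> neg [w [ww be]].
have [v ve] := free_codom_dual (fun i => (-1) ^+ neg * c i) (sroot_free D).
exists (w v) => i; rewrite be ve mulrA -signr_addb addbb mul1r //.
Qed.

Lemma bface_nonempty b J : is_base b -> exists c, bface b J c.
Proof.
move=> /(base_dual (fun i => (i \notin J)%:R))[c ce]; exists c.
by split=> i iJ; rewrite ce; [rewrite iJ|rewrite iJ ltr01].
Qed.

Lemma base_root b a : is_base b -> all_root D a -> exists n, coherent n /\
  forall v, ev a v = \sum_i (n i)%:~R * ev (b i) v.
Proof.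
case=> neg [w [ww be]] ra; have [a' ra' e] := all_root_weyl ww ra.
have [n [nc ne]] := all_root_coherent ra'.
have [w' [ww' wK w'K]] := weyl_inv ww.
exists (fun i => (-1) ^+ neg * n i); split.
  case: neg {be} => /=; last first.
    by case: nc => nc; [left|right] => i; rewrite mul1r.
  by case: nc => nc; [right|left] => i; rewrite mulN1r ?oppr_le0 ?oppr_ge0.
move=> v; rewrite -[v]w'K -e ne; apply: eq_bigr => i _.
by rewrite be; case: neg {be}; rewrite ?mul1r ?mulN1r ?intrN ?mulrNN.
Qed.

Lemma base_weyl_id b w v : is_base b -> weyl D w -> bface b finset.set0 v ->
  bface b finset.set0 (w v) -> w = id.
Proof.
case=> neg [u [wu be]] ww [_ bv] [_ bwv].
have [u' [wu' uK u'K]] := weyl_inv wu.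
pose v' := u' ((-1) ^+ neg *: v).
have bu i z : ev (b i) z = al i (u' ((-1) ^+ neg *: z)).
  rewrite weylZ // -{1}[z]u'K be; case: neg {be v'} => /=.
    by rewrite scaleN1r mulN1r evN.
  by rewrite scale1r mul1r.
have : (u' \o w) \o u = id.
  apply: (@weyl_chamber_id _ _ _ D _ v').
  - by apply: weyl_comp => //; apply: weyl_comp.
  - by move=> i; rewrite -bu; apply: bv; rewrite finset.in_set0.
  - move=> i; rewrite /v' /= u'K weylZ // -bu; apply: bwv.
    by rewrite finset.in_set0.
move=> e; apply/funext => z; rewrite -[z]u'K -[LHS]u'K.
by congr u; exact: (congr1 (@^~ (u' z)) e).
Qed.

(** The base conjugates [v] to a dominant vector [z]; the fixer of [z] is generated by the simple
    reflections whose roots vanish at [z], that is, by those of [J]. *)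
Lemma spherical_fixer b J : is_base b -> spherical_type D J ->
  forall v, bface b J v -> finite_set [set w | weyl D w /\ w v = v].
Proof.
case=> neg [u [wu be]] sJ v; rewrite (bface_image _ wu be) => -[z Jz <-].
have [u' [wu' uK u'K]] := weyl_inv wu.
apply: (@sub_finite_set _ _ ((fun g => u \o g \o u') @`
    gen_group [set srefl D i | i in [set` J]])); last exact: finite_image sJ.
move=> w [ww]; rewrite weylZ // => /(congr1 (fun z => (-1 : R) ^+ neg *: z)).
rewrite !signK => wz; exists (u' \o w \o u); last first.
  by apply/funext => y /=; rewrite u'K u'K.
have Jal i : al i z = 0 <-> i \in J.
  split=> [ali|]; last by case: Jz => + _; exact.
  apply: contrapT => /negP iJ; case: Jz => _ /(_ i iJ) z1.
  have : 0 < al i z by [].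
  by rewrite ali ltxx.
have -> : [set srefl D i | i in [set` J]] = [set srefl D i | i in [set i | al i z = 0]].
  by congr image; rewrite eqEsubset; split=> i /= /Jal.
apply: weyl_fixer.
- by apply: weyl_comp => //; exact: weyl_comp.
- move=> i; case: Jz => [z0 z1].
  have [iJ|iJ] := boolP (i \in J); first by rewrite le_eqVlt eq_sym; apply/orP; left; apply/eqP; exact: z0.
  exact/ltW/z1.
- by rewrite /= wz uK.
Qed.

End Bases.

(** * Enclosed sets *)

Section Neighbourhoods.
Context (R : realType) (V : vectType R).

Lemma vnbhsI (x : V) N M : vnbhs x N -> vnbhs x M -> vnbhs x (N `&` M).
Proof. by move=> hN hM; rewrite /vnbhs /= preimage_setI; exact: filterI. Qed.

Lemma vnbhsS (x : V) N M : N `<=` M -> vnbhs x N -> vnbhs x M.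
Proof. by move=> NM; rewrite /vnbhs /=; apply: filterS => v; exact: NM. Qed.

Lemma vnbhsT (x : V) : vnbhs x setT.
Proof. by rewrite /vnbhs /= preimage_setT; exact: filterT. Qed.

Lemma vnbhs_self (x : V) N : vnbhs x N -> N x.
Proof. by rewrite /vnbhs /= => /nbhs_singleton; rewrite /= v2rK. Qed.

Lemma vnbhs_ray (x c : V) N : vnbhs x N ->
  exists2 e : R, 0 < e & forall t, 0 < t <= e -> N (x + t *: c).
Proof.
move=> /nbhs_ballP[d /= d0 dN].
pose M := \sum_j `|v2r c 0 j|.
have M0 : 0 <= M by rewrite sumr_ge0.
exists (d / (M + 1)); first by rewrite divr_gt0 // ltr_wpDl.
move=> t /andP[t0 te]; rewrite -[_ + _]v2rK; apply: dN; split=> // i j.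
rewrite linearD linearZ /= /ball /= mxE opprD addrA subrr add0r normrN mxE normrM.
rewrite gtr0_norm // (ord1 i).
have cM : `|v2r c 0 j| <= M by rewrite /M (bigD1 j) //= lerDl sumr_ge0.
have : t * (M + 1) <= d by rewrite -ler_pdivlMr // ltr_wpDl.
have : t * `|v2r c 0 j| <= t * M by rewrite ler_pM2l.
lra.
Qed.

Lemma vnbhs_form (x : V) (a : 'Hom(V, R^o)) (e : R) : 0 < e ->
  vnbhs x [set v | `|ev a (v - x)| < e].
Proof.
move=> e0; pose M := \sum_j `|ev a (r2v (delta_mx 0 j))|.
have M0 : 0 <= M by rewrite sumr_ge0.
apply/nbhs_ballP; exists (e / (M + 1)) => /=; first by rewrite divr_gt0 // ltr_wpDl.
move=> y xy /=.
set z := v2r x - y.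
have -> : r2v y - x = - r2v z by rewrite /z [r2v (_ - _)]linearB /= v2rK opprB.
have zj j : `|z 0 j| <= e / (M + 1).
  by case: xy => _ /(_ 0 j); rewrite /ball /= /z !mxE => /ltW.
rewrite evN normrN [z]row_sum_delta linear_sum ev_sum.
apply: le_lt_trans (ler_norm_sum _ _ _) _.
apply: (@le_lt_trans _ _ (\sum_j (e / (M + 1)) * `|ev a (r2v (delta_mx 0 j))|)).
  by apply: ler_sum => j _; rewrite linearZ evZ normrM ler_wpM2r.
rewrite -mulr_sumr -/M mulrAC ltr_pdivrMr ?ltr_wpDl // ltr_pM2l //.
lra.
Qed.

Lemma vnbhs_forms (I : finType) (x : V) (a : I -> 'Hom(V, R^o)) (e : I -> R) :
  (forall i, 0 < e i) -> vnbhs x [set v | forall i, `|ev (a i) (v - x)| < e i].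
Proof.
move=> e0.
suff : forall s : seq I, vnbhs x [set v | forall i, i \in s -> `|ev (a i) (v - x)| < e i].
  move=> /(_ (enum I)); apply: vnbhsS => v h i; apply: h; exact: mem_enum.
elim=> [|i s IH]; first by apply: (vnbhsS _ (vnbhsT x)).
apply: vnbhsS (vnbhsI (vnbhs_form x (a i) (e0 i)) IH) => v [hi hs] j.
by rewrite inE => /predU1P[->|/hs].
Qed.

End Neighbourhoods.

(** * Enclosed sets: intervals, recession cones, germs and chimneys *)

Section Enclosures.
Context (R : realType) (V : vectType R) (I : finType) (D : vectorial_data V I).
Context (AA : model_apartment D).
Local Notation is_base := (is_base D).

Definition half_spaces (k : 'Hom(V, R^o) -> option R) : set V :=
  \bigcap_(alpha in all_root D) half_apartment alpha (k alpha).

Definition is_encl (E : set V) : Prop := exists k,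
  (forall alpha, all_root D alpha -> admissible AA alpha (k alpha)) /\
  E = half_spaces k.

Lemma half_spacesP k v : half_spaces k v <->
  forall a r, all_root D a -> k a = Some r -> 0 <= ev a v + r.
Proof.
split=> [h a r ra ka|h a ra]; first by have := h a ra; rewrite ka.
by case ka: (k a) => [r|//]; exact: h.
Qed.

Lemma enclosureP F U : enclosure AA F U <-> exists E, [/\ is_encl E, F E & E `<=` U].
Proof.
split=> [[k [ka FE EU]]|[_ [[k [ka ->]] FE EU]]].
  by exists (half_spaces k); split=> //; exists k.
by exists k.
Qed.

Lemma is_enclT : is_encl setT.
Proof.
exists (fun=> None); split=> //; rewrite eqEsubset; split=> // v _.
Qed.

Lemma is_enclI E E' : is_encl E -> is_encl E' -> is_encl (E `&` E').
Proof.
move=> [k [ka ->]] [k' [ka' ->]].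
pose kk a := match k a, k' a with
  | Some r, Some r' => Some (Num.min r r')
  | Some r, None => Some r
  | None, o => o end.
exists kk; split=> [a ra|].
  have := ka a ra; have := ka' a ra; rewrite /kk.
  case: (k a) => [r|//]; case: (k' a) => [r'|//] /= h' h rra.
  by case: (leP r r') => _; [exact: h|exact: h'].
rewrite eqEsubset; split=> v.
  move=> [/half_spacesP h /half_spacesP h']; apply/half_spacesP => a s ra.
  have := h a _ ra; have := h' a _ ra; rewrite /kk.
  case: (k a) => [r|]; case: (k' a) => [r'|] // hr' hr [<-].
  - by case: (leP r r') => _; [exact: hr|exact: hr'].
  - exact: hr.
  - exact: hr'.
move=> /half_spacesP h; split; apply/half_spacesP => a s ra kas.
  have := h a _ ra; rewrite /kk kas; case: (k' a) => [r'|] /(_ _ erefl) //.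
  by move=> h1; apply: le_trans h1 _; rewrite lerD2l ge_min lexx.
have := h a _ ra; rewrite /kk kas; case: (k a) => [r'|] /(_ _ erefl) //.
by move=> h1; apply: le_trans h1 _; rewrite lerD2l ge_min lexx orbT.
Qed.

Lemma coherent_form (b : I -> 'Hom(V, R^o)) (n : I -> int) (a : 'Hom(V, R^o)) :
  coherent n -> (forall v, ev a v = \sum_i (n i)%:~R * ev (b i) v) ->
  (forall u, (forall i, 0 <= ev (b i) u) -> 0 <= ev a u) \/
  (forall u, (forall i, 0 <= ev (b i) u) -> ev a u <= 0).
Proof.
move=> [n0|n0] e; [left|right] => u u0; rewrite e.
  by apply: sumr_ge0 => i _; rewrite mulr_ge0 // ler0z.
by apply: sumr_le0 => i _; rewrite mulr_le0_ge0 // lerz0.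
Qed.

Lemma base_sign b a : is_base b -> all_root D a ->
  (forall u, (forall i, 0 <= ev (b i) u) -> 0 <= ev a u) \/
  (forall u, (forall i, 0 <= ev (b i) u) -> ev a u <= 0).
Proof. by move=> bb ra; have [n [nc /(coherent_form nc)]] := base_root bb ra. Qed.

(* Every root is monotone for the order defined by [b]. *)
Lemma encl_interval E b x c u : is_encl E -> is_base b -> E x -> E (x + c) ->
  (forall i, 0 <= ev (b i) u <= ev (b i) c) -> E (x + u).
Proof.
move=> [k [ka ->]] bb /half_spacesP Ex /half_spacesP Exc uc.
apply/half_spacesP => a r ra kr; have := Ex _ _ ra kr; have := Exc _ _ ra kr.
have [s|s] := base_sign bb ra.
  have := s u (fun i => proj1 (andP (uc i))); rewrite !evD; lra.
have cu i : 0 <= ev (b i) (c - u) by rewrite evB subr_ge0; case/andP: (uc i).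
have := s (c - u) cu; rewrite evB !evD; lra.
Qed.

Lemma encl_closed E x c (e : R) : is_encl E -> 0 < e ->
  (forall t, 0 < t <= e -> E (x + t *: c)) -> E x.
Proof.
move=> [k [ka ->]] e0 h; apply/half_spacesP => a r ra kr.
rewrite leNgt; apply/negP => xr.
pose m := - (ev a x + r); have m0 : 0 < m by rewrite oppr_gt0.
have [ac|ac] := leP (ev a c) 0.
  have te : 0 < e <= e by rewrite e0 lexx.
  have /half_spacesP/(_ _ _ ra kr) := h e te.
  by rewrite evD evZ; rewrite /m in m0; nra.
pose t := Num.min e (m / (2 * ev a c)).
have t0 : 0 < t by rewrite lt_min e0 divr_gt0 // mulr_gt0.
have te : 0 < t <= e by rewrite t0 ge_min lexx.
have /half_spacesP/(_ _ _ ra kr) := h t te.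
have : t * (2 * ev a c) <= m.
  by rewrite -ler_pdivlMr ?mulr_gt0 // ge_min lexx orbT.
by rewrite evD evZ /m; nra.
Qed.

(** A root bounding [E] is nonnegative at [c], since its half-apartment contains a ray. If its
    coefficients are nonpositive, it vanishes at [c] and so involves only the simple roots of [J].
    In both cases it is nonnegative at [c'], and [E] is stable under translation by [c']. *)
Lemma encl_recession E b J x y c c' : is_encl E -> is_base b -> bface b J c ->
  (forall i, i \in J -> ev (b i) c' = 0) -> (forall i, 0 <= ev (b i) c') ->
  (forall t, 0 < t -> E (x + t *: c)) -> E y -> E (y + c').
Proof.
move=> [k [ka ->]] bb [c0 c1] c'0 c'1 h /half_spacesP Ey.
apply/half_spacesP => a r ra kr; have := Ey _ _ ra kr; rewrite evD => yr.
have cpos i : 0 <= ev (b i) c.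
  by have [/c0 ->//|/c1/ltW] := boolP (i \in J).
have ac0 : 0 <= ev a c.
  rewrite leNgt; apply/negP => ac.
  pose t := (`|ev a x + r| + 1) / - ev a c.
  have t0 : 0 < t by rewrite divr_gt0 ?oppr_gt0 // ltr_wpDl.
  have /half_spacesP/(_ _ _ ra kr) := h t t0.
  have : t * ev a c = - (`|ev a x + r| + 1).
    by rewrite /t invrN mulrN mulNr divfK // lt_eqF.
  have := ler_norm (ev a x + r); rewrite evD evZ; lra.
suff : 0 <= ev a c' by lra.
have [n [nc e]] := base_root bb ra; case: nc => n0.
  by rewrite e sumr_ge0 // => i _; rewrite mulr_ge0 // ler0z.
have ac : ev a c = 0.
  apply/eqP; rewrite eq_le ac0 andbT e sumr_le0 // => i _.
  by rewrite mulr_le0_ge0 // lerz0.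
rewrite e big1 // => i _; have [/c'0 ->|iJ] := boolP (i \in J).
  by rewrite mulr0.
suff -> : n i = 0 by rewrite mul0r.
move: ac; rewrite e => /eqP.
rewrite -oppr_eq0 -sumrN psumr_eq0 => [/allP/(_ i)|j _]; last first.
  by rewrite oppr_ge0 mulr_le0_ge0 // lerz0.
rewrite mem_index_enum => /(_ isT); rewrite oppr_eq0 mulf_eq0 intr_eq0.
by rewrite [ev _ _ == 0]gt_eqF ?c1 // orbF => /eqP.
Qed.

Lemma bface_scale (b : I -> 'Hom(V, R^o)) J c (t : R) :
  0 < t -> bface b J c -> bface b J (t *: c).
Proof.
move=> t0 [c0 c1]; split=> i iJ; rewrite evZ; first by rewrite c0 ?mulr0.
by rewrite mulr_gt0 // c1.
Qed.

Lemma bfaceD (b : I -> 'Hom(V, R^o)) J c c' :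
  bface b J c -> bface b J c' -> bface b J (c + c').
Proof.
move=> [c0 c1] [d0 d1]; split=> i iJ; rewrite evD; first by rewrite c0 ?d0 ?addr0.
by rewrite addr_gt0 ?c1 ?d1.
Qed.

Lemma bface_ge0 (b : I -> 'Hom(V, R^o)) J c : bface b J c -> forall i, 0 <= ev (b i) c.
Proof. by move=> [c0 c1] i; have [/c0 ->//|/c1/ltW] := boolP (i \in J). Qed.

Lemma bface_small (b : I -> 'Hom(V, R^o)) J c u :
  bface b J c -> bface b J u ->
  (forall i, `|ev (b i) u| < if i \in J then 1 else ev (b i) c) ->
  forall i, 0 <= ev (b i) u <= ev (b i) c.
Proof.
move=> bc bu h i; rewrite (bface_ge0 bu) /=.
have [iJ|iJ] := boolP (i \in J).
  by case: bc => + _; case: bu => + _ => -> // ->.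
by have := h i; rewrite (negbTE iJ) => /ltW; apply: le_trans; exact: ler_norm.
Qed.

Lemma vnbhs_bface (b : I -> 'Hom(V, R^o)) J x c : bface b J c ->
  vnbhs x [set v | bface b J (v - x) -> forall i, 0 <= ev (b i) (v - x) <= ev (b i) c].
Proof.
move=> bc; pose e i := if i \in J then 1 else ev (b i) c.
have e0 i : 0 < e i.
  by rewrite /e; case: ifPn => // iJ; case: bc => _; exact.
apply: vnbhsS (vnbhs_forms x b e0) => v /= h bv.
exact: bface_small bc bv h.
Qed.

(** Two points suffice: half-apartments are closed, which gives [x], and conversely the box spanned
    by [x] and [x + c] contains a neighbourhood of [x] in the face. *)
Lemma germ_encl E b J x : is_encl E -> is_base b ->
  germ x (translate x (bface b J)) E <-> E x /\ exists2 c, bface b J c & E (x + c).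
Proof.
move=> eE bb; split=> [[N xN NE]|[Ex [c bc Exc]]].
  have [c bc] := bface_nonempty J bb.
  have [e e0 he] := vnbhs_ray c xN.
  have hE t : 0 < t <= e -> E (x + t *: c).
    move=> te; apply: NE; split; last exact: he.
    by exists (t *: c) => //; apply: bface_scale => //; case/andP: te.
  split; first exact: encl_closed eE e0 hE.
  by exists (e *: c); [exact: bface_scale|apply: hE; rewrite e0 lexx].
eexists; first exact: vnbhs_bface bc.
move=> _ [[u bu <-]] /=; rewrite addrAC subrr add0r => /(_ bu).
exact: encl_interval eE bb Ex Exc.
Qed.

Lemma germ_segment_encl E b J x y : is_encl E -> is_base b -> bface b J (y - x) ->
  germ x (segment_oc x y) E <-> germ x (translate x (bface b J)) E.
Proof.
move=> eE bb byx; split=> [[N xN NE]|[N xN NE]]; last first.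
  exists N => // _ [[t /= /andP[t0 t1] <-] Nt]; apply: NE; split=> //.
  by exists (t *: (y - x)) => //; exact: bface_scale.
have [e e0 he] := vnbhs_ray (y - x) xN.
pose e' := Num.min e 1; have e'0 : 0 < e' by rewrite lt_min e0 ltr01.
have hE t : 0 < t <= e' -> E (x + t *: (y - x)).
  move=> /andP[t0]; rewrite le_min => /andP[te t1]; apply: NE; split.
    by exists t => //=; rewrite t0 t1.
  by apply: he; rewrite t0.
apply/(germ_encl _ _ eE bb); split; first exact: encl_closed eE e'0 hE.
by exists (e' *: (y - x)); [exact: bface_scale|apply: hE; rewrite e'0 lexx].
Qed.

(** A test by points, for enclosed sets [E], of the containment of a chimney with base point [y]. *)
Definition in_chimney (y : V) (F1 Fv E : set V) : Prop :=
  [/\ E y, exists2 c, F1 c & E (y + c) & forall c, Fv c -> E (y + c)].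

(** Letting [s] or [t] tend to 0 in [x + xi + t c1 + s c] isolates the conditions of the test.
    Conversely the box below [c1] can be pushed along the face [Fv], a recession direction of
    [E]. *)
Lemma filter_add_encl E b1 J1 b J x xi : is_encl E -> is_base b1 -> is_base b ->
  filter_add (filter_translate xi (germ x (translate x (bface b1 J1))))
    (bface b J) E <->
  in_chimney (x + xi) (bface b1 J1) (bface b J) E.
Proof.
move=> eE bb1 bb; split=> [[N [M xM MN] NE]|[Ey [c1 bc1 Ec1] Ec]].
  have [c1 bc1] := bface_nonempty J1 bb1.
  have [c0 bc0] := bface_nonempty J bb.
  have [e e0 he] := vnbhs_ray c1 xM.
  have key t s c : 0 < t <= e -> 0 < s -> bface b J c ->
      E (x + xi + t *: c1 + s *: c).
    move=> te s0 bc; apply: NE; exists (x + t *: c1 + xi).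
      apply: (MN (x + t *: c1)); split; last exact: he.
      by exists (t *: c1) => //; apply: bface_scale => //; case/andP: te.
    by exists (s *: c); [exact: bface_scale|rewrite (addrAC x)].
  have key1 t : 0 < t <= e -> E (x + xi + t *: c1).
    move=> te; apply: (encl_closed (c := c0) eE ltr01) => s /andP[s0 _].
    exact: key.
  have Ey := encl_closed eE e0 key1.
  split=> //.
    by exists (e *: c1); [exact: bface_scale|apply: key1; rewrite e0 lexx].
  move=> c bc; apply: (encl_closed (c := c1) eE e0) => t te.
  by rewrite addrAC -[c]scale1r; exact: key.
exists [set v + xi | v in [set x + u | u in
    [set u | bface b1 J1 u /\ forall i, 0 <= ev (b1 i) u <= ev (b1 i) c1]]].
  eexists; first exact: vnbhs_bface bc1.
  move=> _ [[u bu <-]] /=; rewrite addrAC subrr add0r => /(_ bu) uc.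
  by exists (x + u) => //; exists u.
move=> _ [_ [_ [u [bu uc] <-] <-]] [c bc <-].
rewrite (addrAC x).
have [c0 bc0] := bface_nonempty J bb.
apply: (encl_recession (x := x + xi) eE bb bc0).
- by case: bc.
- exact: bface_ge0 bc.
- by move=> t t0; apply: Ec; exact: bface_scale.
- exact: encl_interval eE bb1 Ey Ec1 uc.
Qed.

Lemma filter_translate0 (F : set_system V) : filter_translate 0 F = F.
Proof.
apply/funext => U; rewrite /filter_translate /fmap /=; congr F.
by apply/funext => v; rewrite /= addr0.
Qed.

Lemma chimneyP b1 J1 b J x U : is_base b1 -> is_base b ->
  chimney AA (germ x (translate x (bface b1 J1))) (bface b J) U <->
  exists E, [/\ is_encl E, in_chimney x (bface b1 J1) (bface b J) E & E `<=` U].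
Proof.
move=> bb1 bb; rewrite /chimney -[germ _ _]filter_translate0.
split=> [/enclosureP[E [eE FE EU]]|[E [eE FE EU]]].
  by exists E; split=> //; move/(filter_add_encl _ _ _ _ eE bb1 bb): FE; rewrite addr0.
apply/enclosureP; exists E; split=> //.
by apply/(filter_add_encl _ _ _ _ eE bb1 bb); rewrite addr0.
Qed.

Lemma chimney_germP b1 J1 b J x U : is_base b1 -> is_base b ->
  chimney_germ AA (germ x (translate x (bface b1 J1))) (bface b J) U <->
  exists xi, bface b J xi /\
    exists E, [/\ is_encl E, in_chimney (x + xi) (bface b1 J1) (bface b J) E & E `<=` U].
Proof.
move=> bb1 bb; split=> [[xi bxi /enclosureP[E [eE FE EU]]]|[xi [bxi [E [eE FE EU]]]]].
  exists xi; split=> //; exists E; split=> //.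
  exact/(filter_add_encl _ _ _ _ eE bb1 bb).
exists xi => //; apply/enclosureP; exists E; split=> //.
exact/(filter_add_encl _ _ _ _ eE bb1 bb).
Qed.

End Enclosures.

(** * The affine Weyl group *)

Section AffineWeyl.
Context (R : realType) (V : vectType R) (I : finType) (D : vectorial_data V I).
Context (AA : model_apartment D).
Local Notation is_base := (is_base D).
Local Notation is_encl := (is_encl AA).

Lemma root_coroot2 a h : root_coroot D a h -> ev a h = 2.
Proof. by case=> w [i [_ e ->]]; rewrite -(al_cr D i); exact: e. Qed.

Lemma affine_reflectionK a h k : root_coroot D a h ->
  involutive (affine_reflection a h k).
Proof.
move=> /root_coroot2 ah v; rewrite /affine_reflection -/(ev a v).
rewrite -[a (v - _)]/(ev a (v - _)) !evE ah -addrA -opprD -scalerDl.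
set c := (X in X *: h); have -> : c = 0 by rewrite /c; lra.
by rewrite scale0r subr0.
Qed.

Lemma Wa_group : bij_group (Wa AA).
Proof.
apply: gen_group_bij => _ [a [h [k [ah _ ->]]]].
by exists (affine_reflection a h k); exact: affine_reflectionK.
Qed.

Lemma Wa_id : Wa AA id. Proof. by have [] := Wa_group. Qed.

Lemma Wa_comp w w' : Wa AA w -> Wa AA w' -> Wa AA (w \o w').
Proof. by have [_ _ + _] := Wa_group; exact. Qed.

Lemma Wa_inv w : Wa AA w -> exists w', [/\ Wa AA w', cancel w w' & cancel w' w].
Proof. by move=> ww; exact: bij_group_inv Wa_group ww. Qed.

Lemma root_reflection_weyl a h : root_coroot D a h -> weyl D (fun v => v - ev a v *: h).
Proof.
case=> w [i [ww e ->]]; have [w' [ww' wK w'K]] := weyl_inv ww.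
have -> : (fun v => v - ev a v *: w (scoroot D i)) = w \o (srefl D i \o w').
  apply/funext => v /=; rewrite sreflE (weylB _ _ ww) (weylZ _ _ ww) w'K.
  by congr (_ - _ *: _); rewrite -[v in LHS]w'K; exact: e.
by apply: weyl_comp => //; apply: weyl_comp => //; exact: weyl_srefl.
Qed.

Lemma Wa_affine w : Wa AA w ->
  exists w0 t, weyl D w0 /\ forall v, w v = w0 v + t.
Proof.
move: w; apply: gen_group_min; last first.
  move=> _ [a [h [k [ah _ ->]]]].
  exists (fun v => v - ev a v *: h), (- (k *: h)); split.
    exact: root_reflection_weyl.
  by move=> v; rewrite /affine_reflection -/(ev a v) scalerDl opprD addrA.
split.
- move=> g [w0 [t [ww e]]]; have [w' [ww' wK w'K]] := weyl_inv ww.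
  exists (fun v => w' (v - t)) => v; first by rewrite e addrK wK.
  by rewrite e w'K subrK.
- by exists id, 0; split=> [|v]; [exact: weyl_id|rewrite addr0].
- move=> g h [w0 [t [ww e]]] [w1 [t1 [ww1 e1]]].
  exists (w0 \o w1), (w0 t1 + t); split; first exact: weyl_comp.
  by move=> v /=; rewrite e1 e (weylD _ _ ww) addrA.
move=> g h [w0 [t [ww e]]] gK hK; have [w' [ww' wK w'K]] := weyl_inv ww.
exists w', (- w' t); split=> // v.
by rewrite -{2}(hK v) e (weylD _ _ ww') wK addrK.
Qed.

Lemma weyl_Wa w : weyl D w -> Wa AA w.
Proof.
move: w; apply: gen_group_min; first exact: Wa_group.
move=> _ [i _ <-]; apply: sub_gen_group.
have ri : root_coroot D (sroot D i) (scoroot D i).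
  by exists id, i; split=> //; exact: weyl_id.
exists (sroot D i), (scoroot D i), 0; split=> //.
  by apply: wall_params0; exists (scoroot D i).
by apply/funext => v; rewrite /affine_reflection addr0.
Qed.

Lemma Wa_wall_params w w0 t a a' k : Wa AA w -> (forall v, w v = w0 v + t) ->
  (forall v, ev a' v = ev a (w0 v)) ->
  wall_params (walls AA) a k -> wall_params (walls AA) a' (k + ev a t).
Proof.
move=> ww we ae ak; have [w' [ww' wK w'K]] := Wa_inv ww.
have := walls_stable ww' ak; rewrite /wall_params /=.
suff -> : w' @` wall a k = wall a' (k + ev a t) by [].
rewrite eqEsubset; split=> [_ [v va <-]|v va].
  rewrite /wall /= -/(ev a' _) ae; move: va; rewrite /wall /= -/(ev a v) => <-.
  by rewrite -{2}(w'K v) we evD; lra.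
exists (w v); last exact: wK.
by move: va; rewrite /wall /= -/(ev a' v) -/(ev a (w v)) ae we evD => <-; lra.
Qed.

(** The linear part permutes the roots and the translation part shifts their parameters; for a real
    root the new parameter is again that of a wall because [Wa] preserves the walls. *)
Lemma is_encl_preimage w E : Wa AA w -> is_encl E -> is_encl (w @^-1` E).
Proof.
move=> ww [k [ka ->]]; have [w0 [t [ww0 we]]] := Wa_affine ww.
have [w1 [ww1 w0K w1K]] := weyl_inv ww0.
have [l le] := weyl_lfun ww0; have [l1 l1e] := weyl_lfun ww1.
have comp_root (m : 'End(V)) u a : weyl D u -> (forall v, u v = m v) ->
    all_root D a -> all_root D (a \o m)%VF.
  move=> wu um ra; have [a' ra' e] := all_root_weyl wu ra.
  suff -> : (a \o m)%VF = a' by [].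
  by apply: ev_inj => v; rewrite e comp_form um.
have compK (a : 'Hom(V, R^o)) : ((a \o l1) \o l)%VF = a.
  by apply: ev_inj => v; rewrite !comp_form -l1e -le w0K.
have compK' (a : 'Hom(V, R^o)) : ((a \o l) \o l1)%VF = a.
  by apply: ev_inj => v; rewrite !comp_form -l1e -le w1K.
pose k' a := omap (fun r => r + ev (a \o l1)%VF t) (k (a \o l1)%VF).
exists k'; split=> [a ra|].
  have := ka _ (comp_root _ _ _ ww1 l1e ra); rewrite /k'.
  case: (k _) => [r|//] /= h rra; apply: (Wa_wall_params ww we).
    by move=> v; rewrite comp_form -l1e w0K.
  apply: h; have [a' ra' e] := real_root_weyl ww1 rra.
  suff -> : (a \o l1)%VF = a' by [].
  by apply: ev_inj => v; rewrite e comp_form l1e.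
rewrite eqEsubset; split=> v /half_spacesP h; apply/half_spacesP => a r ra.
  rewrite /k'; case kE: (k _) => [s|//] /= [<-].
  have := h _ _ (comp_root _ _ _ ww1 l1e ra) kE.
  by rewrite we evD comp_form -l1e w0K; lra.
move=> kr; have := h (a \o l)%VF (r + ev a t) (comp_root _ _ _ ww0 le ra).
rewrite /k' compK' kr => /(_ erefl).
by rewrite comp_form -le we evD; lra.
Qed.

(** The product of the reflections in two parallel walls is a translation by a multiple of the
    coroot [h], and [a] takes the value 2 at [h]. *)
Lemma wall_params_translate a h k n : root_coroot D a h ->
  wall_params (walls AA) a k -> wall_params (walls AA) a n ->
  wall_params (walls AA) a (n + 2 * k) /\ wall_params (walls AA) a (n - 2 * k).
Proof.
move=> ah ak an; have ra : real_root D a by exists h.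
have r0 : Wa AA (affine_reflection a h 0).
  by apply: sub_gen_group; exists a, h, 0; split=> //; exact: wall_params0.
have rk : Wa AA (affine_reflection a h k).
  by apply: sub_gen_group; exists a, h, k.
have ah2 := root_coroot2 ah.
split.
  have := Wa_wall_params (w0 := id) (t := k *: h) (Wa_comp r0 rk) _ _ an.
  rewrite evZ ah2 mulrC; apply=> v //=.
  rewrite /affine_reflection -/(ev a v) -[a (v - _)]/(ev a (v - _)) !evE ah2.
  by rewrite -addrA -opprD -scalerDl -scaleNr; congr (_ + _ *: _); lra.
have := Wa_wall_params (w0 := id) (t := - k *: h) (Wa_comp rk r0) _ _ an.
rewrite evZ ah2 mulNr mulrC; apply=> v //=.
rewrite /affine_reflection -/(ev a v) -[a (v - _)]/(ev a (v - _)) !evE ah2.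
by rewrite -addrA -opprD -scalerDl -scaleNr; congr (_ + _ *: _); lra.
Qed.

(* There are finitely many orbits of real roots, so the gaps of the sets of
   parameters of walls are uniformly bounded. *)
Lemma wall_params_gap : exists2 d : R, 0 < d & forall a, real_root D a ->
  forall r, exists2 k, wall_params (walls AA) a k & r <= k <= r + d.
Proof.
have gap i : exists2 d : R, 0 < d & forall r, exists2 k,
    wall_params (walls AA) (sroot D i) k & r <= k <= r + d.
  have ri : root_coroot D (sroot D i) (scoroot D i).
    by exists id, i; split=> //; exact: weyl_id.
  have rri : real_root D (sroot D i) by exists (scoroot D i).
  have [k0 [ak0 k00]] : exists k0, wall_params (walls AA) (sroot D i) k0 /\ k0 != 0.
    apply: contrapT => h; apply: (wall_params_infinite rri).
    apply: (@sub_finite_set _ _ [set 0]); last exact: finite_set1.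
    by move=> k ak; apply: contrapT => k1; apply: h; exists k; split; [exact: ak|exact/eqP].
  (* All integer multiples of [d] are parameters, since 0 is one and the translation by [k0] moves
     parameters by [2 k0]. *)
  pose d := 2 * `|k0|; have d0 : 0 < d by rewrite mulr_gt0 // normr_gt0.
  have stepd n : wall_params (walls AA) (sroot D i) n ->
      wall_params (walls AA) (sroot D i) (n + d) /\
      wall_params (walls AA) (sroot D i) (n - d).
    move=> an; have [h1 h2] := wall_params_translate ri ak0 an.
    rewrite /d; case: (leP 0 k0) => k0s; first by rewrite ger0_norm //; split.
    by rewrite ltr0_norm // mulrN opprK; split.
  have natd (n : nat) : wall_params (walls AA) (sroot D i) (n%:R * d) /\
      wall_params (walls AA) (sroot D i) (- (n%:R * d)).
    elim: n => [|n [h1 h2]]; first by rewrite mul0r oppr0; split; exact: wall_params0.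
    rewrite -natr1 mulrDl mul1r opprD; split.
      by have [] := stepd _ h1.
    by have [] := stepd _ h2.
  exists d => // r; exists ((Num.ceil (r / d))%:~R * d).
    have [|n|n] := intP (Num.ceil (r / d)).
    - by have [] := natd 0%N.
    - by have [] := natd n.+1.
    - by rewrite rmorphN mulNr; have [] := natd n.+1.
  have /andP[h1 h2] := ceil_itv (r / d).
  rewrite -ler_pdivrMr // h2 /=.
  have -> : r + d = (r / d + 1) * d by rewrite mulrDl mul1r divfK // gt_eqF.
  by rewrite ler_pM2r //; move: h1; rewrite intrB; lra.
have /choice[d hd] : forall i, exists d : R, 0 < d /\ forall r, exists2 k,
    wall_params (walls AA) (sroot D i) k & r <= k <= r + d.
  by move=> i; have [d d0 h] := gap i; exists d.
(* The sum bounds every [d i]; the summand 1 makes positivity immediate. *)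
exists (1 + \sum_i d i); first by rewrite ltr_pwDl // sumr_ge0 // => i _; apply: ltW; case: (hd i).
move=> a [h [w [i [ww e _]]]] r; have [w' [ww' wK w'K]] := weyl_inv ww.
have [_ /(_ r)[k ik /andP[rk kr]]] := hd i; exists k.
  have := Wa_wall_params (a := sroot D i) (a' := a) (w0 := w') (t := 0) (weyl_Wa ww') _ _ ik.
  rewrite ev0 addr0; apply=> v; first by rewrite addr0.
  by rewrite -{1}(w'K v); exact: e.
rewrite rk /=; apply: le_trans kr _; rewrite lerD2l.
have dj j : 0 <= d j by apply: ltW; case: (hd j).
rewrite (bigD1 i) //=; have : 0 <= \sum_(j | j != i) d j by rewrite sumr_ge0.
lra.
Qed.

End AffineWeyl.

(** * Chimneys *)

Section ChimneyFixedPoints.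
Context (R : realType) (V : vectType R) (I : finType) (D : vectorial_data V I).
Context (AA : model_apartment D).
Local Notation is_base := (is_base D).
Local Notation is_encl := (is_encl AA).

Lemma affine_slope_ge0 (p q : R) : (forall t, 0 < t -> 0 <= p + t * q) -> 0 <= q.
Proof.
move=> h; rewrite leNgt; apply/negP => q0.
pose t := (`|p| + 1) / - q.
have t0 : 0 < t by rewrite divr_gt0 ?oppr_gt0 // ltr_wpDl.
have := h t t0; have -> : t * q = - (`|p| + 1).
  by rewrite /t invrN mulrN mulNr divfK // lt_eqF.
have := ler_norm p; lra.
Qed.

Lemma finite_lower_bound (J : finType) (P : pred J) (x : J -> R) :
  (forall j, P j -> 0 < x j) -> exists2 c, 0 < c & forall j, P j -> c <= x j.
Proof.
move=> x0.
suff [c c0 h] : exists2 c, 0 < c & forall j, j \in enum J -> P j -> c <= x j.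
  by exists c => // j; apply: h; exact: mem_enum.
elim: (enum J) => [|j s [c c0 IH]]; first by exists 1.
have [Pj|nPj] := boolP (P j); last first.
  exists c => // l; rewrite inE => /predU1P[->|/IH//].
  by rewrite (negbTE nPj).
exists (Num.min c (x j)); first by rewrite lt_min c0 x0.
move=> l; rewrite inE => /predU1P[->|ls Pl]; first by rewrite ge_min lexx orbT.
by rewrite ge_min IH.
Qed.

(** Coefficients are integers: a root positive at [xi] has nonnegative coefficients and one at least
    1 outside [J], so the least value of [b i] at [xi], [i] outside [J], bounds all such roots at
    once. *)
Lemma root_value_lower_bound b J xi : is_base b -> bface b J xi ->
  exists2 c : R, 0 < c & forall a, all_root D a -> 0 < ev a xi -> c <= ev a xi.
Proof.
move=> bb bxi; have [xi0 xi1] := bxi.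
have [c c0 hc] := finite_lower_bound xi1.
exists c => // a ra a0; have [n [nc e]] := base_root bb ra.
have bge := bface_ge0 bxi.
case: nc => n0; last first.
  move: a0; rewrite e ltNge => /negP[]; apply: sumr_le0 => i _.
  by rewrite mulr_le0_ge0 // lerz0.
have [i iJ ni] : exists2 i, i \notin J & n i != 0.
  apply: contrapT => h; move: a0; rewrite e big1 ?ltxx // => i _.
  have [/xi0 ->|iJ] := boolP (i \in J); first by rewrite mulr0.
  have [->|ni] := eqVneq (n i) 0; first by rewrite mul0r.
  by exfalso; apply: h; exists i.
rewrite e (bigD1 i) //=.
have s0 : 0 <= \sum_(j | j != i) (n j)%:~R * ev (b j) xi.
  by apply: sumr_ge0 => j _; rewrite mulr_ge0 // ler0z.
have n1 : 1 <= (n i)%:~R :> R by rewrite ler1z; have := n0 i; move: ni; lia.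
have := hc i iJ; nra.
Qed.

(** Common to the fixed sets of affine maps and to affine subspaces, the two kinds of sets to be
    brought back from the germ of a chimney to the chimney. *)
Definition line_closed (X : set V) : Prop := forall z c (t0 : R),
  (forall t, t0 <= t -> X (z + t *: c)) -> X z.

(* A half-apartment containing the shifted chimney of base [x + xi] can be
   moved back by [alpha (xi)], up to the bounded gap between walls, to contain
   the chimney of base [x]. Conversely, translating the resulting enclosed set
   by a large multiple of [xi] brings it into the shifted chimney, so both span
   the same affine subspace. *)
Lemma chimney_germ_line_closed X b1 J1 b J x : line_closed X ->
  is_base b1 -> is_base b ->
  chimney_germ AA (germ x (translate x (bface b1 J1))) (bface b J) X ->
  chimney AA (germ x (translate x (bface b1 J1))) (bface b J) X.
Proof.
move=> lX bb1 bb /(chimney_germP _ _ _ _ _ bb1 bb)[xi [bxi [_ [[k [ka ->]] [Ey [c1 bc1 Ec1] Ec] fixE]]]].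
have /half_spacesP Ey' := Ey; have /half_spacesP Ec1' := Ec1.
have [delta delta0 gap] := wall_params_gap AA.
have [c0 c00 hc0] := root_value_lower_bound bb bxi.
have xi_ge0 a r : all_root D a -> k a = Some r -> 0 <= ev a xi.
  move=> ra kr; apply: (@affine_slope_ge0 (ev a (x + xi) + r)) => t t0.
  have /half_spacesP/(_ a r ra kr) := Ec _ (bface_scale t0 bxi).
  by rewrite evD evZ; lra.
have /choice[k' hk'] : forall a, exists o : option R,
    (all_root D a -> admissible AA a o) /\
    if k a is Some r then all_root D a -> exists2 r', o = Some r' &
      (ev a xi = 0 /\ r' = r \/ 0 < ev a xi /\ r + ev a xi <= r' <= r + ev a xi + delta)
    else o = None.
  move=> a; case kr : (k a) => [r|]; last by exists None.
  have [ra|nra] := pselect (all_root D a); last by exists None; split.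
  (* If [a] vanishes at [xi] the parameter is kept, as no translation along [xi] could compensate an
     increase. *)
  have := xi_ge0 a r ra kr; rewrite le_eqVlt => /predU1P[a0|a0].
    exists (Some r); split; first by have := ka a ra; rewrite kr.
    by move=> _; exists r => //; left.
  have [rra|nrra] := pselect (real_root D a).
    have [r' ar' rr'] := gap a rra (r + ev a xi).
    exists (Some r'); split; first by move=> _ _.
    by move=> _; exists r' => //; right.
  exists (Some (r + ev a xi)); split; first by move=> _ /nrra.
  move=> _; exists (r + ev a xi) => //.
  by right; split=> //; rewrite lexx /= lerDl ltW.
have k'_ge a r r' : all_root D a -> k a = Some r -> k' a = Some r' ->
    r + ev a xi <= r'.
  move=> ra kr k'r'; have [_] := hk' a; rewrite kr => /(_ ra)[s].
  rewrite k'r' => -[<-] [[-> ->]|[_ /andP[h _]]]; last exact: h.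
  by rewrite addr0.
have k'_None a : all_root D a -> forall r', k' a = Some r' ->
    exists r, k a = Some r.
  by move=> ra r'; have [_] := hk' a; case: (k a) => [r|->//]; exists r.
apply/(chimneyP _ _ _ _ _ bb1 bb); exists (half_spaces D k'); split.
- by exists k'; split=> // a; have [] := hk' a.
- split.
  + apply/half_spacesP => a r' ra k'r'; have [r kr] := k'_None a ra r' k'r'.
    have := Ey' a r ra kr; have := k'_ge a r r' ra kr k'r'; rewrite evD; lra.
  + exists c1 => //; apply/half_spacesP => a r' ra k'r'.
    have [r kr] := k'_None a ra r' k'r'.
    have := Ec1' a r ra kr; have := k'_ge a r r' ra kr k'r'; rewrite !evD; lra.
  + move=> c bc; apply/half_spacesP => a r' ra k'r'.
    have [r kr] := k'_None a ra r' k'r'.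
    have /half_spacesP/(_ a r ra kr) := Ec c bc.
    by have := k'_ge a r r' ra kr k'r'; rewrite !evD; lra.
move=> z /half_spacesP Ez.
(* Passing from [k] to [k'] raised parameters by at most [a(xi) + delta]. As [a(xi)] is at least
   [c0], moving by [t0 xi] compensates this. *)
pose t0 := 1 + delta / c0.
apply: (lX z xi t0) => t t0t; apply: fixE; apply/half_spacesP => a r ra kr.
have [_] := hk' a; rewrite kr => /(_ ra)[r' k'r' hr'].
have := Ez a r' ra k'r'; rewrite evD evZ; case: hr' => [[-> ->]|].
  by rewrite mulr0 addr0.
move=> [a0 /andP[_ hr']] zr'.
have := hc0 a ra a0 => c0a.
have : delta <= (t - 1) * ev a xi.
  have : delta = delta / c0 * c0 by rewrite divfK // gt_eqF.
  move=> ->; have d1 : 0 <= delta / c0 by rewrite divr_ge0 // ltW.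
  by apply: ler_pM => //; [exact: ltW|move: t0t; rewrite /t0; lra].
by nra.
Qed.

Lemma fixed_line_closed w : Wa AA w -> line_closed [set v | w v = v].
Proof.
move=> /Wa_affine[w0 [v0 [ww0 we]]] z c t0 far.
have h1 := far t0 (lexx _).
have h2 : w (z + (t0 + 1) *: c) = z + (t0 + 1) *: c by apply: far; rewrite lerDl.
move: h1 h2; rewrite /= !we scalerDl scale1r !(weylD _ _ ww0) => h1 h2.
have wc : w0 c = c.
  apply: (addrI (w0 z + w0 (t0 *: c) + v0)).
  by rewrite addrAC -(addrA (w0 z)) h2 h1 addrA.
apply: (addIr (t0 *: c)); rewrite -h1 (weylZ _ _ ww0) wc.
by rewrite addrAC.
Qed.

Lemma affine_line_closed y (U : {vspace V}) : line_closed (affine_subspace y U).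
Proof.
move=> z c t0 far; have [u /= uU zu] := far t0 (lexx _).
have [|u' /= u'U zu'] := far (t0 + 1); first by rewrite lerDl.
have ce : c = u' - u.
  apply: (addrI (y + u)); rewrite {1}zu -addrA -[X in _ + (_ + X)]scale1r.
  by rewrite -scalerDl -zu' -addrA [u + _]addrC subrK.
exists (u - t0 *: c) => /=; last by rewrite addrA zu addrK.
by rewrite rpredB // memvZ // ce rpredB.
Qed.

End ChimneyFixedPoints.

(** * Supports, solid chimneys and thick sets *)

Section Supports.
Context (R : realType) (V : vectType R) (I : finType) (D : vectorial_data V I).
Context (AA : model_apartment D).
Local Notation is_base := (is_base D).
Local Notation is_encl := (is_encl AA).

Lemma affine_subspaceI (x y z : V) (U W : {vspace V}) :
  affine_subspace x U z -> affine_subspace y W z ->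
  affine_subspace x U `&` affine_subspace y W = affine_subspace z (U :&: W).
Proof.
case=> u /= uU zE; case=> v /= vW vz; move: vz; rewrite -zE => vz {z zE}.
rewrite eqEsubset; split.
  move=> _ [[u' /= u'U <-] [v' /= v'W v'e]]; exists (u' - u); last first.
    by rewrite -addrA [u + _]addrC subrK.
  rewrite /= memv_cap rpredB //=.
  have -> : u' - u = v' - v.
    transitivity ((x + u') - (x + u)); first by rewrite opprD addrACA subrr add0r.
    by rewrite -v'e -vz opprD addrACA subrr add0r.
  by rewrite rpredB.
move=> p [t /=]; rewrite memv_cap => /andP[tU tW] <-; split.
  by exists (u + t); rewrite ?addrA //= rpredD.
by exists (v + t); rewrite -?vz ?addrA //= rpredD.
Qed.

(** An affine subspace of least dimension in [F] meets every other one in [F], and the intersection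
    cannot have smaller dimension. *)
Lemma support_exists (F : set_system V) :
  F setT -> (forall U W, F U -> F W -> F (U `&` W)) -> ~ F set0 ->
  exists x U, is_support F x U.
Proof.
move=> FT FI F0.
pose P n := `[< exists x (U : {vspace V}), F (affine_subspace x U) /\ \dim U = n >].
have exP : exists n, P n.
  exists (\dim {:V}); apply/asboolP; exists 0, fullv; split=> //.
  suff -> : affine_subspace 0 {:V} = setT by [].
  rewrite eqEsubset; split=> // v _; exists v => /=; first exact: memvf.
  by rewrite add0r.
have [n /asboolP[x [U [FU dU]]] nmin] := ex_minnP exP.
exists x, U; split=> // y W FW.
have FUW := FI _ _ FU FW.
have [z [zU zW]] : affine_subspace x U `&` affine_subspace y W !=set0.
  by apply/set0P/eqP => e; apply: F0; rewrite -e.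
have UW : (U <= W)%VS.
  suff <- : (U :&: W)%VS = U by exact: capvSr.
  apply/eqP; rewrite eqEdim capvSl /= dU.
  apply: nmin; apply/asboolP; exists z, (U :&: W)%VS; split=> //.
  by rewrite -(affine_subspaceI zU zW).
move=> v vU; have : (affine_subspace x U `&` affine_subspace x U) v by split.
rewrite (affine_subspaceI zU zU) capvv => -[u /= uU <-].
case: zW => w /= wW <-; exists (w + u); last by rewrite addrA.
by rewrite /= rpredD // (subvP UW).
Qed.

Definition upward (F : set_system V) : Prop := forall U W, U `<=` W -> F U -> F W.
Definition closed_setI (F : set_system V) : Prop :=
  forall U W, F U -> F W -> F (U `&` W).

Lemma upward_germ x S : upward (germ x S).
Proof. by move=> U W UW [N xN NU]; exists N => // v /NU/UW. Qed.

Lemma meet_germ x (S : set V) : closed_setI (germ x S).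
Proof.
move=> U W [N xN NU] [M xM MW]; exists (N `&` M); first exact: vnbhsI.
by move=> v [Sv [Nv Mv]]; split; [exact: NU|exact: MW].
Qed.

Lemma in_chimneyI (b1 : I -> 'Hom(V, R^o)) J1 y Fv E E' : is_base b1 -> is_encl E -> is_encl E' ->
  in_chimney y (bface b1 J1) Fv E -> in_chimney y (bface b1 J1) Fv E' ->
  in_chimney y (bface b1 J1) Fv (E `&` E').
Proof.
move=> bb1 eE eE' [E0 [c bc Ec] Ev] [E'0 [c' bc' Ec'] E'v].
split=> [//||d bd]; last by split; [exact: Ev|exact: E'v].
have gE : germ y (translate y (bface b1 J1)) E.
  by apply/(germ_encl _ _ eE bb1); split=> //; exists c.
have gE' : germ y (translate y (bface b1 J1)) E'.
  by apply/(germ_encl _ _ eE' bb1); split=> //; exists c'.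
have /(germ_encl _ _ (is_enclI eE eE') bb1)[_] := meet_germ gE gE'.
by move=> [d bd Ed]; exists d.
Qed.

Lemma meet_chimney b1 J1 b J x : is_base b1 -> is_base b ->
  closed_setI (chimney AA (germ x (translate x (bface b1 J1))) (bface b J)).
Proof.
move=> bb1 bb U W /(chimneyP _ _ _ _ _ bb1 bb)[E [eE iE EU]].
move=> /(chimneyP _ _ _ _ _ bb1 bb)[E' [eE' iE' EW]].
apply/(chimneyP _ _ _ _ _ bb1 bb); exists (E `&` E'); split.
- exact: is_enclI.
- exact: in_chimneyI.
- by move=> v [/EU ? /EW].
Qed.

Lemma chimney_support b1 J1 b J x : is_base b1 -> is_base b ->
  exists y U, is_support (chimney AA (germ x (translate x (bface b1 J1))) (bface b J)) y U.
Proof.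
move=> bb1 bb; apply: support_exists.
- apply/(chimneyP _ _ _ _ _ bb1 bb); exists setT; split=> //; first exact: is_enclT.
  by split=> //; have [c bc] := bface_nonempty J1 bb1; exists c.
- exact: meet_chimney.
- by move=> /(chimneyP _ _ _ _ _ bb1 bb)[E [_ [E0 _ _] Es]]; exact: Es E0.
Qed.

(** The direction of the support contains a vector of the face [bface b J], whose fixer is
    finite. *)
Lemma solid_spherical b1 J1 b J x : is_base b1 -> is_base b -> spherical_type D J ->
  solid D (chimney AA (germ x (translate x (bface b1 J1))) (bface b J)).
Proof.
move=> bb1 bb sJ; have [y [U yU]] := chimney_support J1 J x bb1 bb.
exists y, U; split=> //.
have [c bc] := bface_nonempty J bb.
apply: (sub_finite_set _ (spherical_fixer bb sJ bc)) => w [ww wU]; split=> //.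
apply: wU; case: yU => /(chimneyP _ _ _ _ _ bb1 bb)[E [_ [E0 _ Ev] EU]] _.
case: (EU _ E0) => u /= uU yu; case: (EU _ (Ev c bc)) => u' /= u'U yu'.
have -> : c = u' - u.
  by apply: (addrI x); rewrite -yu' -yu -addrA [u + _]addrC subrK.
by rewrite rpredB.
Qed.

Lemma chamber_interior b c u : is_base b -> bface b finset.set0 c ->
  exists2 s : R, 0 < s &
    forall i, 0 <= ev (b i) (2^-1 *: c + s *: u) <= ev (b i) c.
Proof.
move=> bb [_ c1].
(* Half of [c] is interior to the box between 0 and [c], with this margin in every coordinate. *)
have e0 i : 0 < ev (b i) c / 2 by rewrite divr_gt0 // c1 // finset.in_set0.
have [s s0 hs] := vnbhs_ray u (vnbhs_forms 0 b e0).
exists s => // i; have := hs s; rewrite s0 lexx => /(_ isT i).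
rewrite subr0 add0r ltr_norml => /andP[]; rewrite !evE => h1 h2.
have := e0 i; lra.
Qed.

(* An enclosed set containing the ends of a segment with direction in a chamber
   has nonempty interior. *)
Definition thick (E : set V) : Prop :=
  exists b x c, [/\ is_base b, bface b finset.set0 c, E x & E (x + c)].

Lemma thick_interior E : is_encl E -> thick E ->
  exists x, E x /\ forall u, exists2 s : R, 0 < s & E (x + s *: u).
Proof.
move=> eE [b [x [c [bb bc Ex Exc]]]].
have inE u : exists2 s : R, 0 < s & E (x + 2^-1 *: c + s *: u).
  have [s s0 hs] := chamber_interior u bb bc; exists s => //.
  by rewrite -addrA; exact: encl_interval eE bb Ex Exc hs.
exists (x + 2^-1 *: c); split=> //.
by have [s s0] := inE 0; rewrite scaler0 addr0.
Qed.

Lemma solid_chamber b1 b J x : is_base b1 -> is_base b ->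
  solid D (chimney AA (germ x (translate x (bface b1 finset.set0))) (bface b J)).
Proof.
move=> bb1 bb; exists 0, fullv; split; last first.
  apply: (@sub_finite_set _ _ [set id]); last exact: finite_set1.
  by move=> w [_ h]; apply/funext => u; apply: h; exact: memvf.
split.
  apply/(chimneyP _ _ _ _ _ bb1 bb); exists setT; split; first exact: is_enclT.
    by split=> //; have [c bc] := bface_nonempty finset.set0 bb1; exists c.
  by move=> v _; exists v => /=; [exact: memvf|rewrite add0r].
move=> y W /(chimneyP _ _ _ _ _ bb1 bb)[E [eE [Ex [c bc Exc] _] EW]] v _.
have tE : thick E by exists b1, x, c.
have [x0 [Ex0 hx0]] := thick_interior eE tE.
case: (EW _ Ex0) => u /= uW yu.
have [s s0 /EW[u' /= u'W yu']] := hx0 (v - y).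
exists (v - y); last by rewrite addrC subrK.
have su : s *: (v - y) = u' - u.
  by apply: (addrI x0); rewrite -yu' -yu -addrA [u + _]addrC subrK.
have -> : v - y = s^-1 *: (u' - u) by rewrite -su scalerA mulVf ?scale1r // gt_eqF.
by rewrite /= memvZ // rpredB.
Qed.

Lemma thick_preimage w E : Wa AA w -> thick E -> thick (w @^-1` E).
Proof.
move=> ww [b [x [c [bb bc Ex Exc]]]]; have [w' [ww' wK w'K]] := Wa_inv ww.
have [w0 [t [ww0 w'e]]] := Wa_affine ww'.
have [neg [u [wu be]]] := bb.
have [b' be'] := base_exists neg (weyl_comp ww0 wu).
exists b', (w' x), (w0 c); split.
- by exists neg, (w0 \o u); split=> //; exact: weyl_comp.
- have e i : ev (b' i) (w0 c) = ev (b i) c.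
    have [u1 [_ uK u1K]] := weyl_inv wu.
    by rewrite -(u1K c) be; exact: be'.
  by split=> i iJ; rewrite e; case: bc => h0 h1; [exact: h0|exact: h1].
- by rewrite /= w'K.
have -> : w' x + w0 c = w' (x + c) by rewrite !w'e (weylD _ _ ww0) addrAC.
by rewrite /= w'K.
Qed.

End Supports.

(** * The filters of the axioms up to enclosure *)

Section FilterClasses.
Context (R : realType) (V : vectType R) (I : finType) (D : vectorial_data V I).
Context (AA : model_apartment D).
Local Notation is_base := (is_base D).
Local Notation is_encl := (is_encl AA).

Lemma enclosure_ext (F F' : set_system V) :
  (forall E, is_encl E -> F E <-> F' E) -> enclosure AA F = enclosure AA F'.
Proof.
move=> h; apply/funext => U; apply/propext; split=> /enclosureP[E [eE FE EU]].
  by apply/enclosureP; exists E; split=> //; apply/h.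
by apply/enclosureP; exists E; split=> //; apply/h.
Qed.

Lemma enclosure_idem (F : set_system V) : enclosure AA (enclosure AA F) = enclosure AA F.
Proof.
apply/funext => U; apply/propext; split.
  move=> /enclosureP[E [eE /enclosureP[E' [eE' FE' E'E]] EU]].
  by apply/enclosureP; exists E'; split=> // v /E'E/EU.
move=> /enclosureP[E [eE FE EU]]; apply/enclosureP; exists E; split=> //.
by apply/enclosureP; exists E; split.
Qed.

Lemma in_chimney_mono y (F1 Fv E E' : set V) : E `<=` E' ->
  in_chimney y F1 Fv E -> in_chimney y F1 Fv E'.
Proof.
move=> EE' [Ey [c c1 Ec] Ev]; split=> [||d /Ev/EE'//]; first exact: EE'.
by exists c => //; exact: EE'.
Qed.

Lemma chimney_encl b1 J1 b J x E : is_base b1 -> is_base b -> is_encl E ->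
  chimney AA (germ x (translate x (bface b1 J1))) (bface b J) E <->
  in_chimney x (bface b1 J1) (bface b J) E.
Proof.
move=> bb1 bb eE; split=> [/(chimneyP _ _ _ _ _ bb1 bb)[E' [_ h E'E]]|h].
  exact: in_chimney_mono E'E h.
by apply/(chimneyP _ _ _ _ _ bb1 bb); exists E; split.
Qed.

Lemma chimney_germ_encl b1 J1 b J x E : is_base b1 -> is_base b -> is_encl E ->
  chimney_germ AA (germ x (translate x (bface b1 J1))) (bface b J) E <->
  exists2 xi, bface b J xi & in_chimney (x + xi) (bface b1 J1) (bface b J) E.
Proof.
move=> bb1 bb eE; split=> [/(chimney_germP _ _ _ _ _ bb1 bb)[xi [bxi [E' [_ h E'E]]]]|[xi bxi h]].
  by exists xi => //; exact: in_chimney_mono E'E h.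
by apply/(chimney_germP _ _ _ _ _ bb1 bb); exists xi; split=> //; exists E; split.
Qed.

Lemma bfaceT (b : I -> 'Hom(V, R^o)) : bface b [set: I]%SET 0.
Proof. by split=> i; rewrite ?finset.inE // ev0. Qed.

(** The face of type [I] is the common kernel of the simple roots; it may be larger than 0, but
    enclosed sets do not distinguish its germ from the point [x]. *)
Lemma germ_vertex_encl b x E : is_base b -> is_encl E ->
  germ x (translate x (bface b [set: I]%SET)) E <-> E x.
Proof.
move=> bb eE; split=> [/(germ_encl _ _ eE bb)[]//|Ex].
by apply/(germ_encl _ _ eE bb); split=> //; exists 0; [exact: bfaceT|rewrite addr0].
Qed.

Lemma local_faceP F : local_face D F <->
  exists b J x, is_base b /\ F = germ x (translate x (bface b J)).
Proof.
split=> [[x [Fv [/vectorial_faceP[b [J [bb ->]]] ->]]]|[b [J [x [bb ->]]]]].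
  by exists b, J, x.
by exists x, (bface b J); split=> //; apply/vectorial_faceP; exists b, J.
Qed.

(** Local faces are not listed in (MA2); the germ of a segment inside the face, or the point [x] if
    the chosen vector is 0, has the same enclosure. *)
Lemma local_face_MA2 b J x : is_base b -> exists F', [/\ MA2_filter AA F',
  forall U, germ x (translate x (bface b J)) U -> F' U &
  forall E, is_encl E -> F' E <-> germ x (translate x (bface b J)) E].
Proof.
move=> bb; have [c bc] := bface_nonempty J bb.
have [c0|c0] := pselect (c = 0).
  exists (globally [set x]); split; first by constructor 1; exists x.
    move=> U [N xN NU] _ ->; apply: NU; split; last exact: vnbhs_self xN.
    by exists c => //; rewrite c0 addr0.
  move=> E eE; split=> [h|/(germ_encl _ _ eE bb)[Ex _] _ -> //].
  apply/(germ_encl _ _ eE bb); split; first exact: h.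
  by exists c => //; rewrite c0 addr0; exact: h.
have bc' : bface b J (x + c - x) by rewrite addrAC subrr add0r.
exists (germ x (segment_oc x (x + c))); split; last first.
- by move=> E eE; exact: germ_segment_encl eE bb bc'.
- move=> U [N xN NU]; exists N => // _ [[t /= /andP[t0 t1] <-] Nt]; apply: NU.
  by split=> //; exists (t *: (x + c - x)) => //; exact: bface_scale.
constructor 2; exists x, (x + c); split=> //.
  by move=> /(congr1 (+%R (- x))); rewrite addNr addKr => /esym.
by apply/tits_leP; exists b, J.
Qed.

(** Up to enclosure there are two kinds: a point is a face of type [I], and a generic ray is a
    chimney based at such a face, solid because its direction is spherical. *)
Lemma MA2_filter_cases F : MA2_filter AA F ->
  (exists b J x, is_base b /\ forall E, is_encl E -> F E <-> germ x (translate x (bface b J)) E) \/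
  (exists b1 J1 b J x, [/\ is_base b1, is_base b,
    solid D (chimney AA (germ x (translate x (bface b1 J1))) (bface b J)) &
    forall E, is_encl E ->
      F E <-> chimney AA (germ x (translate x (bface b1 J1))) (bface b J) E]).
Proof.
have [b0 be0] := base_exists false (@weyl_id _ _ _ D).
have bb0 : is_base b0 by exists false, id; split=> //; exact: weyl_id.
case=> [[x ->]|[x [y [_ /tits_leP[b [J [bb byx]]] ->]]]||].
- left; exists b0, [set: I]%SET, x; split=> // E eE.
  split=> [h|/(germ_vertex_encl _ bb0 eE) Ex _ ->//].
  by apply/(germ_vertex_encl _ bb0 eE); exact: h.
- by left; exists b, J, x; split=> // E eE; exact: germ_segment_encl eE bb byx.
- move=> [x [y [_ /tits_ltP[b [J [bb sJ byx]]] ->]]].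
  right; exists b0, [set: I]%SET, b, J, x; split=> //; first exact: solid_spherical.
  move=> E eE; split=> [h|].
    have ray t : 0 <= t -> E (x + t *: (y - x)) by move=> t0; apply: h; exists t.
    have Ex : E x by have := ray 0 (lexx _); rewrite scale0r addr0.
    apply/(chimney_encl _ _ _ bb0 bb eE); split=> //.
      by exists 0; [exact: bfaceT|rewrite addr0].
    move=> c bc; apply: (encl_recession (x := x) eE bb byx) Ex.
    + by case: bc.
    + exact: bface_ge0 bc.
    + by move=> t t0; apply: ray; exact: ltW.
  move=> /(chimney_encl _ _ _ bb0 bb eE)[Ex _ Ev] _ [t /= t0 <-].
  move: t0; rewrite le_eqVlt => /predU1P[<-|t0]; first by rewrite scale0r addr0.
  by apply: Ev; exact: bface_scale.
- move=> [F1 [Fv [/local_faceP[b1 [J1 [x [bb1 ->]]]] /vectorial_faceP[b [J [bb ->]]] -> sC]]].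
  by right; exists b1, J1, b, J, x; split.
Qed.

Lemma germ_chamber_face b J x E : is_base b -> is_encl E ->
  germ x (translate x (bface b finset.set0)) E -> germ x (translate x (bface b J)) E.
Proof.
move=> bb eE /(germ_encl _ _ eE bb)[Ex [c bc Exc]].
have [u bu] := bface_nonempty J bb.
have e0 i : 0 < ev (b i) c by case: bc => _; apply; rewrite finset.in_set0.
have [s s0 hs] := vnbhs_ray u (vnbhs_forms 0 b e0).
apply/(germ_encl _ _ eE bb); split=> //; exists (s *: u); first exact: bface_scale.
apply: (encl_interval eE bb Ex Exc) => i.
rewrite (bface_ge0 (bface_scale s0 bu)) /=; apply/ltW.
have := hs s; rewrite s0 lexx => /(_ isT i); rewrite subr0 add0r.
by apply: le_lt_trans; exact: ler_norm.
Qed.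

Lemma in_chimney_chamber_face b1 J1 y Fv E : is_base b1 -> is_encl E ->
  in_chimney y (bface b1 finset.set0) Fv E -> in_chimney y (bface b1 J1) Fv E.
Proof.
move=> bb eE [Ey [c bc Ec] Ev]; split=> //.
have /(germ_chamber_face J1 bb eE)/(germ_encl _ _ eE bb)[_ //] :
  germ y (translate y (bface b1 finset.set0)) E.
by apply/(germ_encl _ _ eE bb); split=> //; exists c.
Qed.

End FilterClasses.

(** * Intersections of members, chimney germs and spanning sets *)

Section FilterProperties.
Context (R : realType) (V : vectType R) (I : finType) (D : vectorial_data V I).
Context (AA : model_apartment D).
Local Notation is_base := (is_base D).
Local Notation is_encl := (is_encl AA).

Lemma upward_enclosure F : upward (enclosure AA F).
Proof.
move=> U W UW /enclosureP[E [eE FE EU]]; apply/enclosureP; exists E; split=> //.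
by move=> v /EU/UW.
Qed.

Lemma meet_enclosure F : closed_setI F -> closed_setI (enclosure AA F).
Proof.
move=> mF U W /enclosureP[E [eE FE EU]] /enclosureP[E' [eE' FE' EW]].
apply/enclosureP; exists (E `&` E'); split; first exact: is_enclI.
  exact: mF.
by move=> v [/EU ? /EW].
Qed.

Lemma sub_enclosure F U : upward F -> enclosure AA F U -> F U.
Proof. by move=> uF /enclosureP[E [_ FE EU]]; exact: uF EU FE. Qed.

Lemma in_chimney_shift (b1 b : I -> 'Hom(V, R^o)) J1 J (y xi : V) E : is_base b -> is_encl E -> bface b J xi ->
  in_chimney y (bface b1 J1) (bface b J) E ->
  in_chimney (y + xi) (bface b1 J1) (bface b J) E.
Proof.
move=> bb eE bxi [Ey [c bc Ec] Ev]; split.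
- exact: Ev.
- exists c => //; rewrite addrAC.
  apply: (encl_recession (x := y) eE bb bxi) Ec.
  + by case: bxi.
  + exact: bface_ge0 bxi.
  + by move=> t t0; apply: Ev; exact: bface_scale.
- by move=> d bd; rewrite -addrA; apply: Ev; exact: bfaceD.
Qed.

Section ChimneyFilters.
Context (b1 b : I -> 'Hom(V, R^o)) (J1 J : {set I}) (x : V).
Hypotheses (bb1 : is_base b1) (bb : is_base b).
Local Notation chim x := (chimney AA (germ x (translate x (bface b1 J1))) (bface b J)).
Local Notation chimg x := (chimney_germ AA (germ x (translate x (bface b1 J1))) (bface b J)).

Lemma meet_chimney_germ : closed_setI (chimg x).
Proof.
move=> U W /(chimney_germP _ _ _ _ _ bb1 bb)[xi [bxi [E [eE iE EU]]]].
move=> /(chimney_germP _ _ _ _ _ bb1 bb)[xi' [bxi' [E' [eE' iE' EW]]]].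
apply/(chimney_germP _ _ _ _ _ bb1 bb); exists (xi + xi').
split; first exact: bfaceD.
exists (E `&` E'); split; first exact: is_enclI.
  apply: (in_chimneyI bb1 eE eE').
    by rewrite addrA; exact: in_chimney_shift.
  by rewrite [xi + _]addrC addrA; exact: in_chimney_shift.
by move=> v [/EU ? /EW].
Qed.

Lemma upward_chimney_germ : upward (chimg x).
Proof. by move=> U W UW [xi bxi h]; exists xi => //; exact: upward_enclosure UW h. Qed.

Lemma chimney_sub_germ U : chim x U -> chimg x U.
Proof.
move=> /(chimneyP _ _ _ _ _ bb1 bb)[E [eE iE EU]].
apply/(chimney_germP _ _ _ _ _ bb1 bb); have [c bc] := bface_nonempty J bb.
exists c; split=> //; exists E; split=> //; exact: in_chimney_shift.
Qed.

Lemma chimney_translate xi U :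
  chimney AA (filter_translate xi (germ x (translate x (bface b1 J1)))) (bface b J) U
  <-> chim (x + xi) U.
Proof.
split=> [/enclosureP[E [eE FE EU]]|/(chimneyP _ _ _ _ _ bb1 bb)[E [eE iE EU]]].
  apply/(chimneyP _ _ _ _ _ bb1 bb); exists E; split=> //.
  exact/(filter_add_encl _ _ _ _ eE bb1 bb).
apply/enclosureP; exists E; split=> //.
exact/(filter_add_encl _ _ _ _ eE bb1 bb).
Qed.

Lemma chimney_germ_chimney U : chimg x U -> exists2 xi, bface b J xi & chim (x + xi) U.
Proof. by move=> [xi bxi /chimney_translate h]; exists xi. Qed.

Lemma chimney_chimney_germ xi U : bface b J xi -> chim (x + xi) U -> chimg x U.
Proof. by move=> bxi /chimney_translate h; exists xi. Qed.

(* By [chimney_germ_line_closed] the support can only grow along the chimney. *)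
Lemma solid_chimney_shift xi : bface b J xi -> solid D (chim x) -> solid D (chim (x + xi)).
Proof.
move=> bxi [y [U [[_ Umin] Ufin]]].
have [z [W [zW Wmin]]] := chimney_support AA J1 J (x + xi) bb1 bb.
exists z, W; split=> //; apply: (sub_finite_set _ Ufin) => w [ww wW]; split=> // u uU.
apply: wW; have := Umin z W.
have {}zW : chim x (affine_subspace z W).
  apply: chimney_germ_line_closed => //; first exact: affine_line_closed.
  exact: chimney_chimney_germ zW.
move=> /(_ zW) UW.
have [|w0 /= w0W yw0] := UW y; first by exists 0; rewrite /= ?mem0v ?addr0.
have [|w1 /= w1W yw1] := UW (y + u); first by exists u.
have -> : u = w1 - w0.
  by apply: (addrI y); rewrite -yw1 -yw0 -addrA [w0 + _]addrC subrK.
by rewrite rpredB.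
Qed.

End ChimneyFilters.

Lemma upward_MA2 F : MA2_filter AA F -> upward F.
Proof.
case=> [[x ->]|[x [y [_ _ ->]]]|[x [y [_ _ ->]]]|[F1 [Fv [_ _ -> _]]]].
- by move=> U W UW h v /h/UW.
- exact: upward_germ.
- by move=> U W UW h v /h/UW.
- exact: upward_enclosure.
Qed.

Lemma upward_splayed F : splayed_chimney_germ AA F -> upward F.
Proof.
move=> [F1 [Fv [_ _ ->]]] U W UW [xi ? h].
by exists xi => //; exact: upward_enclosure UW h.
Qed.

Lemma upward_MA3 F : MA3_filter AA F -> upward F.
Proof.
case=> [[F0 _ ->]|[F1 [Fv [_ _ _ ->]]]]; first exact: upward_enclosure.
move=> U W UW [xi ? h]; by exists xi => //; exact: upward_enclosure UW h.
Qed.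

(* A subset of [x + C], [C] a chamber, starting from [x] in every direction of
   [C]: enough to determine an affine map. *)
Definition spanning (U : set V) : Prop := exists b x, is_base b /\
  forall c, bface b finset.set0 c -> exists2 e : R, 0 < e &
    forall t, 0 < t <= e -> U (x + t *: c).

Lemma chamber_open b c u : is_base b -> bface b finset.set0 c ->
  exists2 s : R, 0 < s & bface b finset.set0 (c + s *: u).
Proof.
move=> bb [_ c1].
have e0 i : 0 < ev (b i) c by rewrite c1 // finset.in_set0.
have [s s0 hs] := vnbhs_ray u (vnbhs_forms 0 b e0).
exists s => //; split=> i; first by rewrite finset.in_set0.
have := hs s; rewrite s0 lexx => /(_ isT i).
rewrite subr0 add0r ltr_norml evD => /andP[h1 _] _; lra.
Qed.

(** Two fixed points on a ray from [x] show that [w] fixes [x] and that its linear part fixes the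
    direction; these directions fill an open cone. *)
Lemma spanning_fixed_id U w : spanning U -> Wa AA w ->
  (forall v, U v -> w v = v) -> w = id.
Proof.
move=> [b [x [bb hU]]] ww fixU; have [w0 [t [ww0 we]]] := Wa_affine ww.
have wc c : bface b finset.set0 c -> w x = x /\ w0 c = c.
  move=> bc; have [e e0 he] := hU c bc.
  have h1 : w (x + e *: c) = x + e *: c by apply: fixU; apply: he; rewrite e0 lexx.
  have h2 : w (x + (e / 2) *: c) = x + (e / 2) *: c.
    by apply: fixU; apply: he; apply/andP; split; lra.
  have e2 : e = e / 2 + e / 2 by lra.
  have h3 : w0 ((e / 2) *: c) = (e / 2) *: c.
    apply: (addrI (w (x + (e / 2) *: c))); rewrite {2}h2 -addrA -scalerDl -e2 -h1.
    rewrite [in RHS]e2 scalerDl addrA !we addrAC; congr (_ + _).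
    by rewrite !(weylD _ _ ww0).
  split.
    apply: (addIr ((e / 2) *: c)); rewrite -[RHS]h2 -{1}h3 !we addrAC.
    by rewrite (weylD _ _ ww0).
  apply: (scalerI (a := e / 2)); first by rewrite gt_eqF // divr_gt0.
  by rewrite -(weylZ _ _ ww0).
have [c bc] := bface_nonempty finset.set0 bb.
have [wx w0c] := wc c bc.
have w0u u : w0 u = u.
  have [s s0 bs] := chamber_open u bb bc; have [_] := wc _ bs.
  rewrite (weylD _ _ ww0) w0c (weylZ _ _ ww0) => /addrI; apply: scalerI.
  by rewrite gt_eqF.
apply/funext => v; rewrite we w0u.
by move: wx; rewrite we w0u -[RHS]addr0 => /addrI ->; rewrite addr0.
Qed.

Lemma spanning_germ b x U : is_base b ->
  germ x (translate x (bface b finset.set0)) U -> spanning U.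
Proof.
move=> bb [N xN NU]; exists b, x; split=> // c bc.
have [e e0 he] := vnbhs_ray c xN; exists e => // t te; apply: NU; split; last exact: he.
by exists (t *: c) => //; apply: bface_scale => //; case/andP: te.
Qed.

Lemma spanning_sector b x U : is_base b -> translate x (bface b finset.set0) `<=` U ->
  spanning U.
Proof.
move=> bb xU; exists b, x; split=> // c bc; exists 1 => // t /andP[t0 _].
by apply: xU; exists (t *: c) => //; exact: bface_scale.
Qed.

(* An enclosed form of the sector germ. *)
Definition sector_chimney_germ b x : set_system V :=
  chimney_germ AA (germ x (translate x (bface b [set: I]%SET))) (bface b finset.set0).

Lemma sector_chimney_splayed b x : is_base b ->
  splayed_chimney_germ AA (sector_chimney_germ b x).
Proof.
move=> bb; exists (germ x (translate x (bface b [set: I]%SET))), (bface b finset.set0).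
split=> //; first by apply/local_faceP; exists b, [set: I]%SET, x.
by apply/spherical_faceP; exists b, finset.set0; split=> //; exact: spherical_type0.
Qed.

Lemma sector_chimney_MA3 b x : is_base b -> MA3_filter AA (sector_chimney_germ b x).
Proof.
move=> bb; right.
exists (germ x (translate x (bface b [set: I]%SET))), (bface b finset.set0).
split=> //.
- by apply/local_faceP; exists b, [set: I]%SET, x.
- by apply/vectorial_faceP; exists b, finset.set0.
- exact: solid_spherical (spherical_type0 D).
Qed.

Lemma sector_chimney_encl b x E : is_base b -> is_encl E ->
  sector_chimney_germ b x E <->
  exists2 xi, bface b finset.set0 xi & E (x + xi) /\
    forall c, bface b finset.set0 c -> E (x + xi + c).
Proof.
move=> bb eE; split=> [/(chimney_germ_encl _ _ _ bb bb eE)[xi bxi [h1 _ h2]]|[xi bxi [h1 h2]]].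
  by exists xi.
apply/(chimney_germ_encl _ _ _ bb bb eE); exists xi => //; split=> //.
by exists 0; [exact: bfaceT|rewrite addr0].
Qed.

Lemma sector_chimney_thick b x E : is_base b -> is_encl E ->
  sector_chimney_germ b x E -> thick D E.
Proof.
move=> bb eE /(sector_chimney_encl _ bb eE)[xi bxi [h1 h2]].
have [c bc] := bface_nonempty finset.set0 bb.
by exists b, (x + xi), c; split=> //; exact: h2.
Qed.

Lemma sector_chimney_sector b x U : is_base b -> sector_chimney_germ b x U ->
  exists t, translate t (translate x (bface b finset.set0)) `<=` U.
Proof.
move=> bb /(chimney_germP _ _ _ _ _ bb bb)[xi [bxi [E [eE [_ _ h] EU]]]].
by exists xi => _ [_ [c bc <-] <-]; apply: EU; rewrite addrA [xi + x]addrC; exact: h.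
Qed.

End FilterProperties.

(** * Charts of apartments *)

Section Charts.
Context (R : realType) (V : vectType R) (I : finType) (D : vectorial_data V I).
Context (AA : model_apartment D) (Delta : Type) (S : apartment_system V Delta).
Hypothesis hS : affine_ordered_hovel AA S.
Context (G : set (Delta -> Delta)).
Hypothesis hG : bij_group G.
Local Notation is_base := (is_base D).
Local Notation is_encl := (is_encl AA).
Local Notation Wa := (Wa AA).
Local Notation spl := (splayed_chimney_germ AA).
Local Notation MA3 := (MA3_filter AA).

Definition chart (f : V -> Delta) : Prop :=
  apartments S (range f) /\ charts S (range f) f.

Definition agree (f f' : V -> Delta) : set V := [set v | f v = f' v].

Lemma apartment_chart A f : apartments S A -> charts S A f ->
  [/\ A = range f, injective f & chart f].
Proof.
move=> hA hf; have [f0 [f0A f0i f0s] cE] := hovel_MA1 hS hA.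
have : [set f0 \o w | w in Wa] f by rewrite -cE.
move=> [w ww fE]; have [w' [_ wK w'K]] := Wa_inv ww.
have rE : A = range f.
  rewrite eqEsubset; split=> [a /f0s[v _ <-]|_ [v _ <-]]; rewrite -fE.
    by exists (w' v) => //=; rewrite w'K.
  exact: f0A.
split=> //; last by rewrite /chart -rE.
move=> u v; rewrite -fE /= => fuv; apply: (can_inj wK).
by apply: f0i fuv; rewrite inE.
Qed.

Lemma chart_inj f : chart f -> injective f.
Proof. by move=> [h1 h2]; have [] := apartment_chart h1 h2. Qed.

Lemma chart_exists A : apartments S A -> exists2 f, chart f & range f = A.
Proof.
move=> hA; have [f0 _ cE] := hovel_MA1 hS hA.
have hf : charts S A f0 by rewrite cE; exists id => //; exact: Wa_id.
by have [rE _ cf] := apartment_chart hA hf; exists f0.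
Qed.

Lemma range_comp (f : V -> Delta) w : Wa w -> range (f \o w) = range f.
Proof.
move=> /Wa_inv[w' [_ wK w'K]]; rewrite eqEsubset; split=> _ [v _ <-].
  by exists (w v).
by exists (w' v) => //=; rewrite w'K.
Qed.

Lemma chart_comp f w : chart f -> Wa w -> chart (f \o w).
Proof.
move=> [hA hf] ww; rewrite /chart range_comp //; split=> //.
have [f0 _ cE] := hovel_MA1 hS hA; move: hf; rewrite cE => -[w0 ww0 <-].
by exists (w0 \o w) => //; exact: Wa_comp.
Qed.

Lemma chart_rel f f' : chart f -> chart f' -> range f = range f' ->
  exists2 w, Wa w & f' = f \o w.
Proof.
move=> [hA hf] [hA' hf'] rE; have [f0 _ cE] := hovel_MA1 hS hA.
move: hf hf'; rewrite -rE !cE => -[w ww <-] [w' ww' <-].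
have [v [wv wK vK]] := Wa_inv ww.
exists (v \o w'); first exact: Wa_comp.
by apply/funext => u /=; rewrite vK.
Qed.

Lemma weyl_iso_chart A A' phi f : apartments S A -> apartments S A' ->
  charts S A f -> weyl_isomorphism AA S A A' phi ->
  chart (phi \o f) /\ range (phi \o f) = A'.
Proof.
move=> hA hA' hf [_ h].
have [f' [cA' cf'] rE] := chart_exists hA'; rewrite rE in cA' cf'.
have [k wk e] := h f f' hf cf'.
have -> : phi \o f = f' \o k by apply/funext => v /=; rewrite e.
split; last by rewrite range_comp.
by apply: chart_comp => //; rewrite /chart rE.
Qed.

Lemma pullback_fmap (f : V -> Delta) F : injective f -> filter_pullback f (fmap f F) = F :> set_system V.
Proof.
move=> fi; apply/funext => U; rewrite /filter_pullback /fmap /=; congr F.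
rewrite eqEsubset; split=> [v [u Uu /fi <-]//|v Uv]; by exists v.
Qed.

Lemma chart_enclosureE (f : V -> Delta) F : injective f ->
  chart_enclosure AA f (fmap f F) = fmap f (enclosure AA F).
Proof. by move=> fi; rewrite /chart_enclosure pullback_fmap. Qed.

Lemma in_apartment_fmap (P : set_system V -> Prop) f F : chart f -> P F ->
  in_apartment S (range f) P (fmap f F).
Proof. by move=> [_ hf] PF; exists f, F. Qed.

Lemma MA2_chart f A' F : chart f -> apartments S A' -> MA2_filter AA F ->
  F (f @^-1` A') ->
  exists f', [/\ chart f', range f' = A' & enclosure AA F (agree f f')].
Proof.
move=> cf hA' F2 FA'; have fi := chart_inj cf; have [hA hf] := cf.
have [_ [phi wphi [X]]] := hovel_MA2 hS hA hA' hf (in_apartment_fmap cf F2) FA'.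
rewrite chart_enclosureE // => FX phiX.
have [cphi rphi] := weyl_iso_chart hA hA' hf wphi.
exists (phi \o f); split=> //; apply: upward_enclosure FX => v Xv.
by rewrite /agree /= phiX.
Qed.

(* Filters of [V] read in an arbitrary chart of an apartment. *)
Definition in_chart (P : set_system V -> Prop) (F : set_system V) : Prop :=
  exists2 w, Wa w & exists2 F0, P F0 & F = fmap w F0.

Lemma in_chart_id (P : set_system V -> Prop) F : P F -> in_chart P F.
Proof. by move=> PF; exists id; [exact: Wa_id|exists F]. Qed.

Lemma in_hovel_chart (P : set_system V -> Prop) f F : chart f -> in_chart P F ->
  in_hovel S P (fmap f F).
Proof.
move=> cf [w ww [F0 PF0 ->]]; exists (range f); first by case: cf.
exists (f \o w), F0; split=> //.
by have [_] := chart_comp cf ww; rewrite range_comp.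
Qed.

Lemma upward_in_chart (P : set_system V -> Prop) F :
  (forall F, P F -> upward F) -> in_chart P F -> upward F.
Proof.
move=> uP [w ww [F0 PF0 ->]] U W UW; apply: (uP _ PF0) => v; exact: UW.
Qed.

Lemma MA3_chart f f' RR F : chart f -> chart f' ->
  in_chart spl RR -> in_chart MA3 F ->
  exists A, [/\ apartments S A, RR (f @^-1` A) & F (f' @^-1` A)].
Proof.
by move=> cf cf' hR hF; exact: (hovel_MA3 hS (in_hovel_chart cf hR) (in_hovel_chart cf' hF)).
Qed.

Lemma MA4_chart f A' RR F : chart f -> apartments S A' ->
  in_chart spl RR -> in_chart MA3 F -> RR (f @^-1` A') -> F (f @^-1` A') ->
  exists f', [/\ chart f', range f' = A' & enclosure AA (RR `&` F) (agree f f')].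
Proof.
move=> cf hA' hR hF RA' FA'; have fi := chart_inj cf; have [hA hf] := cf.
have uR := upward_in_chart (@upward_splayed _ _ _ _ AA) hR.
have uF := upward_in_chart (@upward_MA3 _ _ _ _ AA) hF.
have subr : f @^-1` A' `<=` f @^-1` range f by move=> v _; exists v.
have RA : fmap f RR (range f) by exact: uR subr RA'.
have FA : fmap f F (range f) by exact: uF subr FA'.
have [_ [phi wphi [X]]] := hovel_MA4 hS (in_hovel_chart cf hR)
  (in_hovel_chart cf hF) hA hA' hf RA FA RA' FA'.
rewrite -[_ `&` _]/(fmap f (RR `&` F)) chart_enclosureE // => FX phiX.
have [cphi rphi] := weyl_iso_chart hA hA' hf wphi.
exists (phi \o f); split=> //; apply: upward_enclosure FX => v Xv.
by rewrite /agree /= phiX.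
Qed.

(** An equality of maps on all of [V]: once both are charts, [g] restricts to a Weyl-isomorphism of
    their apartments. *)
Definition conn (f f' : V -> Delta) : Prop := exists2 g, G g & f' = g \o f.

Lemma conn_sym f f' : conn f f' -> conn f' f.
Proof.
move=> [g Gg ->]; have [h [Gh gK hK]] := bij_group_inv hG Gg.
by exists h => //; apply/funext => v /=; rewrite gK.
Qed.

Lemma conn_trans f f' f'' : conn f f' -> conn f' f'' -> conn f f''.
Proof.
move=> [g Gg ->] [g' Gg' ->]; exists (g' \o g) => //.
by case: hG => _ _ + _; exact.
Qed.

Lemma conn_comp f f' w : conn f f' -> conn (f \o w) (f' \o w).
Proof. by move=> [g Gg ->]; exists g. Qed.

Lemma conn_weyl f g : chart f -> chart (g \o f) ->
  range (g \o f) = g @` range f /\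
  weyl_isomorphism AA S (range f) (range (g \o f)) g.
Proof.
move=> cf cgf; have fi := chart_inj cf; have gfi := chart_inj cgf.
split; first by rewrite image_comp.
split.
  split=> [_ [v _ <-]|_ _ /set_mem[u _ <-] /set_mem[v _ <-] /gfi ->//|_ [v _ <-]].
    by exists v.
  by exists (f v) => //; exists v.
move=> f1 f2 hf1 hf2; have [hA hf] := cf; have [hA' hgf] := cgf.
have [r1 _ cf1] := apartment_chart hA hf1; have [r2 _ cf2] := apartment_chart hA' hf2.
have [w ww ->] := chart_rel cf cf1 r1.
have [w' ww' e] := chart_rel cf2 cgf (esym r2).
exists (w' \o w); first exact: Wa_comp.
by move=> v /=; rewrite -[RHS]/((f2 \o w') (w v)) -e.
Qed.

(** The common form in which (MA2) and (MA4) are used. *)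
Definition transportable (Om : set_system V) : Prop := forall f A',
  chart f -> apartments S A' -> Om (f @^-1` A') ->
  exists f', [/\ chart f', range f' = A' & Om (agree f f')].

(** The element [w] is needed when [Om] lies in a wall, for instance: agreement on [Om] then leaves
    the second chart free up to such a [w]. *)
Definition conn_filter (Om : set_system V) : Prop := forall f f',
  chart f -> chart f' -> Om (agree f f') ->
  exists w, [/\ Wa w, Om [set v | w v = v] & conn f (f' \o w)].

Lemma good_of_conn Om f : upward Om -> closed_setI Om -> transportable Om ->
  conn_filter Om -> chart f -> good AA S G (fmap f Om).
Proof.
move=> uO mO tO cO cf A1 A2 hA1 hA2 OA1 OA2.
have [f1 [cf1 r1 a1]] := tO f A1 cf hA1 OA1.
have [f2 [cf2 r2 a2]] := tO f A2 cf hA2 OA2.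
have a12 : Om (agree f1 f2).
  by apply: uO (mO _ _ a1 a2) => v [h1 h2]; rewrite /agree /= -h1.
have [w [ww fw [g Gg e]]] := cO f1 f2 cf1 cf2 a12.
have cgf : chart (g \o f1) by rewrite -e; exact: chart_comp.
have [rg wg] := conn_weyl cf1 cgf.
have rE : A2 = range (g \o f1) by rewrite -e range_comp.
exists g; split=> //.
- exists (f @` (agree f f1 `&` agree f f2 `&` [set v | w v = v])).
    apply: uO (mO _ _ (mO _ _ a1 a2) fw) => v hv; exists v => //.
  move=> _ [v [[h1 h2] h3] <-]; rewrite [in LHS]h1.
  by rewrite -[LHS]/((g \o f1) v) -e /= h3 -h2.
- by rewrite rE rg r1.
- by rewrite rE -{1}r1.
Qed.

(** Goodness gives [g o f = f' o k] with [k] in [Wa]; since [k] fixes a spanning set, it is the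
    identity. *)
Lemma conn_of_good Om f f' : upward Om -> closed_setI Om ->
  (forall U, Om U -> spanning D U) -> good AA S G (fmap f Om) ->
  chart f -> chart f' -> Om (agree f f') -> conn f f'.
Proof.
move=> uO mO sO gO cf cf' a; have [hA hf] := cf; have [hA' hf'] := cf'.
have OA : fmap f Om (range f) by apply: uO a => v _; exists v.
have OA' : fmap f Om (range f') by apply: uO a => v fv; exists v.
have [g [Gg [X OX gX] _ [_ wg]]] := gO _ _ hA hA' OA OA'.
have [k wk e] := wg f f' hf hf'.
exists g => //; apply/funext => v /=; rewrite e.
have -> // : k = id.
apply: (spanning_fixed_id (sO _ (mO _ _ OX a)) wk) => u [Xu fu].
by apply: (chart_inj cf'); rewrite -e -[RHS]fu gX.
Qed.

(** Composition through an intermediate apartment: [f3] and [f3'] are its charts obtained from [f1]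
    and [f2]. They differ by some [w], which fixes [Om] because all four charts agree there. *)
Lemma conn_glue Om f1 f2 f3 f3' : upward Om -> closed_setI Om ->
  chart f1 -> chart f2 -> chart f3 -> chart f3' -> range f3 = range f3' ->
  Om (agree f1 f2) -> Om (agree f1 f3) -> Om (agree f2 f3') ->
  conn f1 f3 -> conn f2 f3' ->
  exists w, [/\ Wa w, Om [set v | w v = v] & conn f1 (f2 \o w)].
Proof.
move=> uO mO c1 c2 c3 c3' rE a12 a13 a23 k13 k23.
have [w ww e] := chart_rel c3' c3 (esym rE).
exists w; split=> //.
  apply: uO (mO _ _ a12 (mO _ _ a13 a23)) => v [h12 [h13 h23]] /=.
  by apply: (chart_inj c3'); rewrite -[LHS]/((f3' \o w) v) -e -h13 h12.
apply: conn_trans k13 _; rewrite e; apply: conn_comp; exact: conn_sym.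
Qed.

Lemma transportable_MA2 F : MA2_filter AA F -> transportable (enclosure AA F).
Proof.
move=> F2 f A' cf hA' FA'; apply: MA2_chart => //.
by apply: sub_enclosure FA'; exact: upward_MA2 F2.
Qed.

Lemma transportable_face b J x : is_base b ->
  transportable (enclosure AA (germ x (translate x (bface b J)))).
Proof.
move=> bb; have [F' [F'2 _ e]] := local_face_MA2 AA J x bb.
by rewrite -(enclosure_ext e); exact: transportable_MA2.
Qed.

Lemma transportable_chimney b1 J1 b J x : is_base b1 -> is_base b ->
  solid D (chimney AA (germ x (translate x (bface b1 J1))) (bface b J)) ->
  transportable (chimney AA (germ x (translate x (bface b1 J1))) (bface b J)).
Proof.
move=> bb1 bb sC; rewrite /chimney -enclosure_idem; apply: transportable_MA2.
constructor 4; exists (germ x (translate x (bface b1 J1))), (bface b J); split=> //.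
  by apply/local_faceP; exists b1, J1, x.
by apply/vectorial_faceP; exists b, J.
Qed.

Lemma transportable_chimney_germ b1 J1 b J x : is_base b1 -> is_base b ->
  solid D (chimney AA (germ x (translate x (bface b1 J1))) (bface b J)) ->
  transportable (chimney_germ AA (germ x (translate x (bface b1 J1))) (bface b J)).
Proof.
move=> bb1 bb sC f A' cf hA' /(chimney_germ_chimney bb1 bb)[xi bxi hxi].
have [f' [cf' rf' a]] :=
  transportable_chimney bb1 bb (solid_chimney_shift bb1 bb bxi sC) cf hA' hxi.
by exists f'; split=> //; exact: chimney_chimney_germ a.
Qed.

Lemma transport_fmap Om f f' : upward Om -> closed_setI Om -> Om (agree f f') ->
  fmap f Om = fmap f' Om.
Proof.
move=> uO mO a; apply/funext => U; apply/propext; rewrite /fmap /=; split=> h.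
  by apply: uO (mO _ _ a h) => v [e Uv]; rewrite /= -e.
by apply: uO (mO _ _ a h) => v [e Uv]; rewrite /= e.
Qed.

End Charts.

(** * From local chambers to strong transitivity *)

Section ConnectedFilters.
Context (R : realType) (V : vectType R) (I : finType) (D : vectorial_data V I).
Context (AA : model_apartment D) (Delta : Type) (S : apartment_system V Delta).
Hypothesis hS : affine_ordered_hovel AA S.
Context (G : set (Delta -> Delta)).
Hypothesis hG : bij_group G.
Local Notation is_base := (is_base D).
Local Notation is_encl := (is_encl AA).
Local Notation Wa := (Wa AA).
Local Notation spl := (splayed_chimney_germ AA).
Local Notation MA3 := (MA3_filter AA).
Local Notation chart := (chart S).
Local Notation conn := (conn G).
Local Notation conn_filter := (conn_filter AA S G).

Hypothesis conn_chamber : forall f f' b x, chart f -> chart f' -> is_base b ->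
  germ x (translate x (bface b finset.set0)) (agree f f') -> conn f f'.

Lemma conn_thick f f' E : chart f -> chart f' -> is_encl E -> thick D E ->
  E `<=` agree f f' -> conn f f'.
Proof.
move=> cf cf' eE [b [x [c [bb bc Ex Exc]]]] Ea.
apply: (conn_chamber (x := x) cf cf' bb); apply: upward_germ Ea _.
by apply/(germ_encl _ _ eE bb); split=> //; exists c.
Qed.

Lemma conn_face b J x : is_base b ->
  conn_filter (enclosure AA (germ x (translate x (bface b J)))).
Proof.
move=> bb h1 h2 c1 c2 a12.
pose C0 := germ x (translate x (bface b finset.set0)).
pose F0 := germ x (translate x (bface b J)).
have F3 J' : MA3 (enclosure AA (germ x (translate x (bface b J')))).
  left; exists (germ x (translate x (bface b J'))) => //.
  by apply/local_faceP; exists b, J', x.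
(* The chamber at [x] is read in [h1] and the sector germ in [h2]: the two charts agree on the face
   and may diverge on the chamber. *)
have [A [hA SA CA]] := MA3_chart hS c2 c1
  (in_chart_id AA (sector_chimney_splayed AA x bb)) (in_chart_id AA (F3 finset.set0)).
have [h3 [c3 r3 a13]] := transportable_face hS bb c1 hA CA.
have uO : upward (enclosure AA F0) by exact: upward_enclosure.
have mO : closed_setI (enclosure AA F0).
  by apply: meet_enclosure; exact: meet_germ.
have C0F0 U : enclosure AA C0 U -> enclosure AA F0 U.
  move=> /enclosureP[E [eE CE EU]]; apply/enclosureP; exists E; split=> //.
  exact: germ_chamber_face bb eE CE.
have k13 : conn h1 h3.
  have /enclosureP[E [eE CE Ea]] := a13.
  apply: (conn_thick c1 c3 eE) Ea.
  by have /(germ_encl _ _ eE bb)[Ex [c bc Exc]] := CE; exists b, x, c.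
have FA : enclosure AA F0 (h2 @^-1` A).
  apply: uO (mO _ _ a12 (C0F0 _ CA)) => v [e Av].
  by rewrite /preimage /= -e.
have [h3' [c3' r3' /enclosureP[E [eE [SE FE] Ea]]]] := MA4_chart hS c2 hA
  (in_chart_id AA (sector_chimney_splayed AA x bb)) (in_chart_id AA (F3 J)) SA FA.
apply: (conn_glue hS hG uO mO c1 c2 c3 c3').
- by rewrite r3.
- exact: a12.
- exact: C0F0.
- exact: uO Ea FE.
- exact: k13.
- exact: conn_thick c2 c3' eE (sector_chimney_thick bb eE SE) Ea.
Qed.

Lemma chimney_germ_thick b1 b J x E : is_base b1 -> is_base b -> is_encl E ->
  chimney_germ AA (germ x (translate x (bface b1 finset.set0))) (bface b J) E ->
  thick D E.
Proof.
move=> bb1 bb eE /(chimney_germ_encl _ _ _ bb1 bb eE)[xi bxi [Ex [c bc Exc] _]].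
by exists b1, (x + xi), c.
Qed.

Lemma chimney_germ_chamber_face b1 J1 b J x U : is_base b1 -> is_base b ->
  chimney_germ AA (germ x (translate x (bface b1 finset.set0))) (bface b J) U ->
  chimney_germ AA (germ x (translate x (bface b1 J1))) (bface b J) U.
Proof.
move=> bb1 bb /(chimney_germP _ _ _ _ _ bb1 bb)[xi [bxi [E [eE iE EU]]]].
apply/(chimney_germP _ _ _ _ _ bb1 bb); exists xi; split=> //.
by exists E; split=> //; exact: in_chimney_chamber_face bb1 eE iE.
Qed.

Lemma chimney_germ_MA3 b1 J1 b J x : is_base b1 -> is_base b ->
  solid D (chimney AA (germ x (translate x (bface b1 J1))) (bface b J)) ->
  MA3 (chimney_germ AA (germ x (translate x (bface b1 J1))) (bface b J)).
Proof.
move=> bb1 bb sC; right; exists (germ x (translate x (bface b1 J1))), (bface b J).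
split=> //; first by apply/local_faceP; exists b1, J1, x.
by apply/vectorial_faceP; exists b, J.
Qed.

(** The gluing takes place along the germ of the chimney, the only form of it that (MA3) and (MA4)
    accept. *)
Lemma conn_chimney b1 J1 b J x : is_base b1 -> is_base b ->
  solid D (chimney AA (germ x (translate x (bface b1 J1))) (bface b J)) ->
  conn_filter (chimney AA (germ x (translate x (bface b1 J1))) (bface b J)).
Proof.
move=> bb1 bb sC h1 h2 c1 c2 a12.
set F1 := germ x (translate x (bface b1 J1)).
set C1 := germ x (translate x (bface b1 finset.set0)).
have sC1 := solid_chamber AA J x bb1 bb.
have [A [hA SA CA]] := MA3_chart hS c2 c1
  (in_chart_id AA (sector_chimney_splayed AA x bb))
  (in_chart_id AA (chimney_germ_MA3 bb1 bb sC1)).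
have [h3 [c3 r3 a13]] := transportable_chimney_germ hS bb1 bb sC1 c1 hA CA.
have uO : upward (chimney_germ AA F1 (bface b J)) by exact: upward_chimney_germ.
have mO : closed_setI (chimney_germ AA F1 (bface b J)) by exact: meet_chimney_germ.
have a12' := chimney_sub_germ bb1 bb a12.
have k13 : conn h1 h3.
  have /(chimney_germP _ _ _ _ _ bb1 bb)[xi [bxi [E [eE [Ex [c bc Exc] _] Ea]]]] := a13.
  by apply: (conn_thick c1 c3 eE) Ea; exists b1, (x + xi), c.
have FA : chimney_germ AA F1 (bface b J) (h2 @^-1` A).
  apply: uO (mO _ _ a12' (chimney_germ_chamber_face J1 bb1 bb CA)) => v [e Av].
  by rewrite /preimage /= -e.
have [h3' [c3' r3' /enclosureP[E [eE [SE FE] Ea]]]] := MA4_chart hS c2 hA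
  (in_chart_id AA (sector_chimney_splayed AA x bb))
  (in_chart_id AA (chimney_germ_MA3 bb1 bb sC)) SA FA.
have rE : range h3 = range h3' by rewrite r3.
have a13' := chimney_germ_chamber_face J1 bb1 bb a13.
have a23' := uO _ _ Ea FE.
have k23 := conn_thick c2 c3' eE (sector_chimney_thick bb eE SE) Ea.
have [w [ww fw k]] := conn_glue hS hG uO mO c1 c2 c3 c3' rE a12' a13' a23' k13 k23.
(* So far [w] fixes a member of the germ; its fixed set is line closed, so it belongs to the chimney
   itself. *)
exists w; split=> //; apply: chimney_germ_line_closed => //.
exact: fixed_line_closed ww.
Qed.

Lemma conn_MA2 F : MA2_filter AA F -> conn_filter (enclosure AA F).
Proof.
move=> /MA2_filter_cases[[b [J [x [bb e]]]]|[b1 [J1 [b [J [x [bb1 bb sC e]]]]]]].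
  by rewrite (enclosure_ext e); exact: conn_face.
by rewrite (enclosure_ext e) /chimney enclosure_idem; exact: conn_chimney.
Qed.

(* [X'] is a thickening of [X]: the filter obtained by replacing a local face by
   a local chamber having it in its closure. *)
Definition thickening (X X' : set_system V) : Prop :=
  [/\ upward X, closed_setI X,
      forall E, is_encl E -> X' E -> X E /\ thick D E &
      forall U, X' U -> exists E, [/\ is_encl E, X' E & E `<=` U]].

Lemma thickening_fmap X X' w : Wa w -> thickening X X' ->
  thickening (fmap w X) (fmap w X').
Proof.
move=> ww [uX mX XE XU]; have [w' [ww' wK w'K]] := Wa_inv ww.
have wwE (U : set V) : w' @^-1` (w @^-1` U) = U.
  by rewrite eqEsubset; split=> v /=; rewrite w'K.
have wwE' (U : set V) : w @^-1` (w' @^-1` U) = U.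
  by rewrite eqEsubset; split=> v /=; rewrite wK.
split.
- by move=> U W UW; apply: uX => v; exact: UW.
- by move=> U W hU hW; exact: mX hU hW.
- move=> E eE X'E; have [XwE tE] := XE _ (is_encl_preimage ww eE) X'E.
  by split=> //; rewrite -[E]wwE; exact: (thick_preimage ww' tE).
- move=> U /XU[E [eE X'E EU]]; exists (w' @^-1` E); split.
  + exact: is_encl_preimage.
  + by rewrite /fmap /= wwE'.
  + by move=> v /EU /=; rewrite w'K.
Qed.

Lemma thickening_chimney_germ b1 J1 b J x : is_base b1 -> is_base b ->
  thickening (chimney_germ AA (germ x (translate x (bface b1 J1))) (bface b J))
    (chimney_germ AA (germ x (translate x (bface b1 finset.set0))) (bface b J)).
Proof.
move=> bb1 bb; split.
- exact: upward_chimney_germ.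
- exact: meet_chimney_germ.
- move=> E eE h; split; first exact: chimney_germ_chamber_face.
  exact: chimney_germ_thick h.
- move=> U /(chimney_germP _ _ _ _ _ bb1 bb)[xi [bxi [E [eE iE EU]]]].
  exists E; split=> //; apply/(chimney_germP _ _ _ _ _ bb1 bb); exists xi; split=> //.
  by exists E; split.
Qed.

Lemma thickening_face b J x : is_base b ->
  thickening (enclosure AA (germ x (translate x (bface b J))))
    (enclosure AA (germ x (translate x (bface b finset.set0)))).
Proof.
move=> bb; split.
- exact: upward_enclosure.
- by apply: meet_enclosure; exact: meet_germ.
- move=> E eE h; have {}h := sub_enclosure (@upward_germ _ _ _ _) h; split.
    by apply/enclosureP; exists E; split=> //; exact: germ_chamber_face bb eE h.
  by have /(germ_encl _ _ eE bb)[Ex [c bc Exc]] := h; exists b, x, c.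
- move=> U /enclosureP[E [eE h EU]]; exists E; split=> //.
  by apply/enclosureP; exists E; split.
Qed.

Lemma transportable_MA4 RR F : in_chart AA spl RR -> in_chart AA MA3 F ->
  transportable S (enclosure AA (RR `&` F)).
Proof.
move=> hR hF f A' cf hA' /enclosureP[E [eE [RE FE] EU]].
have uR := upward_in_chart (@upward_splayed _ _ _ _ AA) hR.
have uF := upward_in_chart (@upward_MA3 _ _ _ _ AA) hF.
by apply: MA4_chart => //; [exact: uR EU RE|exact: uF EU FE].
Qed.

Lemma conn_MA4 RR RR' F F' : in_chart AA spl RR -> in_chart AA spl RR' ->
  in_chart AA MA3 F -> in_chart AA MA3 F' ->
  thickening RR RR' -> thickening F F' -> conn_filter (enclosure AA (RR `&` F)).
Proof.
move=> sR sR' sF sF' [uR mR RE RU] [uF mF FE FU] h1 h2 c1 c2 a12.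
have uRF : upward (RR `&` F) by move=> U W UW [/(uR _ _ UW) ? /(uF _ _ UW)].
have mRF : closed_setI (RR `&` F).
  by move=> U W [? ?] [? ?]; split; [exact: mR|exact: mF].
have uO : upward (enclosure AA (RR `&` F)) by exact: upward_enclosure.
have mO : closed_setI (enclosure AA (RR `&` F)) by exact: meet_enclosure.
have [A [hA RA FA]] := MA3_chart hS c2 c1 sR' sF'.
have [Ra Fa] := sub_enclosure uRF a12.
have RA2 : RR (h2 @^-1` A).
  by have [E [eE R'E EU]] := RU _ RA; apply: uR EU _; case: (RE E eE R'E).
have FA1 : F (h1 @^-1` A).
  by have [E [eE F'E EU]] := FU _ FA; apply: uF EU _; case: (FE E eE F'E).
have RA1 : RR (h1 @^-1` A).
  by apply: uR (mR _ _ Ra RA2) => v [e Av]; rewrite /preimage /= e.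
have FA2 : F (h2 @^-1` A).
  by apply: uF (mF _ _ Fa FA1) => v [e Av]; rewrite /preimage /= -e.
(* Only one of the two filters is thickened on each side: [F] for [h1], [RR] for [h2]. This makes
   each comparison thick, while both still cover [RR] and [F]. *)
have [h3 [c3 r3 /enclosureP[E [eE [rE fE] Ea]]]] := MA4_chart hS c1 hA sR sF' RA1 FA.
have [h3' [c3' r3' /enclosureP[E' [eE' [rE' fE'] Ea']]]] :=
  MA4_chart hS c2 hA sR' sF RA FA2.
have [fE2 tE] := FE _ eE fE; have [rE2 tE'] := RE _ eE' rE'.
apply: (conn_glue hS hG uO mO c1 c2 c3 c3').
- by rewrite r3.
- exact: a12.
- by apply/enclosureP; exists E.
- by apply/enclosureP; exists E'.
- exact: conn_thick c1 c3 eE tE Ea.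
- exact: conn_thick c2 c3' eE' tE' Ea'.
Qed.

Lemma enclosure_fmap F w : Wa w -> enclosure AA (fmap w F) = fmap w (enclosure AA F).
Proof.
move=> ww; have [w' [ww' wK w'K]] := Wa_inv ww.
apply/funext => U; apply/propext; split=> /enclosureP[E [eE FE EU]].
  apply/enclosureP; exists (w @^-1` E); split=> //; first exact: is_encl_preimage.
  by move=> v /EU.
apply/enclosureP; exists (w' @^-1` E); split.
- exact: is_encl_preimage.
- by rewrite /fmap /= (_ : _ @^-1` _ = E) // eqEsubset; split=> v /=; rewrite wK.
- by move=> v /EU /=; rewrite w'K.
Qed.

Lemma good_MA2 A F f : apartments S A -> charts S A f ->
  in_apartment S A (MA2_filter AA) F -> good AA S G (chart_enclosure AA f F).
Proof.
move=> hA hf [f1 [F0 [hf1 F2 ->]]].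
have [rf fi cf] := apartment_chart hS hA hf.
have [rf1 f1i cf1] := apartment_chart hS hA hf1.
have [|w ww e] := chart_rel hS cf cf1; first by rewrite -rf.
rewrite e -[fmap (f \o w) F0]/(fmap f (fmap w F0)) chart_enclosureE //.
rewrite enclosure_fmap // -[fmap f _]/(fmap (f \o w) (enclosure AA F0)) -e.
apply: good_of_conn => //; first exact: upward_enclosure.
- case: (MA2_filter_cases F2) => [[b [J [x [bb eF]]]]|[b1 [J1 [b [J [x [bb1 bb _ eF]]]]]]].
    by rewrite (enclosure_ext eF); apply: meet_enclosure; exact: meet_germ.
  by rewrite (enclosure_ext eF); apply: meet_enclosure; exact: meet_chimney.
- exact: transportable_MA2.
- exact: conn_MA2.
Qed.

(** The germ may come from another apartment. (MA2), applied to a solid chimney representing it,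
    gives a chart of [A] in which it is the same chimney germ, so that it can be thickened there. *)
Lemma splayed_thickening f0 RR A : chart f0 -> apartments S A -> spl RR ->
  fmap f0 RR A -> exists f1, [/\ chart f1, range f1 = A, fmap f0 RR = fmap f1 RR &
    exists2 RR', spl RR' & thickening RR RR'].
Proof.
move=> c0 hA [F1 [Fv [/local_faceP[b1 [J1 [x [bb1 ->]]]] /spherical_faceP[b [J [bb sJ ->]]] ->]]] RA.
have sC := solid_spherical AA J1 x bb1 bb sJ.
have [f1 [c1 r1 a]] := transportable_chimney_germ hS bb1 bb sC c0 hA RA.
exists f1; split=> //.
  by apply: transport_fmap a; [exact: upward_chimney_germ|exact: meet_chimney_germ].
exists (chimney_germ AA (germ x (translate x (bface b1 finset.set0))) (bface b J)).
  exists (germ x (translate x (bface b1 finset.set0))), (bface b J); split=> //.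
    by apply/local_faceP; exists b1, finset.set0, x.
  by apply/spherical_faceP; exists b, J.
exact: thickening_chimney_germ.
Qed.

Lemma MA3_thickening f0 F A : chart f0 -> apartments S A -> MA3 F ->
  fmap f0 F A -> exists f1, [/\ chart f1, range f1 = A, fmap f0 F = fmap f1 F &
    exists2 F', MA3 F' & thickening F F'].
Proof.
move=> c0 hA [[F0 /local_faceP[b [J [x [bb ->]]]] ->]|] RA.
  have [f1 [c1 r1 a]] := transportable_face hS bb c0 hA RA.
  exists f1; split=> //.
    apply: transport_fmap a; first exact: upward_enclosure.
    by apply: meet_enclosure; exact: meet_germ.
  exists (enclosure AA (germ x (translate x (bface b finset.set0)))); last exact: thickening_face.
  left; exists (germ x (translate x (bface b finset.set0))) => //.
  by apply/local_faceP; exists b, finset.set0, x.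
case: RA => [F1 [Fv [/local_faceP[b1 [J1 [x [bb1 ->]]]] /vectorial_faceP[b [J [bb ->]]] sC ->]]] RA.
have [f1 [c1 r1 a]] := transportable_chimney_germ hS bb1 bb sC c0 hA RA.
exists f1; split=> //.
  by apply: transport_fmap a; [exact: upward_chimney_germ|exact: meet_chimney_germ].
exists (chimney_germ AA (germ x (translate x (bface b1 finset.set0))) (bface b J)).
  by apply: chimney_germ_MA3 => //; exact: solid_chamber.
exact: thickening_chimney_germ.
Qed.

Lemma good_MA4 RR F A f : in_hovel S spl RR -> in_hovel S MA3 F ->
  apartments S A -> charts S A f -> RR A -> F A ->
  good AA S G (chart_enclosure AA f (RR `&` F)).
Proof.
move=> [A0 hA0 [f0 [RR0 [hf0 R0 ->]]]] [A1 hA1 [f1 [F0 [hf1 F30 ->]]]] hA hf RA FA.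
have [_ _ c0] := apartment_chart hS hA0 hf0.
have [_ _ c1] := apartment_chart hS hA1 hf1.
have [rf fi cf] := apartment_chart hS hA hf.
have [g0 [cg0 rg0 -> [RR' R' tR]]] := splayed_thickening c0 hA R0 RA.
have [g1 [cg1 rg1 -> [F' F3' tF]]] := MA3_thickening c1 hA F30 FA.
have [|w0 ww0 e0] := chart_rel hS cf cg0; first by rewrite rg0.
have [|w1 ww1 e1] := chart_rel hS cf cg1; first by rewrite rg1.
rewrite e0 e1 -[_ `&` _]/(fmap f (fmap w0 RR0 `&` fmap w1 F0)) chart_enclosureE //.
have inR : in_chart AA spl (fmap w0 RR0) by exists w0 => //; exists RR0.
have inR' : in_chart AA spl (fmap w0 RR') by exists w0 => //; exists RR'.
have inF : in_chart AA MA3 (fmap w1 F0) by exists w1 => //; exists F0.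
have inF' : in_chart AA MA3 (fmap w1 F') by exists w1 => //; exists F'.
have tR' := thickening_fmap ww0 tR; have tF' := thickening_fmap ww1 tF.
apply: good_of_conn => //.
- exact: upward_enclosure.
- apply: meet_enclosure => U W [? ?] [? ?]; case: tR' => _ mR _ _; case: tF' => _ mF _ _.
  by split; [exact: mR|exact: mF].
- exact: transportable_MA4.
- exact: conn_MA4 inR inR' inF inF' tR' tF'.
Qed.

Lemma strongly_transitive_of_conn : strongly_transitive AA S G.
Proof. by split; [exact: good_MA2|exact: good_MA4]. Qed.

End ConnectedFilters.

(** * From sector germs to local chambers *)

Section RealInduction.
Context (R : realType).

Lemma real_induction (P : R -> Prop) (s1 : R) : P s1 ->
  (forall s t : R, s1 <= t <= s -> P s -> P t) ->
  (forall s : R, s1 <= s -> P s -> exists2 e : R, 0 < e & P (s + e)) ->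
  (forall s : R, s1 < s -> (forall t : R, s1 <= t < s -> P t) -> P s) ->
  forall s : R, s1 <= s -> P s.
Proof.
move=> P1 Pdown Pstep Plim s s1s; apply: contrapT => nPs.
pose Z := [set z | s1 <= z /\ P z].
have Zs z : Z z -> z <= s.
  move=> [s1z Pz]; rewrite leNgt; apply/negP => sz; apply: nPs.
  by apply: (Pdown z) Pz; rewrite s1s ltW.
have supZ : has_sup Z by split; [exists s1|exists s => z /Zs].
have s1Z : Z s1 by [].
set s0 := sup Z.
have s1s0 : s1 <= s0 by exact: (ub_le_sup supZ.2).
have below t : s1 <= t < s0 -> P t.
  move=> /andP[s1t ts0]; have [z [s1z Pz] tz] := sup_gt supZ.1 ts0.
  by apply: (Pdown z) Pz; rewrite s1t ltW.
have Ps0 : P s0.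
  by move: s1s0; rewrite le_eqVlt => /predU1P[<-//|s1s0]; exact: Plim.
have [e e0 Pse] := Pstep s0 s1s0 Ps0.
have : s0 + e <= s0.
  by apply: (ub_le_sup supZ.2); split=> //; rewrite ler_wpDr // ltW.
by rewrite gerDl leNgt e0.
Qed.

End RealInduction.

(** * Extension along a ray opposite to a sector germ *)

Section SectorGerms.
Context (R : realType) (V : vectType R) (I : finType) (D : vectorial_data V I).
Context (AA : model_apartment D) (Delta : Type) (S : apartment_system V Delta).
Hypothesis hS : affine_ordered_hovel AA S.
Context (G : set (Delta -> Delta)).
Hypothesis hG : bij_group G.
Local Notation is_base := (is_base D).
Local Notation is_encl := (is_encl AA).
Local Notation Wa := (Wa AA).
Local Notation MA3 := (MA3_filter AA).
Local Notation chart := (chart S).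
Local Notation conn := (conn G).
Local Notation sector := (sector_chimney_germ AA).

Lemma upward_sector b x : is_base b -> upward (sector b x).
Proof. by move=> bb; exact: upward_chimney_germ. Qed.

Lemma meet_sector b x : is_base b -> closed_setI (sector b x).
Proof. by move=> bb; exact: meet_chimney_germ. Qed.

Lemma face_MA3 b J x : is_base b -> MA3 (enclosure AA (germ x (translate x (bface b J)))).
Proof.
move=> bb; left; exists (germ x (translate x (bface b J))) => //.
by apply/local_faceP; exists b, J, x.
Qed.

(** An enclosed set in the sector germ has the closed chamber as recession directions, so the
    enclosure given by (MA4) for the germ and the point [y] contains the whole closed cone at
    [y]. *)
Lemma sector_spread b x y h A : is_base b -> chart h -> apartments S A ->
  sector b x (h @^-1` A) -> A (h y) ->
  exists h', [/\ chart h', range h' = A, sector b x (agree h h') &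
    forall c, (forall i, 0 <= ev (b i) c) -> h (y + c) = h' (y + c)].
Proof.
move=> bb ch hA SA Ahy.
pose F := germ y (translate y (bface b [set: I]%SET)).
have ptF : forall E, is_encl E -> globally [set y] E <-> F E.
  move=> E eE; split=> [Ey|/(germ_vertex_encl _ bb eE) Ey _ ->//].
  by apply/(germ_vertex_encl _ bb eE); exact: Ey.
have FA : enclosure AA F (h @^-1` A).
  have gy : MA2_filter AA (globally [set y]) by constructor 1; exists y.
  have yA : globally [set y] (h @^-1` A) by move=> _ ->.
  have [k [ck rk a]] := MA2_chart hS ch hA gy yA.
  rewrite -(enclosure_ext ptF); apply: upward_enclosure a => v e.
  by rewrite /preimage /= e -rk; exists v.
have [h' [ch' rh' /enclosureP[E [eE [SE FE] Ea]]]] := MA4_chart hS ch hA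
  (in_chart_id AA (sector_chimney_splayed AA x bb))
  (in_chart_id AA (face_MA3 [set: I]%SET y bb)) SA FA.
exists h'; split=> //; first exact: upward_sector Ea SE.
move=> c c0; apply: Ea.
have Ey : E y by apply/(germ_vertex_encl _ bb eE); exact: (sub_enclosure (@upward_germ _ _ _ _) FE).
have /(sector_chimney_encl _ bb eE)[xi bxi [_ Ec]] := SE.
have [d bd] := bface_nonempty finset.set0 bb.
apply: (encl_recession (x := x + xi) eE bb bd) Ey => //.
- by move=> i; rewrite finset.in_set0.
- by move=> t t0; apply: Ec; exact: bface_scale.
Qed.

(** The difference of the two points is regular, so a Weyl element fixing it is trivial. *)
Lemma chart_unique b h h' y xi (t1 t2 : R) : is_base b ->
  chart h -> chart h' -> range h = range h' -> bface b finset.set0 xi -> t1 < t2 ->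
  h (y + t1 *: xi) = h' (y + t1 *: xi) -> h (y + t2 *: xi) = h' (y + t2 *: xi) ->
  h = h'.
Proof.
move=> bb ch ch' rE bxi t12 e1 e2.
have [w ww hE] := chart_rel hS ch ch' rE; rewrite hE.
have f1 : w (y + t1 *: xi) = y + t1 *: xi.
  by apply: (chart_inj hS ch); rewrite e1 hE.
have f2 : w (y + t2 *: xi) = y + t2 *: xi.
  by apply: (chart_inj hS ch); rewrite e2 hE.
suff -> : w = id by [].
have [w0 [v0 [ww0 we]]] := Wa_affine ww.
have f3 : w0 ((t2 - t1) *: xi) = (t2 - t1) *: xi.
  have -> : (t2 - t1) *: xi = (y + t2 *: xi) - (y + t1 *: xi).
    by rewrite opprD addrACA subrr add0r scalerBl.
  by rewrite (weylB _ _ ww0) -{2}f1 -{2}f2 !we opprD addrACA subrr addr0.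
have t120 : 0 < t2 - t1 by rewrite subr_gt0.
have w0id : w0 = id.
  have b3 := bface_scale t120 bxi.
  by apply: (base_weyl_id bb ww0 b3); rewrite f3.
apply/funext => v; rewrite we w0id.
by move: f1; rewrite we w0id -[RHS]addr0 => /addrI ->; rewrite addr0.
Qed.

(** (MAO) identifies the segments as sets only, so nothing relates [s] to [t]. The reverse order of
    the end points is reduced to the direct one by exchanging them. *)
Lemma segment_chart f h x y x' y' (t : R) : chart f -> chart h ->
  f x = h x' -> f y = h y' -> tits_le D x y \/ tits_le D y x -> 0 <= t <= 1 ->
  exists2 s, 0 <= s <= 1 & f (x + t *: (y - x)) = h (x' + s *: (y' - x')).
Proof.
have flip (u v : V) (r : R) : u + r *: (v - u) = v + (1 - r) *: (u - v).
  by rewrite scalerBl scale1r addrA [v + (u - v)]addrC subrK -scalerN opprB.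
have main x1 y1 x1' y1' r : chart f -> chart h -> f x1 = h x1' -> f y1 = h y1' ->
    tits_le D x1 y1 -> 0 <= r <= 1 ->
    exists2 s, 0 <= s <= 1 & f (x1 + r *: (y1 - x1)) = h (x1' + s *: (y1' - x1')).
  move=> [hA cf] [hA' ch] ex ey le r01.
  have := hovel_MAO hS hA hA' cf ch ex ey le => e.
  have : (f @` segment x1 y1) (f (x1 + r *: (y1 - x1))).
    by exists (x1 + r *: (y1 - x1)) => //; exists r.
  by rewrite e => -[_ [s s01 <-] <-]; exists s.
move=> cf ch ex ey [le|le] t01; first exact: main.
have [|s s01 e] := main y x y' x' (1 - t) cf ch ey ex le.
  by move: t01; rewrite subr_ge0 lerBlDr lerDl andbC.
exists (1 - s); first by move: s01; rewrite subr_ge0 lerBlDr lerDl andbC.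
by rewrite flip e flip.
Qed.

Lemma face_chart b f A y xi : is_base b -> chart f -> apartments S A ->
  bface b finset.set0 xi ->
  enclosure AA (germ y (translate y (bface b finset.set0))) (f @^-1` A) ->
  exists h, [/\ chart h, range h = A & exists2 e : R, 0 < e &
    forall t : R, 0 <= t <= e -> f (y + t *: xi) = h (y + t *: xi)].
Proof.
move=> bb cf hA bxi FA.
have [h [ch rh /enclosureP[E [eE FE Ea]]]] := transportable_face hS bb cf hA FA.
exists h; split=> //.
have /(germ_encl _ _ eE bb)[Ey _] := FE.
have [N yN NE] := FE; have [e e0 he] := vnbhs_ray xi yN.
exists e => // t /andP[]; rewrite le_eqVlt => /predU1P[<- _|t0 te].
  by rewrite scale0r addr0; exact: Ea.
apply: Ea; apply: NE; split; first by exists (t *: xi) => //; exact: bface_scale.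
by apply: he; rewrite t0.
Qed.

Section Extension.
Context (f f' : V -> Delta) (b : I -> 'Hom(V, R^o)) (x xi : V) (e0 : R).
Hypotheses (cf : chart f) (cf' : chart f') (bb : is_base b).
Hypothesis bxi : bface b finset.set0 xi.
Hypothesis e0_gt0 : 0 < e0.
Local Notation p u := (x + u *: xi).

(* The ray of [f'] from [p e0] in the direction [- xi], down to [p (- s)], lies
   in a common apartment with the sector germ of [f]. *)
Definition extends (s : R) : Prop := exists h, [/\ chart h, sector b x (agree f h) &
  forall u : R, - s <= u <= e0 -> h (p u) = f' (p u)].

Lemma pD u t : p u + t *: xi = p (u + t).
Proof. by rewrite scalerDl addrA. Qed.

Lemma xi_ge0 (t : R) : 0 <= t -> forall i, 0 <= ev (b i) (t *: xi).
Proof. by move=> t0 i; rewrite evZ mulr_ge0 // (bface_ge0 bxi). Qed.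

Lemma sector_agree_preimage h A : sector b x (agree f h) -> sector b x (f @^-1` A) ->
  sector b x (h @^-1` A).
Proof.
move=> a SA; apply: (upward_sector bb) (meet_sector bb a SA) => v [e Av].
by rewrite /preimage /= -e.
Qed.

Lemma sector_agree_trans h h' : sector b x (agree f h) -> sector b x (agree h h') ->
  sector b x (agree f h').
Proof.
move=> a a'; apply: (upward_sector bb) (meet_sector bb a a') => v [e e'].
by rewrite /agree /= e e'.
Qed.

(** The local chamber at the limit point points back along [xi], so the new chart overlaps the
    previous ones in a segment of regular direction, which identifies it. *)
Lemma extends_limit (s0 : R) : - (e0 / 2) < s0 ->
  (forall t : R, - (e0 / 2) <= t < s0 -> extends t) -> extends s0.
Proof.
move=> s0e ext; have e0p := e0_gt0; pose y0 := p (- s0).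
have [A [hA SA CA]] := MA3_chart hS cf cf'
  (in_chart_id AA (sector_chimney_splayed AA x bb))
  (in_chart_id AA (face_MA3 finset.set0 y0 bb)).
have [h2 [c2 r2 [e epos f'h2]]] := face_chart bb cf' hA bxi CA.
(* The points at distances [d] and [2 d] from [y0] lie in the germ and below [p e0], and [s0 - d]
   remains in the range where extension is known. *)
pose d := Num.min (Num.min (e / 2) (e0 / 2)) (s0 + e0 / 2).
have d0 : 0 < d by rewrite /d !lt_min !divr_gt0 //=; lra.
have [de de0 ds] : [/\ d <= e / 2, d <= e0 / 2 & d <= s0 + e0 / 2].
  by split; rewrite /d !ge_min lexx ?orbT.
have [|h [ch Sh hf']] := ext (s0 - d); first by apply/andP; split; lra.
pose y := p (- s0 + d).
have hy : h y = f' y by apply: hf'; apply/andP; split; lra.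
have Ahy : A (h y).
  rewrite hy /y -pD f'h2; last by apply/andP; split; lra.
  by rewrite -r2; exists (y0 + d *: xi).
have [h' [ch' rh' Sh' spread]] := sector_spread bb ch hA (sector_agree_preimage Sh SA) Ahy.
have hh' (u : R) : - s0 + d <= u -> h (p u) = h' (p u).
  move=> du; have -> : p u = y + (u - (- s0 + d)) *: xi by rewrite /y pD; congr (_ + _ *: _); lra.
  by apply: spread; apply: xi_ge0; rewrite subr_ge0.
have h2h' : h2 = h'.
  apply: (@chart_unique b h2 h' y0 xi d (d + d) bb) => //.
  - by rewrite r2 rh'.
  - by rewrite ltrDr.
  - rewrite -f'h2; last by apply/andP; split; lra.
    by rewrite pD -hh' // hf' //; apply/andP; split; lra.
  - rewrite -f'h2; last by apply/andP; split; lra.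
    by rewrite pD -hh' ?hf' //; [apply/andP; split|]; lra.
exists h'; split=> //; first exact: sector_agree_trans Sh Sh'.
move=> u /andP[u1 u2]; have [ud|ud] := leP (- s0 + d) u.
  by rewrite -hh' // hf' //; apply/andP; split; lra.
rewrite -h2h'; have -> : p u = y0 + (u + s0) *: xi by rewrite pD; congr (_ + _ *: _); lra.
by rewrite f'h2 //; apply/andP; split; lra.
Qed.

(** In [A] the part of the ray above [y] is read by [h'], the part below by [h2 = h' o w], with [w]
    fixing [y]. By (MAO) [y] lies between the images of a lower and an upper point, so the linear
    part of [w] sends [xi] to a positive multiple of itself, preserves the chamber, and is
    trivial. *)
Lemma extends_step (s : R) : - (e0 / 2) <= s -> extends s -> exists2 e : R, 0 < e & extends (s + e).
Proof.
move=> se [h [ch Sh hf']]; have e0p := e0_gt0; pose y := p (- s).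
have bbN := is_baseN bb.
have bNxi : bface (fun i => - b i) finset.set0 (- xi) by apply/bfaceN; rewrite opprK.
have [A [hA SA CA]] := MA3_chart hS cf cf'
  (in_chart_id AA (sector_chimney_splayed AA x bb))
  (in_chart_id AA (face_MA3 finset.set0 y bbN)).
have [h2 [c2 r2 [e epos f'h2]]] := face_chart bbN cf' hA bNxi CA.
have hy : h y = f' y by apply: hf'; apply/andP; split; lra.
have f'y : f' y = h2 y.
  by have := f'h2 0; rewrite scale0r addr0; apply; rewrite lexx ltW.
have Ahy : A (h y) by rewrite hy f'y -r2; exists y.
have [h' [ch' rh' Sh' spread]] := sector_spread bb ch hA (sector_agree_preimage Sh SA) Ahy.
have hh' (u : R) : - s <= u -> h (p u) = h' (p u).
  move=> su; have -> : p u = y + (u + s) *: xi by rewrite pD; congr (_ + _ *: _); lra.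
  by apply: spread; apply: xi_ge0; lra.
have [|w ww wE] := chart_rel hS ch' c2; first by rewrite r2.
have [w0 [v0 [ww0 we]]] := Wa_affine ww.
have wy : w y = y.
  apply: (chart_inj hS ch'); rewrite -[LHS]/((h' \o w) y) -wE -f'y -hy.
  by apply: hh'.
pose a := y + e *: - xi.
have wa : w a = y - e *: w0 xi.
  rewrite we /a scalerN (weylB _ _ ww0) (weylZ _ _ ww0) addrAC -we wy //.
have q1 : f' a = h' (w a).
  by rewrite f'h2 ?wE //; apply/andP; split; lra.
have q2 : f' (p e0) = h' (p e0).
  by rewrite -hf' ?hh' //; [lra|apply/andP; split; lra].
have paE : p e0 - a = (e0 + s + e) *: xi.
  rewrite /a /y scalerN -scaleNr pD opprD addrACA subrr add0r -scalerBl.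
  by congr (_ *: _); lra.
have ese : 0 < e0 + s + e by lra.
have letits : tits_le D a (p e0) \/ tits_le D (p e0) a.
  by apply/tits_leP; exists b, finset.set0; split=> //; rewrite paE; exact: bface_scale.
pose t := e / (e0 + s + e).
have t01 : 0 <= t <= 1.
  apply/andP; split; first by rewrite divr_ge0 // ltW.
  by rewrite /t ler_pdivrMr // mul1r; lra.
have [r /andP[r0 r1]] := segment_chart cf' ch' q1 q2 letits t01.
have aE : a + e *: xi = y by rewrite /a scalerN subrK.
rewrite paE scalerA [t * _]divfK ?gt_eqF // aE.
have -> : f' y = h' y by rewrite -hy hh'.
move=> /(chart_inj hS ch') yE.
(* This is the position of [y] on the segment from [w a = y - e w0 xi] to
   [p e0 = y + (e0 + s) xi]. *)
have key : (1 - r) *: (e *: w0 xi) = r *: ((e0 + s) *: xi).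
  have p0 : p e0 = y + (e0 + s) *: xi by rewrite pD; congr (_ + _ *: _); lra.
  move: yE; rewrite wa p0; set W := e *: w0 xi; set K := (e0 + s) *: xi.
  rewrite [y + K - _](_ : _ = K + W); last by rewrite opprB addrC addrA subrK addrC.
  rewrite -addrA -{1}[y]addr0 => /addrI/esym/eqP.
  rewrite addrC subr_eq0 => /eqP e1.
  by rewrite scalerBl scale1r -{1}e1 scalerDr addrK.
have xi_n0 : xi != 0.
  have /card_gt0P[i _] := index_nonempty D.
  apply/eqP => xi0; case: bxi => _ /(_ i); rewrite finset.in_set0 => /(_ isT).
  by rewrite xi0 ev0 ltxx.
have es0 : 0 < e0 + s by lra.
have r1' : 0 < 1 - r.
  rewrite subr_gt0 lt_neqAle r1 andbT; apply/eqP => r1E; move/eqP: key.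
  rewrite r1E subrr scale0r scale1r eq_sym scaler_eq0 (negbTE xi_n0) orbF.
  by rewrite gt_eqF.
have re0 : 0 < (1 - r) * e by exact: mulr_gt0.
pose c := ((1 - r) * e)^-1 * (r * (e0 + s)).
have w0xi : w0 xi = c *: xi.
  apply: (scalerI (a := (1 - r) * e)); first by rewrite gt_eqF.
  by rewrite -scalerA key !scalerA /c mulrA divff ?mul1r // gt_eqF.
have c0 : 0 < c.
  have : 0 <= c.
    by apply: mulr_ge0; [rewrite invr_ge0 ltW|rewrite mulr_ge0 // ltW].
  rewrite le_eqVlt => /predU1P[cE|//]; move: w0xi; rewrite -cE scale0r => w0xi.
  have [w1 [_ wK _]] := weyl_inv ww0.
  have w00 : w0 0 = 0 by rewrite -[X in w0 X](scale0r xi) (weylZ _ _ ww0) scale0r.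
  have xi0 : xi = 0 by apply: (can_inj wK); rewrite w0xi w00.
  by move: xi_n0; rewrite xi0 eqxx.
have w0id : w0 = id.
  by apply: (base_weyl_id bb ww0 bxi); rewrite w0xi; exact: bface_scale.
have wid : w = id.
  apply/funext => v; rewrite we w0id.
  by move: wy; rewrite we w0id -[RHS]addr0 => /addrI ->; rewrite addr0.
have h2h' : h2 = h' by rewrite wE wid.
exists e => //; exists h'; split=> //; first exact: sector_agree_trans Sh Sh'.
move=> u /andP[u1 u2]; have [us|us] := leP (- s) u.
  by rewrite -hh' // hf' //; apply/andP; split; lra.
have -> : p u = y + (- s - u) *: - xi by rewrite scalerN -scaleNr pD; congr (_ + _ *: _); lra.
by rewrite -h2h' -f'h2 //; apply/andP; split; lra.
Qed.

End Extension.
End SectorGerms.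

(** * Comparison of the three conditions *)

Section Equivalences.
Context (R : realType) (V : vectType R) (I : finType) (D : vectorial_data V I).
Context (AA : model_apartment D) (Delta : Type) (S : apartment_system V Delta).
Hypothesis hS : affine_ordered_hovel AA S.
Context (G : set (Delta -> Delta)).
Hypothesis hG : bij_group G.
Local Notation is_base := (is_base D).
Local Notation is_encl := (is_encl AA).
Local Notation chart := (chart S).
Local Notation conn := (conn G).
Local Notation sector := (sector_chimney_germ AA).

Lemma conn_chamber_of_sector :
  (forall f f' b x, chart f -> chart f' -> is_base b -> sector b x (agree f f') ->
    conn f f') ->
  forall f f' b x, chart f -> chart f' -> is_base b ->
    germ x (translate x (bface b finset.set0)) (agree f f') -> conn f f'.
Proof.
move=> conn_sector f f' b x cf cf' bb [N xN NE].
have bbN := is_baseN bb.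
have [xi bxi] := bface_nonempty finset.set0 bb.
have [e0 e0p he0] := vnbhs_ray xi xN.
have ff' u : 0 < u <= e0 -> f (x + u *: xi) = f' (x + u *: xi).
  move=> ue; apply: NE; split; last exact: he0.
  by exists (u *: xi) => //; apply: bface_scale => //; case/andP: ue.
(* The agreement of [f] and [f'] on the ray is obtained for [u > 0] only; starting at [- (e0 / 2)]
   needs just the segment from [e0 / 2] to [e0], where [h = f] works. *)
have ext : forall s, - (e0 / 2) <= s -> extends AA S f f' b x xi e0 s.
  apply: real_induction.
  - exists f; split=> //; last by move=> u /andP[u1 u2]; apply: ff'; apply/andP; split; lra.
    by apply: (upward_sector bb (U := setT)) => //; apply/(sector_chimney_encl _ bb (is_enclT AA)); exists xi.
  - move=> s t /andP[_ ts] [h [ch Sh hf']]; exists h; split=> // u /andP[u1 u2].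
    by apply: hf'; apply/andP; split; lra.
  - move=> s; exact: extends_step.
  - move=> s; exact: extends_limit.
have [A [hA SA SA']] := MA3_chart hS cf cf'
  (in_chart_id AA (sector_chimney_splayed AA x bb))
  (in_chart_id AA (sector_chimney_MA3 AA x bbN)).
have /(chimney_germP _ _ _ _ _ bbN bbN)[eta [beta [E' [eE' [_ _ E'v] E'A]]]] := SA'.
have [s s0 bs] := chamber_open eta bb bxi.
(* With this [t], [x - t xi = x + eta - t (xi + s eta)] lies in the part of the opposite sector
   contained in [A]. *)
pose t := s^-1; have t0 : 0 < t by rewrite invr_gt0.
have [h [ch Sh hf']] : extends AA S f f' b x xi e0 t by apply: ext; lra.
pose y := x + (- t) *: xi.
have hy : h y = f' y by apply: hf'; rewrite lexx /=; lra.
have Ahy : A (h y).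
  rewrite hy; apply: E'A.
  have -> : y = x + eta + (- t) *: (xi + s *: eta).
    rewrite scalerDr scalerA mulNr mulVf ?gt_eqF // scaleN1r addrACA.
    by rewrite subrr addr0.
  apply: E'v; apply/bfaceN; rewrite -scaleNr opprK; exact: bface_scale.
have Shf : sector b x (h @^-1` A) by exact: (sector_agree_preimage bb Sh SA).
have [h3 [c3 r3 S3 spread]] := sector_spread hS bb ch hA Shf Ahy.
have h3f' u : - t <= u <= e0 -> h3 (x + u *: xi) = f' (x + u *: xi).
  move=> ut; rewrite -hf' //.
  have -> : x + u *: xi = y + (u + t) *: xi.
    by rewrite /y -addrA -scalerDl; congr (_ + _ *: _); lra.
  apply/esym/spread => i; rewrite evZ mulr_ge0 ?(bface_ge0 bxi) //.
  by case/andP: ut; lra.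
have k3 : conn f h3.
  by apply: (conn_sector f h3 b x) => //; exact: (sector_agree_trans bb Sh S3).
have x1 : bface b finset.set0 (x + e0 *: xi - x).
  by rewrite addrAC subrr add0r; exact: bface_scale.
have segA : germ x (segment_oc x (x + e0 *: xi)) (f' @^-1` A).
  exists setT; first exact: vnbhsT.
  move=> _ [[r /= /andP[r0 r1] <-] _]; rewrite /preimage /= addrAC subrr add0r scalerA.
  rewrite -h3f'; first by rewrite -r3; exists (x + (r * e0) *: xi).
  apply/andP; split; last by rewrite ler_piMl // ltW.
  by rewrite (@le_trans _ _ 0) ?mulr_ge0 ?ltW ?oppr_lt0.
have seg2 : MA2_filter AA (germ x (segment_oc x (x + e0 *: xi))).
  constructor 2; exists x, (x + e0 *: xi); split=> //; last first.
    by apply/tits_leP; exists b, finset.set0.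
  move=> /(congr1 (fun v => v - x)); rewrite subrr => x0; case: x1 => _.
  have /card_gt0P[i _] := index_nonempty D.
  by move=> /(_ i); rewrite finset.in_set0 -x0 ev0 ltxx => /(_ isT).
have CA : enclosure AA (germ x (translate x (bface b finset.set0))) (f' @^-1` A).
  have [k [ck rk a]] := MA2_chart hS cf' hA seg2 segA.
  rewrite -(enclosure_ext (fun E eE => germ_segment_encl eE bb x1)).
  by apply: upward_enclosure a => v e; rewrite /preimage /= e -rk; exists v.
have [h4 [c4 r4 /enclosureP[E [eE [SE CE] Ea]]]] := MA4_chart hS cf' hA
  (in_chart_id AA (sector_chimney_splayed AA x bbN))
  (in_chart_id AA (face_MA3 AA finset.set0 x bb)) SA' CA.
have {}CE := sub_enclosure (@upward_germ _ _ _ _) CE.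
have [M xM ME] := CE; have [e ep he] := vnbhs_ray xi xM.
have f'h4 u : 0 < u <= e -> f' (x + u *: xi) = h4 (x + u *: xi).
  move=> ue; apply: Ea; apply: ME; split; last exact: he.
  by exists (u *: xi) => //; apply: bface_scale => //; case/andP: ue.
pose d := Num.min e e0.
have d0 : 0 < d by rewrite lt_min ep e0p.
have [de de0] : d <= e /\ d <= e0 by rewrite /d !ge_min !lexx ?orbT.
(* [h3] comes from the sector germ of [f] and [h4] from the opposite one of [f']; as charts of [A]
   agreeing with [f'] at two points of the ray, they coincide. *)
have h34 : h3 = h4.
  apply: (chart_unique (y := x) (xi := xi) (t1 := d / 2) (t2 := d) hS bb) => //.
  - by rewrite r3.
  - lra.
  - by rewrite h3f' ?f'h4 //; apply/andP; split; lra.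
  - by rewrite h3f' ?f'h4 //; apply/andP; split; lra.
apply: (conn_trans hG k3); rewrite h34; apply: (conn_sym hG).
apply: (conn_sector f' h4 (fun i => - b i) x) => //.
exact: upward_sector Ea SE.
Qed.

Lemma conn_chamber_of_good :
  (forall C, in_hovel S (local_chamber D) C -> good AA S G C) ->
  forall f f' b x, chart f -> chart f' -> is_base b ->
    germ x (translate x (bface b finset.set0)) (agree f f') -> conn f f'.
Proof.
move=> gC f f' b x cf cf' bb a.
apply: (conn_of_good hS _ _ _ _ cf cf' a).
- exact: upward_germ.
- exact: meet_germ.
- by move=> U; exact: spanning_germ.
apply: gC; exists (range f); first by case: cf.
exists f, (germ x (translate x (bface b finset.set0))); split=> //; first by case: cf.
exists x, (bface b finset.set0); split=> //.
by apply/vectorial_chamberP; exists b.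
Qed.

Definition sector_filter (b : I -> 'Hom(V, R^o)) (x : V) : set_system V :=
  [set U | exists t, translate t (translate x (bface b finset.set0)) `<=` U].

Lemma meet_sector_filter b x : is_base b -> closed_setI (sector_filter b x).
Proof.
move=> bb U W [t tU] [t' t'W].
(* This [v] dominates both [t] and [t'] for the order of [b], so the sector translated by [v] lies
   in both translates. *)
have [v ve] := base_dual (fun i => `|ev (b i) t| + `|ev (b i) t'|) bb.
exists v => _ [_ [c bc <-] <-].
have sub u : (forall i, ev (b i) u <= ev (b i) v) ->
    translate u (translate x (bface b finset.set0)) (v + (x + c)).
  move=> uv; exists (x + (v - u + c)).
    exists (v - u + c) => //; case: bc => _ c1.
    split=> i iJ; first by rewrite finset.in_set0 in iJ.
    by have := c1 i iJ; have := uv i; rewrite !evE; lra.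
  by rewrite [v - u + c]addrAC addrCA (addrC u) subrK addrCA.
split; [apply: tU|apply: t'W]; apply: sub => i; rewrite ve.
  by have := ler_norm (ev (b i) t); have := normr_ge0 (ev (b i) t'); lra.
by have := ler_norm (ev (b i) t'); have := normr_ge0 (ev (b i) t); lra.
Qed.

Lemma upward_sector_filter b x : upward (sector_filter b x).
Proof. by move=> U W UW [t tU]; exists t => v /tU/UW. Qed.

Lemma conn_sector_of_good :
  (forall Q, in_hovel S (sector_germ D) Q -> good AA S G Q) ->
  forall f f' b x, chart f -> chart f' -> is_base b -> sector b x (agree f f') ->
    conn f f'.
Proof.
move=> gQ f f' b x cf cf' bb a.
have {}a : sector_filter b x (agree f f') by exact: sector_chimney_sector a.
apply: (conn_of_good hS _ _ _ _ cf cf' a).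
- exact: upward_sector_filter.
- exact: meet_sector_filter.
- move=> U [t tU]; apply: (spanning_sector (x := t + x) bb) => _ [c bc <-].
  by apply: tU; exists (x + c); [exists c|rewrite addrA].
apply: gQ; exists (range f); first by case: cf.
exists f, (sector_filter b x); split=> //; first by case: cf.
exists x, (bface b finset.set0); split=> //.
by apply/vectorial_chamberP; exists b.
Qed.

Lemma strong_MA2 F f A : strongly_transitive AA S G -> chart f ->
  MA2_filter AA F -> apartments S A -> F (f @^-1` A) -> forall A',
  apartments S A' -> F (f @^-1` A') -> exists g, [/\ G g, A' = g @` A,
    weyl_isomorphism AA S A A' g & exists2 X, fmap f (enclosure AA F) X &
      forall x, X x -> g x = x].
Proof.
move=> [st _] cf F2 hA FA A' hA' FA'; have [hr hf] := cf.
have := st _ _ _ hr hf (in_apartment_fmap cf F2).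
rewrite chart_enclosureE; last exact: (chart_inj hS cf).
have encl B : apartments S B -> F (f @^-1` B) -> fmap f (enclosure AA F) B.
  move=> hB FB; have [k [ck rk a]] := MA2_chart hS cf hB F2 FB.
  by apply: upward_enclosure a => v e; rewrite /preimage /= e -rk; exists v.
move=> /(_ A A' hA hA' (encl A hA FA) (encl A' hA' FA'))[g [Gg fg AE wg]].
by exists g.
Qed.

(** Strong transitivity is applied to a filter of (MA2) inside the chamber germ with the same
    enclosure. *)
Lemma good_chamber_of_strong : strongly_transitive AA S G ->
  forall C, in_hovel S (local_chamber D) C -> good AA S G C.
Proof.
move=> st C [A0 hA0 [f [C0 [hf [x [Cv [/vectorial_chamberP[b [bb ->]] ->]]] ->]]]].
move=> A A' hA hA' CA CA'; have [_ _ cf] := apartment_chart hS hA0 hf.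
have [F [F2 CF FC]] := local_face_MA2 AA finset.set0 x bb.
have [g [Gg AE wg [X /enclosureP[E [eE FE EX]] gX]]] :=
  strong_MA2 st cf F2 hA (CF _ CA) hA' (CF _ CA').
exists g; split=> //; exists X => //.
by apply: upward_germ EX _; apply/(FC _ eE).
Qed.

(** A ray in the open chamber direction is generic, and its enclosure contains the sector with the
    same origin. *)
Lemma good_sector_of_strong : strongly_transitive AA S G ->
  forall Q, in_hovel S (sector_germ D) Q -> good AA S G Q.
Proof.
move=> st Q [A0 hA0 [f [Q0 [hf [x [Cv [/vectorial_chamberP[b [bb ->]] QE]]] ->]]]].
rewrite {Q0}QE -/(sector_filter b x).
move=> A A' hA hA' QA QA'; have [_ _ cf] := apartment_chart hS hA0 hf.
have [t tAA'] := meet_sector_filter bb QA QA'.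
have [c bc] := bface_nonempty finset.set0 bb.
(* The extra [c] puts the origin of the ray inside the open sector common to [A] and [A']. *)
pose y := t + x + c.
have inA r : 0 <= r -> (f @^-1` A `&` f @^-1` A') (y + r *: c).
  move=> r0; apply: tAA'; exists (x + (c + r *: c)); last by rewrite /y !addrA.
  exists (c + r *: c) => //; rewrite -[X in X + _]scale1r -scalerDl.
  by apply: bface_scale bc; lra.
have ycE : y + c - y = c by rewrite addrAC subrr add0r.
have F2 : MA2_filter AA (globally (ray y (y + c))).
  constructor 3; exists y, (y + c); split=> //; last first.
    apply/tits_ltP; exists b, finset.set0; rewrite ycE; split=> //.
    exact: spherical_type0.
  move=> /(congr1 (fun v => v - y)); rewrite subrr ycE => c0; case: bc => _.
  have /card_gt0P[i _] := index_nonempty D.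
  by move=> /(_ i); rewrite finset.in_set0 -c0 ev0 ltxx => /(_ isT).
have FA : globally (ray y (y + c)) (f @^-1` A).
  by move=> _ [r /= r0 <-]; rewrite ycE; case: (inA r r0).
have FA' : globally (ray y (y + c)) (f @^-1` A').
  by move=> _ [r /= r0 <-]; rewrite ycE; case: (inA r r0).
have [g [Gg AE wg [X /enclosureP[E [eE FE EX]] gX]]] :=
  strong_MA2 st cf F2 hA FA hA' FA'.
exists g; split=> //; exists X => //.
exists (t + c) => _ [_ [c' bc' <-] <-]; apply: EX.
have -> : t + c + (x + c') = y + c' by rewrite /y addrACA addrA.
have rayE r : 0 <= r -> E (y + r *: c).
  by move=> r0; apply: FE; exists r => //; rewrite ycE.
apply: (encl_recession (x := y) eE bb bc).
- by move=> i; rewrite finset.in_set0.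
- exact: bface_ge0 bc'.
- by move=> r r0; apply: rayE; exact: ltW.
- by have := rayE 0; rewrite scale0r addr0; apply.
Qed.

End Equivalences.

Theorem proposition5p3 (R : realType) (V : vectType R) (I : finType)
    (D : vectorial_data V I) (AA : model_apartment D)
    (Delta : Type) (S : apartment_system V Delta)
    (hS : affine_ordered_hovel AA S)
    (G : set (Delta -> Delta)) (hG : bij_group G)
    (hGaut : forall g, G g -> automorphism AA S g)
    (hGweyl : forall g, G g -> vectorially_weyl AA S g) :
  (strongly_transitive AA S G <->
     (forall C, in_hovel S (local_chamber D) C -> good AA S G C)) /\
  (strongly_transitive AA S G <->
     (forall Q, in_hovel S (sector_germ D) Q -> good AA S G Q)).
Proof.
have strong_of_chamber : (forall C, in_hovel S (local_chamber D) C -> good AA S G C) ->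
    strongly_transitive AA S G.
  move=> gC; apply: (strongly_transitive_of_conn hS hG).
  exact: (conn_chamber_of_good hS gC).
have strong_of_sector : (forall Q, in_hovel S (sector_germ D) Q -> good AA S G Q) ->
    strongly_transitive AA S G.
  move=> gQ; apply: (strongly_transitive_of_conn hS hG).
  exact: (conn_chamber_of_sector hS hG (conn_sector_of_good hS gQ)).
split; split=> //.
- exact: good_chamber_of_strong.
- exact: good_sector_of_strong.
Qed.
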